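(* Let $k,n$ be positive integers, $m$ an integer with $0\le m\le n$, $0\le\alpha\le1$, $\gamma=k$ if $\alpha=0$ and $\gamma=(k,\alpha)$ if $\alpha>0$, $A\subset\mathbf R^n$, $a\in\operatorname{Clos}A$, $S\in\mathbf G(n,m)$, $0\le\kappa<\infty$, and suppose $$A\subset\{\chi:|S^\perp_\natural(\chi-a)|\le\kappa|S_\natural(\chi-a)|\}.$$ Consider one of two versions: the pointwise version (P), in which $\sigma:=1$, or the strong version (S), in which $\sigma:=\gamma$. In each version the following three conditions are equivalent. (1) There exists an $m$-dimensional submanifold $B$ of class $\gamma$ of $\mathbf R^n$ which satisfies the conditions in the definition of pointwise differentiability of order $\gamma$ of $A$ at $a$ (version (P)), respectively in the definition of strong pointwise differentiability of order $\gamma$ of $A$ at $a$ (version (S)). (2) The set $S_\natural(A)=\{S_\natural(\chi):\chi\in A\}$ is strongly pointwise differentiable of order $\sigma$ at $S_\natural(a)$ with $\operatorname{Tan}(S_\natural(A),S_\natural(a))=S$, and there exists an $m$-dimensional submanifold $B$ of class $\gamma$ of $\mathbf R^n$ such that $a\in B$ and $$\lim_{r\to0+}r^{-k}\sup\{\operatorname{dist}(x,B):x\in A\cap\mathbf B(a,r)\}=0\ \text{ if }\alpha=0,$$ $$\limsup_{r\to0+}r^{-k-\alpha}\sup\{\operatorname{dist}(x,B):x\in A\cap\mathbf B(a,r)\}<\infty\ \text{ if }\alpha>0.$$ (3) The set $S_\natural(A)$ is strongly pointwise differentiable of order $\sigma$ at $S_\natural(a)$ with $\operatorname{Tan}(S_\natural(A),S_\natural(a))=S$,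 and there exists a function $f:S\to S^\perp$ of class $\gamma$ satisfying $$\lim_{r\to0+}r^{-k}\sup\{|S^\perp_\natural(\chi)-f(S_\natural(\chi))|:\chi\in A,\ S_\natural(\chi)\in\mathbf B(S_\natural(a),r)\}=0\ \text{ if }\alpha=0,$$ $$\limsup_{r\to0+}r^{-k-\alpha}\sup\{|S^\perp_\natural(\chi)-f(S_\natural(\chi))|:\chi\in A,\ S_\natural(\chi)\in\mathbf B(S_\natural(a),r)\}<\infty\ \text{ if }\alpha>0.$$ If these conditions hold, then the $k$-jet $P$ at $S_\natural(a)$ of a function $f$ as in (3) is uniquely determined by $k$, $A$ and $(a,S)$, and the following three additional statements hold. (4) An $m$-dimensional submanifold $B$ of class $\gamma$ of $\mathbf R^n$ satisfies (1) if and only if there exists a function $f:S\to S^\perp$ of class $\gamma$ such that $B\cap U=\{\chi+f(\chi):\chi\in S\}\cap U$ for some neighbourhood $U$ of $a$ and the $k$-jet of $f$ at $S_\natural(a)$ equals $P$. (5) An $m$-dimensional submanifold $B$ of class $\gamma$ of $\mathbf R^n$ satisfies (2) if and only if there exists a function $f:S\to S^\perp$ of class $\gamma$ such that $B\cap U=\{\chi+f(\chi):\chi\in S\}\cap U$ for some neighbourhood $U$ of $a$ and the $k$-jet of $f$ at $S_\natural(a)$ equals $P$. (6) A function $f:S\to S^\perp$ of class $\gamma$ satisfies (3) if and only if its $k$-jet at $S_\natural(a)$ equals $P$.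
   Context: Notation. $\mathbf B(a,r)$ is the closed ball; $\operatorname{dist}(x,A)=\inf\{|x-b|:b\in A\}$. $\mathbf G(n,m)$ is the set of $m$-dimensional linear subspaces of $\mathbf R^n$; for $S\in\mathbf G(n,m)$, $S_\natural$ is the orthogonal projection of $\mathbf R^n$ onto $S$, $S^\perp$ the orthogonal complement and $S^\perp_\natural$ the orthogonal projection onto $S^\perp$. $\operatorname{Tan}(A,a)$ is the set of $v\in\mathbf R^n$ such that for every $\varepsilon>0$ there are $x\in A$, $0<r<\infty$ with $|x-a|<\varepsilon$ and $|r(x-a)-v|<\varepsilon$. A map is of class $k$ if its domain is open and it is $k$ times continuously differentiable, and of class $(k,\alpha)$, $0<\alpha\le1$, if moreover its $k$-th differential is locally Hölder continuous with exponent $\alpha$. The $k$-jet of $f$ at $x$ is the Taylor polynomial function $\chi\mapsto\sum_{i=0}^k\frac1{i!}\mathrm D^if(x)(\chi-x,\dots,\chi-x)$. $B\subset\mathbf R^n$ is an $m$-dimensional submanifold of class $\gamma$ if each $b\in B$ has an open neighbourhood $U$ with a diffeomorphism $f$ of class $\gamma$ (both $f,f^{-1}$ of class $\gamma$) from $U$ onto an open subset of $\mathbf R^n$ and $T\in\mathbf G(n,m)$ with $f(B\cap U)=T\cap\operatorname{im}f$. Definition. $A\subset\mathbf R^n$ is pointwise differentiable of order $\gamma$ at $a$ if there exists a submanifold $B$ of class $\gamma$ of $\mathbf R^n$ such that $a\in B$, $\lim_{r\to0+}r^{-1}\sup\{|\operatorname{dist}(x,A)-\operatorname{dist}(x,B)|:x\in\mathbf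 B(a,r)\}=0$, and $\lim_{r\to0+}r^{-k}\sup\{\operatorname{dist}(x,B):x\in A\cap\mathbf B(a,r)\}=0$ if $\alpha=0$, respectively $\limsup_{r\to0+}r^{-k-\alpha}\sup\{\operatorname{dist}(x,B):x\in A\cap\mathbf B(a,r)\}<\infty$ if $\alpha>0$. $A$ is strongly pointwise differentiable of order $\gamma$ at $a$ if there exists a submanifold $B$ of class $\gamma$ with $a\in B$, $\lim_{r\to0+}r^{-1}\sup\{|\operatorname{dist}(x,A)-\operatorname{dist}(x,B)|:x\in\mathbf B(a,r)\}=0$, and $\lim_{r\to0+}r^{-k}\sup\{|\operatorname{dist}(x,A)-\operatorname{dist}(x,B)|:x\in\mathbf B(a,r)\}=0$ if $\alpha=0$, respectively $\limsup_{r\to0+}r^{-k-\alpha}\sup\{|\operatorname{dist}(x,A)-\operatorname{dist}(x,B)|:x\in\mathbf B(a,r)\}<\infty$ if $\alpha>0$. (Order $1$ means $(k,\alpha)=(1,0)$.) *)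

(* Defs.v *)
From HB Require Import structures.
From mathcomp Require Import all_boot all_order all_algebra.
From mathcomp Require Import all_classical all_reals all_analysis.
From mathcomp Require Import ring lra.
Set Implicit Arguments.
Unset Strict Implicit.
Unset Printing Implicit Defensive.
Import Order.TTheory GRing.Theory Num.Theory.
Import numFieldNormedType.Exports.
Local Open Scope classical_set_scope.
Local Open Scope ring_scope.

(** Row vectors carry the sup norm in the library; [euclid R n] is the same
    vector space with the Euclidean norm. *)
Definition euclid (R : realType) (n : nat) : Type := 'rV[R]_n.

HB.instance Definition _ (R : realType) (n : nat) :=
  Vector.copy (euclid R n) 'rV[R]_n.

Definition edot (R : realType) (n : nat) (x y : euclid R n) : R :=
  \sum_(i < n) (x : 'rV[R]_n) ord0 i * (y : 'rV[R]_n) ord0 i.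

Definition enorm (R : realType) (n : nat) (x : euclid R n) : R :=
  Num.sqrt (edot x x).

Section EuclideanSpace.
Variables (R : realType) (n : nat).
Implicit Types (x y : euclid R n).

Fact edotC x y : edot x y = edot y x.
Proof. by apply: eq_bigr => i _; rewrite mulrC. Qed.

Fact edot_linear y : scalar (fun x => edot x y).
Proof.
move=> c u v; rewrite /edot mulr_sumr -big_split; apply: eq_bigr => i _.
by rewrite !mxE mulrDl mulrA.
Qed.

Fact edot_ge0 x : 0 <= edot x x.
Proof. by apply: sumr_ge0 => i _; rewrite -expr2 sqr_ge0. Qed.

Fact edot_eq0 x : edot x x = 0 -> x = 0.
Proof.
move=> /eqP; rewrite psumr_eq0; last by move=> i _; rewrite -expr2 sqr_ge0.
move=> /allP x0; apply/rowP => i; rewrite mxE.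
by have := x0 i (mem_index_enum i); rewrite -expr2 sqrf_eq0 => /eqP.
Qed.

Fact edot_isBilinear :
  bilinear_for *%R *%R (@edot R n : euclid R n -> euclid R n -> R).
Proof.
split; first exact: edot_linear.
by move=> x c u v; rewrite !(edotC x) edot_linear.
Qed.

HB.instance Definition _ := bilinear_isBilinear.Build R
  (euclid R n) (euclid R n) R *%R (idfun \; *%R) (@edot R n) edot_isBilinear.

Fact edot_hermitian x y :
  edot x y = (-1) ^+ false * @idfun R (edot y x).
Proof. by rewrite expr0 mul1r edotC. Qed.

HB.instance Definition _ := isHermitianSesquilinear.Build R
  (euclid R n) false idfun (@edot R n) edot_hermitian.

Fact enorm_ge0 x : 0 <= enorm x.
Proof. exact: sqrtr_ge0. Qed.

Fact edotDl x y z : edot (x + y : euclid R n) z = edot x z + edot y z.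
Proof. by rewrite -[in LHS](scale1r x) edot_linear mul1r. Qed.

Fact edotZl c x y : edot (c *: x : euclid R n) y = c * edot x y.
Proof.
rewrite -[c *: x]addr0 edot_linear -[X in _ + X](_ : 0 = _) ?addr0//.
by rewrite /edot big1// => i _; rewrite mxE mul0r.
Qed.

Fact edot_le x y : edot x y <= enorm x * enorm y.
Proof.
rewrite /enorm -sqrtrM ?edot_ge0//.
have [y0|y0] := eqVneq (edot y y) 0.
  rewrite (edot_eq0 y0) /edot big1 ?sqrtr_ge0// => i _.
  by rewrite mxE mulr0.
have yy : 0 < edot y y by rewrite lt_def y0 edot_ge0.
have := edot_ge0 (edot y y *: x + - edot x y *: y).
rewrite edotDl !edotZl !(edotC _ (_ + _)) !edotDl !edotZl (edotC y x) => h.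
have {h} : 0 <= edot y y * (edot x x * edot y y - edot x y ^+ 2).
  by apply: le_trans h _; rewrite le_eqVlt; apply/orP; left; apply/eqP; ring.
rewrite pmulr_rge0// subr_ge0 => h.
by apply: le_trans (ler_norm _) _; rewrite -sqrtr_sqr ler_wsqrtr.
Qed.

Fact enormD x y : enorm (x + y : euclid R n) <= enorm x + enorm y.
Proof.
rewrite -(@ler_pXn2r _ 2)// ?nnegrE ?addr_ge0 ?enorm_ge0//.
rewrite sqrrD /enorm !sqr_sqrtr ?edot_ge0//.
rewrite edotDl !(edotC _ (x + y : euclid R n)) !edotDl (edotC y x).
by have := edot_le x y; rewrite /enorm; lra.
Qed.

Fact enormZ (c : R) x : enorm (c *: x : euclid R n) = `|c| * enorm x.
Proof.
by rewrite /enorm edotZl edotC edotZl mulrA -expr2 sqrtrM ?sqr_ge0// sqrtr_sqr.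
Qed.

Fact enorm_eq0 x : enorm x = 0 -> x = 0.
Proof.
move=> /eqP; rewrite sqrtr_eq0 => x0; apply: edot_eq0.
by apply/eqP; rewrite eq_le x0 edot_ge0.
Qed.

HB.instance Definition _ := Lmodule_isNormed.Build R (euclid R n)
  enormD enormZ enorm_eq0.

End EuclideanSpace.

Section SubspaceNorm.
Variables (R : realType) (n : nat) (S : {vspace euclid R n}).
Implicit Types (u v : subvs_of S).

Definition subvs_norm u : R := `|vsval u|.

Fact subvs_normD u v : subvs_norm (u + v) <= subvs_norm u + subvs_norm v.
Proof. exact: ler_normD. Qed.

Fact subvs_normZ (c : R) u : subvs_norm (c *: u) = `|c| * subvs_norm u.
Proof. exact: normrZ. Qed.

Fact subvs_norm_eq0 u : subvs_norm u = 0 -> u = 0.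
Proof. by move=> /normr0_eq0 u0; apply/val_inj. Qed.

HB.instance Definition _ := Lmodule_isNormed.Build R (subvs_of S)
  subvs_normD subvs_normZ subvs_norm_eq0.

End SubspaceNorm.

Definition orthc (R : realType) (n : nat) (S : {vspace euclid R n}) :
  {vspace euclid R n} := orthov (@edot R n) S.

Section OrthogonalProjection.
Variables (R : realType) (n : nat) (S : {vspace euclid R n}).

Fact orthc_capv : (S :&: orthc S = 0)%VS.
Proof.
apply/eqP; rewrite -subv0; apply/subvP => v; rewrite memv_cap => /andP[vS].
by move=> /mem_orthovP/(_ v vS)/edot_eq0 ->; rewrite mem0v.
Qed.

Fact orthc_addv : (S + orthc S = fullv)%VS.
Proof.
apply/eqP; rewrite eqEdim subvf/= dimv_disjoint_sum ?orthc_capv//.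
suff h d (F : 'I_d -> 'Hom(euclid R n, R^o)) :
    (\dim {:euclid R n} <= d + \dim (\bigcap_(i < d) lker (F i))%VS)%N by exact: h.
elim: d F => [|d ih] F; first by rewrite big_ord0 add0n.
rewrite big_ord_recr/= addSnnS.
apply: leq_trans (ih (fun i => F (widen_ord (leqnSn d) i))) _.
rewrite leq_add2l.
set V := (\bigcap_(i < d) _)%VS.
rewrite -(limg_ker_dim (F ord_max) V) addnC -add1n leq_add2r.
by apply: leq_trans (dimvS (subvf _)) _; rewrite dimvf.
Qed.

Definition oproj (x : euclid R n) : subvs_of S :=
  Subvs (memv_pi S (orthc S) x).

Fact oproj_id x : x \in S -> vsval (oproj x) = x.
Proof. exact: daddv_pi_id orthc_capv. Qed.

Fact oproj_orth x : x - vsval (oproj x) \in orthc S.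
Proof.
rewrite -[X in X - _](@daddv_pi_add _ _ _ _ x orthc_capv).
  by rewrite addrC addKr memv_pi.
by rewrite orthc_addv memvf.
Qed.

End OrthogonalProjection.

Definition closedB (R : realType) (V : normedModType R) (a : V) (r : R) :
  set V := closed_ball_ Num.norm a r.

(** Valued in [\bar R]: the distance to the empty set is [+oo]. *)
Definition edist_set (R : realType) (V : normedModType R) (x : V) (A : set V) :
  \bar R := ereal_inf [set `|x - b|%:E | b in A].

Definition tangent_cone (R : realType) (V : normedModType R) (A : set V)
    (a : V) : set V :=
  [set v | forall e : R, 0 < e -> exists x (r : R),
     [/\ A x, 0 < r, `|x - a| < e & `|r *: (x - a) - v| < e]].

Section Differentials.
Variables (R : realType) (V W : normedModType R).

(** [iterdiff f [:: v1; ...; vi] x] is the value [D^i f(x)(v1, ..., vi)]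
    of the i-th Frechet differential. *)
Fixpoint iterdiff (f : V -> W) (vs : seq V) : V -> W :=
  if vs is v :: vs' then fun x => 'd (iterdiff f vs') x v else f.

(** [f] restricted to [U] is of class [k] (if [alpha = 0]) or [(k, alpha)]
    (if [0 < alpha]).  The i-th differential takes values in multilinear maps;
    these form a finite dimensional space when [V] and [W] are such, so that
    differentiability and continuity may be tested after evaluation at
    [vs].  The bound in the Hoelder condition is one on the operator norm. *)
Definition of_class (k : nat) (alpha : R) (U : set V) (f : V -> W) : Prop :=
  [/\ open U,
      forall vs, (size vs < k)%N ->
        forall x, U x -> differentiable (iterdiff f vs) x,
      forall vs, size vs = k ->
        forall x, U x -> {for x, continuous (iterdiff f vs)} &
      0 < alpha -> forall x, U x -> exists2 N, nbhs x N & exists C : R,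
        forall y z, N y -> N z -> forall vs, size vs = k ->
          `|iterdiff f vs y - iterdiff f vs z|
            <= C * `|y - z| `^ alpha * \prod_(v <- vs) `|v| ].

Definition jet (k : nat) (f : V -> W) (x : V) : V -> W :=
  fun y => \sum_(i < k.+1) (i`!%:R)^-1 *: iterdiff f (nseq i (y - x)) x.

End Differentials.

Section PointwiseDifferentiability.
Variables (R : realType) (n : nat).
Local Notation E := (euclid R n).
Implicit Types (k m : nat) (alpha : R) (A B : set E) (a : E).

Definition diffeo k alpha (U : set E) (f g : E -> E) : Prop :=
  [/\ of_class k alpha U f, of_class k alpha (f @` U) g &
      forall x, U x -> g (f x) = x].

Definition submanifold k alpha m B : Prop :=
  forall b, B b -> exists (U : set E) (f g : E -> E) (T : {vspace E}),
    [/\ U b, diffeo k alpha U f g, \dim T = m &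
        f @` (B `&` U) = [set` T] `&` (f @` U)].

(** [h(r) = o(r^k)] if [alpha = 0], [h(r) = O(r^(k + alpha))] otherwise, as
    [r] tends to [0+]. *)
Definition small_order k alpha (h : R -> \bar R) : Prop :=
  if alpha == 0 then ((r ^- k)%:E * h r)%E @[r --> 0^'+] --> 0%E
  else (limf_esup (fun r => (r `^ (- (k%:R + alpha)))%:E * h r) 0^'+ < +oo)%E.

Definition excess A B a (r : R) : \bar R :=
  ereal_sup [set edist_set x B | x in A `&` closedB a r].

Definition gap A B a (r : R) : \bar R :=
  ereal_sup [set `|edist_set x A - edist_set x B|%E | x in closedB a r].

Definition pdiff_conditions k alpha A a B : Prop :=
  [/\ B a, small_order 1 0 (gap A B a) & small_order k alpha (excess A B a)].

Definition strong_pdiff_conditions k alpha A a B : Prop :=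
  [/\ B a, small_order 1 0 (gap A B a) & small_order k alpha (gap A B a)].

Definition strongly_pointwise_differentiable k alpha A a : Prop :=
  exists m B, submanifold k alpha m B /\ strong_pdiff_conditions k alpha A a B.

End PointwiseDifferentiability.

Inductive version := Pointwise | Strong.

Section Conditions.
Variables (R : realType) (n : nat) (ver : version) (k : nat) (alpha : R).
Variables (A : set (euclid R n)) (a : euclid R n) (S : {vspace euclid R n}).
Implicit Types (B : set (euclid R n)) (f P : subvs_of S -> subvs_of (orthc S)).

Definition condition1 B : Prop :=
  match ver with
  | Pointwise => pdiff_conditions k alpha A a B
  | Strong => strong_pdiff_conditions k alpha A a B
  end.

Definition shadow : set (euclid R n) := [set vsval (oproj S x) | x in A].

Definition shadow_condition : Prop :=
  match ver with
  | Pointwise => strongly_pointwise_differentiable 1 0 shadow (vsval (oproj S a))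
  | Strong =>
      strongly_pointwise_differentiable k alpha shadow (vsval (oproj S a))
  end /\ tangent_cone shadow (vsval (oproj S a)) = [set` S].

Definition condition2 B : Prop :=
  [/\ shadow_condition, B a & small_order k alpha (excess A B a)].

Definition condition3 f : Prop :=
  shadow_condition /\
  small_order k alpha (fun r => ereal_sup
    [set `|oproj (orthc S) x - f (oproj S x)|%:E
       | x in A `&` [set x | closedB (oproj S a) r (oproj S x)]]).

Definition graph_of f : set (euclid R n) := [set vsval x + vsval (f x) | x in setT].

Definition local_graph_with_jet B P : Prop :=
  exists f, [/\ of_class k alpha setT f,
    exists2 U, nbhs a U & B `&` U = graph_of f `&` U &
    jet k f (oproj S a) = P].

End Conditions.

(* Main.v *)
(** Both smallness conditions are pointwise: "[sup q = o(r^k)] (or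
    [O(r^(k+alpha))]) over the points at distance at most [r]" says
    [q x <= e |x - a|^(k+alpha)] near [a], for every (or for some) [e].  In this
    form the gap of [A] and [B] is small if and only if the two excesses
    [dist(., B)] on [A] and [dist(., A)] on [B] are.

    Suppose that [B] is near [a] the graph of [f : S -> S^perp].  By the cone
    condition, [|x - a|] and [|S(x - a)|] are comparable on [A], and [f] is
    locally Lipschitz; hence the excess of [A] over [B] is comparable to
    [|S^perp x - f(S x)|] on [A], and, once this is small, the excess of [B]
    over [A] is comparable to the distance to the shadow [S(A)] on [S].  The
    smallness of the latter at order [sigma] is equivalent to the condition on
    the shadow, by the same comparison with [A] replaced by [S(A)].

    It remains to see that [B] is such a graph, i.e. that its tangent plane,
    the preimage of [T] under the derivative of the chart, is transversal to
    [S^perp].  For (1), a tangent vector in [S^perp] would give points of [B],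
    hence of [A], violating the cone condition.  For (2), the tangent vectors of
    the shadow are projections of tangent vectors of [B], so that the plane
    projects onto [S].  If [F] is the chart and [N] is linear, onto
    [S^perp] and with kernel [T], then [x |-> S x + N (F x)] is invertible near
    [a], and the [S^perp] part of its inverse on [S], composed with a smooth
    retraction of [S] to a small ball, is the required function on all of [S].

    Two functions satisfying (3) differ by [o(|s - S a|^k)] on [S(A)], whose
    tangent cone is [S]; so all homogeneous Taylor terms of the difference up to
    degree [k] vanish.  Conversely, by Taylor's formula, equality of the jets
    gives the estimate in (3). *)
Require Import Defs.
From HB Require Import structures.
From mathcomp Require Import all_boot all_order all_algebra.
From mathcomp Require Import all_classical all_reals all_analysis.
From mathcomp Require Import ring lra.
Set Implicit Arguments.
Unset Strict Implicit.
Unset Printing Implicit Defensive.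
Import Order.TTheory GRing.Theory Num.Theory.
Import numFieldNormedType.Exports.
Local Open Scope classical_set_scope.
Local Open Scope ring_scope.

(** * Differentiability and the mean value inequality *)

Section Differentiability.
Variable R : realType.
Implicit Types V W : normedModType R.

(** Classes (k, alpha) are handled through a recursion on directional derivatives; finite dimension
    turns its estimates in fixed directions into operator norm bounds. The inverse function theorem
    is proved for these classes because the function over S comes from inverting a map built from
    the chart, and its inverse must keep the Hölder exponent.

    The two versions differ only in the order at which the shadow fills S, equivalently at which A
    approximates B, so one argument runs with two orders: k + alpha for A over B, and a second one
    that is either 1 or again k + alpha.

    The submanifold attached to the shadow has no prescribed dimension. The shadow lies in S, hence
    satisfies the cone condition with constant 0, which bounds that dimension above by m; a tangent
    cone equal to S bounds it below.

    The jet P must depend neither on alpha nor on the version, so functions with different exponents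
    are compared; both are weakened to exponent 0 and error o(r^k). As a lies only in the closure of
    A, even the value of f at S a is found by a limit. *)

Lemma near_normP V (x : V) (P : V -> Prop) :
  (\forall y \near x, P y) <->
  exists2 d : R, 0 < d & forall y, `|y - x| < d -> P y.
Proof.
split=> [/nbhs_ballP[d /= d0 h]|[d d0 h]].
  by exists d => // y yx; apply: h; rewrite -ball_normE/= distrC.
by apply/nbhs_ballP; exists d => //= y; rewrite -ball_normE/= distrC; exact: h.
Qed.

Lemma diff_epsP V W (f : V -> W) x (e : R) : differentiable f x -> 0 < e ->
  \forall y \near x, `|f y - f x - 'd f x (y - x)| <= e * `|y - x|.
Proof.
move=> /diff_locallyP[_ fd] e0.
have /eqaddoP/(_ _ e0) := fd.
move=> /near_normP[d d0 h]; apply/near_normP; exists d => // y yx.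
have := h (y - x); rewrite subr0 => /(_ yx) /=.
by rewrite !fctE /= subrK opprD addrA.
Qed.

Lemma eps_diff V W (f : V -> W) (L : {linear V -> W}) x :
  continuous L ->
  (forall e : R, 0 < e ->
     \forall y \near x, `|f y - f x - L (y - x)| <= e * `|y - x|) ->
  differentiable f x /\ 'd f x = L :> (V -> W).
Proof.
move=> cL h.
have fL : f \o shift x = cst (f x) + L +o_ (0 : V) id.
  apply/eqaddoP => e e0; have /near_normP[d d0 {}h] := h e e0.
  apply/near_normP; exists d => // y; rewrite subr0 => yd.
  have := h (y + x); rewrite addrK => /(_ yd).
  by rewrite !fctE /= opprD addrA.
have dE : 'd f x = L :> (V -> W) by exact: diff_unique.
split=> //; apply/diff_locallyP; rewrite dE; split=> //.
Qed.

Lemma near_eq_diff V W (f g : V -> W) x : (\forall y \near x, f y = g y) ->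
  differentiable f x -> differentiable g x /\ 'd g x = 'd f x :> (V -> W).
Proof.
move=> fg df; apply: eps_diff; first exact: diff_continuous.
move=> e e0; have fx := nbhs_singleton fg.
apply: filterS2 fg (diff_epsP df e0) => y fgy.
by rewrite fgy fx.
Qed.

Definition has_vderiv W (g : R -> W) (t : R) (w : W) :=
  forall e : R, 0 < e ->
    \forall u \near t, `|g u - g t - (u - t) *: w| <= e * `|u - t|.

(** A vector-valued curve satisfies no mean value equality, so the bound is continued along the
    interval. With slope [M + e], the supremum of the points where it holds satisfies it too, and,
    were it below [T], differentiability there would carry the bound further. *)
Lemma mean_value_le W (g dg : R -> W) (M T : R) : 0 <= T ->
  (forall t : R, 0 <= t <= T -> has_vderiv g t (dg t)) ->
  (forall t : R, 0 <= t <= T -> `|dg t| <= M) -> `|g T - g 0| <= M * T.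
Proof.
move=> T0 gd dM; apply/ler_addgt0Pr => e' e'0; pose e := e' / (T + 1).
have e0 : 0 < e by rewrite divr_gt0// ltr_wpDl.
have eT : e * T <= e'.
  rewrite /e mulrAC ler_pdivrMr ?ltr_wpDl//; apply: ler_wpM2l; first exact: ltW.
  by rewrite lerDl.
suff : `|g T - g 0| <= (M + e) * T.
  by move=> /le_trans; apply; rewrite mulrDl lerD2l.
pose A := [set t : R | 0 <= t <= T /\ `|g t - g 0| <= (M + e) * t].
have A0 : A 0 by split; rewrite ?lexx ?T0// subrr normr0 mulr0.
have supA : has_sup A by split; [exists 0|exists T => t [/andP[]]].
have s0 : 0 <= sup A by apply: ub_le_sup A0; case: supA.
have sT : sup A <= T by apply: ge_sup; [exists 0|move=> t [/andP[]]].
set s := sup A in s0 sT.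
have s0T : 0 <= s <= T by rewrite s0.
have /near_normP[d d0 dP] := gd s s0T e e0.
(* This holds on both sides of [s]: on the left it brings the bound to [s], on the right it carries
   the bound beyond [s]. *)
have Ms u : `|u - s| < d -> `|g u - g s| <= (M + e) * `|u - s|.
  move=> /dP h.
  have -> : g u - g s = (g u - g s - (u - s) *: dg s) + (u - s) *: dg s.
    by rewrite subrK.
  apply: le_trans (ler_normD _ _) _; rewrite normrZ mulrDl addrC lerD//.
  by rewrite mulrC ler_wpM2r// dM.
have [u Au] := sup_adherent d0 supA; rewrite -/s => us.
have ules : u <= s by apply: ub_le_sup Au; case: supA.
have Ps : `|g s - g 0| <= (M + e) * s.
  have -> : g s - g 0 = (g s - g u) + (g u - g 0) by rewrite addrA subrK.
  apply: le_trans (ler_normD _ _) _.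
  have us' : `|u - s| < d by rewrite ler0_norm; lra.
  have := Ms u us'; rewrite distrC (ler0_norm (_ : u - s <= 0)); last lra.
  by have [_] := Au; lra.
have [s_ltT|] := ltP s T; last first.
  move=> s_geT; have s_eqT : s = T by apply/eqP; rewrite eq_le sT.
  by move: Ps; rewrite s_eqT.
pose v := Num.min T (s + d / 2).
have vs : s < v by rewrite lt_min s_ltT/=; lra.
have vT : v <= T by rewrite ge_min lexx.
have vd : v - s <= d / 2 by rewrite lerBlDl ge_min lexx orbT.
have vsd : `|v - s| < d by rewrite gtr0_norm; lra.
have Av : A v.
  split; first by apply/andP; lra.
  have -> : g v - g 0 = (g v - g s) + (g s - g 0) by rewrite addrA subrK.
  apply: le_trans (ler_normD _ _) _.
  by have := Ms v vsd; rewrite gtr0_norm; lra.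
have : v <= s by apply: ub_le_sup Av; case: supA.
lra.
Qed.

Lemma has_vderivD W (g h : R -> W) (t : R) v w :
  has_vderiv g t v -> has_vderiv h t w -> has_vderiv (g \+ h) t (v + w).
Proof.
move=> gv hw e e0; have e2 : 0 < e / 2 by rewrite divr_gt0.
apply: filterS2 (gv _ e2) (hw _ e2) => u gu hu /=.
have -> : g u + h u - (g t + h t) - (u - t) *: (v + w) =
    (g u - g t - (u - t) *: v) + (h u - h t - (u - t) *: w).
  by rewrite scalerDr (opprD (g t)) (addrACA (g u)) (opprD (_ *: v)) [LHS]addrACA.
by apply: le_trans (ler_normD _ _) _; lra.
Qed.

Lemma diff_vderiv W (g : R -> W) (t : R) :
  differentiable g t -> has_vderiv g t ('d g t 1).
Proof.
move=> dg e e0; apply: filterS (diff_epsP dg e0) => u.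
suff -> : 'd g t (u - t) = (u - t) *: 'd g t 1 by [].
by rewrite -linearZ/= /GRing.scale/= mulr1.
Qed.

Lemma vderiv_monomial W (w : W) (c t : R) n :
  has_vderiv (fun u => (c * u ^+ n.+1) *: w) t ((c * n.+1%:R * t ^+ n) *: w).
Proof.
have dm : derivable (fun u : R => c * u ^+ n.+1) t 1.
  by apply: derivableM => //; exact: exprn_derivable.
have dM : differentiable (fun u : R => c * u ^+ n.+1) t.
  exact/derivable1_diffP.
have := diff_vderiv (differentiableZl w dM); rewrite diffZl//.
rewrite -deriveE// deriveM//=; last exact: exprn_derivable.
rewrite derive_cst scaler0 addr0 exp_derive /GRing.scale/= mulr1.
by rewrite -[c * _ * _]mulrA.
Qed.

Lemma vderiv_line V W (f : V -> W) x v (t : R) :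
  differentiable f (x + t *: v) ->
  has_vderiv (fun u => f (x + u *: v)) t ('d f (x + t *: v) v).
Proof.
move=> df e e0; have v0 : 0 < `|v| + 1 by rewrite ltr_wpDl.
have e'0 : 0 < e / (`|v| + 1) by rewrite divr_gt0.
have /near_normP[d d0 dP] := diff_epsP df e'0.
apply/near_normP; exists (d / (`|v| + 1)); first by rewrite divr_gt0.
move=> u ut; have uvE : (x + u *: v) - (x + t *: v) = (u - t) *: v.
  by rewrite opprD addrACA subrr add0r scalerBl.
have uv : `|(u - t) *: v| <= `|u - t| * (`|v| + 1).
  by rewrite normrZ ler_wpM2l// lerDl.
have := dP (x + u *: v); rewrite uvE linearZ/= => h.
apply: le_trans (h _) _.
  by apply: le_lt_trans uv _; rewrite -ltr_pdivlMr.
apply: le_trans (ler_wpM2l (ltW e'0) uv) _.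
by rewrite [_ * (_ + 1)]mulrC mulrA divfK// gt_eqF.
Qed.

Lemma mean_value_segment V W (f : V -> W) x y (M : R) :
  (forall t : R, 0 <= t <= 1 -> differentiable f (x + t *: (y - x)) /\
     `|'d f (x + t *: (y - x)) (y - x)| <= M) -> `|f y - f x| <= M.
Proof.
move=> h.
have := @mean_value_le _ (fun u => f (x + u *: (y - x)))
  (fun t => 'd f (x + t *: (y - x)) (y - x)) M 1 ler01.
rewrite mulr1 scale1r scale0r addr0 (addrC x) subrK; apply=> t /h[]//.
by move=> + _; exact: vderiv_line.
Qed.

Lemma ball_convex V (a x y : V) (r t : R) : `|x - a| < r -> `|y - a| < r ->
  0 <= t <= 1 -> `|x + t *: (y - x) - a| < r.
Proof.
move=> xr yr /andP[t0 t1].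
have -> : x + t *: (y - x) - a = (1 - t) *: (x - a) + t *: (y - a).
  rewrite !scalerBr !scalerBl !scale1r opprB addrACA.
  rewrite -!addrA; congr (x + _); rewrite !addrA.
  by rewrite [RHS]addrAC addrK [- _ + _]addrC.
apply: le_lt_trans (ler_normD _ _) _; rewrite !normrZ !ger0_norm; [|lra|lra].
have [->|tn0] := eqVneq t 0; first by rewrite subr0 mul1r mul0r addr0.
have t_gt0 : 0 < t by rewrite lt_def tn0.
have := ltr_pM2l t_gt0 (`|y - a|) r; rewrite yr => yr'.
have := ler_wpM2l (_ : 0 <= 1 - t) (ltW xr); lra.
Qed.

(** A spanning family with continuous coordinate functionals that may fail to be dual to it; in this
    form the notion passes to retracts such as subspaces. The inverse function theorem asks for
    duality separately. *)
Definition findim V := exists d (e : 'I_d -> V) (l : 'I_d -> {linear V -> R}),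
  (forall i, continuous (l i)) /\ forall x, x = \sum_i l i x *: e i.

Lemma findim_linear_continuous V W (L : {linear V -> W}) :
  findim V -> continuous L.
Proof.
move=> [d [e [l [lc xE]]]].
have -> : (L : V -> W) = \sum_i (fun x => l i x *: L (e i)).
  apply/funext => x; rewrite {1}(xE x) linear_sum fct_sumE.
  by apply: eq_bigr => i _; rewrite linearZ.
move=> x; elim/big_ind : _ => [|f g fc gc|i _]; first exact: cvg_cst.
  exact: continuousD.
by apply: continuousZl; [exact: lc].
Qed.
End Differentiability.

(** * Functions of class (k, alpha) *)

Section Class.
Variable R : realType.
Implicit Types V W : normedModType R.

Definition holder_at V W (alpha : R) (f : V -> W) (x : V) :=
  exists2 N, nbhs x N & exists C : R,
    forall y z, N y -> N z -> `|f y - f z| <= C * `|y - z| `^ alpha.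

(** Unlike [iterdiff], which differentiates last the head of the list, this
    recursion takes the directional derivative first; induction on [k] then
    generalizes over the function. *)
Fixpoint Cclass V W (k : nat) (alpha : R) (U : set V) (f : V -> W) : Prop :=
  if k is k'.+1 then
    (forall x, U x -> differentiable f x) /\
    (forall v, Cclass k' alpha U (fun x => 'd f x v))
  else forall x, U x ->
    {for x, continuous f} /\ (0 < alpha -> holder_at alpha f x).

Lemma iterdiff_rcons V W (f : V -> W) vs v :
  iterdiff f (rcons vs v) = iterdiff (fun x => 'd f x v) vs.
Proof. by elim: vs => //= w vs ->. Qed.

Lemma Cclass_eq V W k alpha (U : set V) (f g : V -> W) : open U ->
  (forall x, U x -> f x = g x) -> Cclass k alpha U f -> Cclass k alpha U g.
Proof.
move=> oU; elim: k f g => [|k ih] f g fg /=.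
  move=> h x Ux; have [fc fh] := h x Ux; split.
    have UN : nbhs x U by apply: open_nbhs_nbhs.
    have gx : g y @[y --> x] --> f x.
      apply: cvg_trans fc; apply: near_eq_cvg.
      by apply: filterS UN => y Uy; rewrite fg.
    by move: gx; rewrite fg.
  move=> /fh[N Nx [C NC]]; exists (N `&` U).
    by apply: filterI => //; apply: open_nbhs_nbhs.
  by exists C => y z [Ny Uy] [Nz Uz]; rewrite -!fg//; exact: NC.
move=> [df dC].
have gf x : U x -> differentiable g x /\ 'd g x = 'd f x :> (V -> W).
  move=> Ux; apply: near_eq_diff; last exact: df.
  have UN : nbhs x U by apply: open_nbhs_nbhs.
  by apply: filterS UN => y Uy; exact: fg.
split=> [x /gf[]//|v]; apply: ih (dC v) => x /gf[_ ->//].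
Qed.

Lemma of_class_Cclass V W k alpha (U : set V) (f : V -> W) :
  of_class k alpha U f -> Cclass k alpha U f.
Proof.
move=> [oU]; elim: k f => [|k ih] f /= df cf hf.
  move=> x Ux; split; first exact: (cf [::]).
  move=> /hf/(_ x Ux)[N Nx [C NC]]; exists N => //; exists C => y z Ny Nz.
  by have := NC y z Ny Nz [::] erefl; rewrite big_nil mulr1.
split=> [x Ux|v]; first exact: (df [::]).
apply: ih => [vs vsk|vs vsk|a0 x Ux].
- by rewrite -iterdiff_rcons; apply: df; rewrite size_rcons.
- by rewrite -iterdiff_rcons; apply: cf; rewrite size_rcons vsk.
have [N Nx [C NC]] := hf a0 x Ux; exists N => //; exists (C * `|v|).
move=> y z Ny Nz vs vsk; rewrite -!iterdiff_rcons.
have := NC y z Ny Nz (rcons vs v); rewrite size_rcons vsk => /(_ erefl).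
rewrite -cats1 big_cat big_seq1 /= !mulrA.
by move/le_trans; apply; rewrite -!mulrA; do 2 (rewrite [leRHS]mulrCA mulrA);
   rewrite le_eqVlt; apply/orP; left; apply/eqP; ring.
Qed.

Lemma Cclass_iterdiff V W j alpha (U : set V) (f : V -> W) vs :
  Cclass (j + size vs) alpha U f -> Cclass j alpha U (iterdiff f vs).
Proof.
elim/last_ind: vs f => [|vs v ih] f; first by rewrite addn0.
by rewrite size_rcons addnS iterdiff_rcons => -[_ /(_ v)]; exact: ih.
Qed.

Lemma Cclass_iterdiff_differentiable V W k alpha (U : set V) (f : V -> W) vs x :
  Cclass k alpha U f -> (size vs < k)%N -> U x ->
  differentiable (iterdiff f vs) x.
Proof.
move=> fC vsk; have /Cclass_iterdiff : Cclass (k - size vs + size vs) alpha U f.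
  by rewrite subnK// ltnW.
by rewrite -subn_gt0 in vsk; case: (k - _)%N vsk => // j _ [+ _]; exact.
Qed.

Lemma diff_lincomb V W d (c : 'I_d -> R) (g : 'I_d -> V -> W) x :
  (forall i, differentiable (g i) x) ->
  differentiable (fun y => \sum_i c i *: g i y) x /\
  forall v, 'd (fun y => \sum_i c i *: g i y) x v = \sum_i c i *: 'd (g i) x v.
Proof.
move=> dg.
suff [? h] : is_diff x (fun y => \sum_i c i *: g i y)
    (fun v => \sum_i c i *: 'd (g i) x v).
  by split=> // v; rewrite h.
have -> : (fun y => \sum_i c i *: g i y) = \sum_i (c i *: g i).
  by apply/funext => y; rewrite fct_sumE.
have -> : (fun v => \sum_i c i *: 'd (g i) x v) =
    \sum_i (c i *: ('d (g i) x : V -> W)).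
  by apply/funext => y; rewrite fct_sumE.
elim/big_ind2 : _ => [|f f' h h' ? ?|i _]; first exact: is_diff_cst.
  exact: is_diffD.
by apply: is_diffZ; apply: differentiableP.
Qed.

Lemma iterdiff_lincomb V W (U : set V) d (c : 'I_d -> R) (g : 'I_d -> V -> W)
    vs (x : V) : open U ->
  (forall i ws (y : V), (size ws < size vs)%N -> U y ->
     differentiable (iterdiff (g i) ws) y) -> U x ->
  iterdiff (fun y => \sum_i c i *: g i y) vs x =
    \sum_i c i *: iterdiff (g i) vs x.
Proof.
move=> oU; elim: vs x => //= v vs ih x dg Ux.
have near_sum : \forall y \near x, \sum_i c i *: iterdiff (g i) vs y =
    iterdiff (fun y => \sum_i c i *: g i y) vs y.
  have UN : nbhs x U by apply: open_nbhs_nbhs.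
  apply: filterS UN => y Uy; rewrite ih// => i ws z wsvs Uz.
  by apply: dg => //; exact: ltnW.
have [ds dE] := diff_lincomb c (fun i => dg i vs x (ltnSn _) Ux).
by have [_ ->] := near_eq_diff near_sum ds; rewrite dE.
Qed.

(** * Iterated differentials in coordinates *)

Section Multilinear.
Variables (V W : normedModType R) (d : nat) (e : 'I_d -> V).
Variables (l : 'I_d -> {linear V -> R}) (lc : forall i, continuous (l i)).
Hypothesis lE : forall x, x = \sum_i l i x *: e i.

(** The innermost differential is linear in its direction at every point, and the remaining
    differentiations commute with the resulting linear combination of functions. *)
Lemma iterdiff_rconsE k alpha (U : set V) (f : V -> W) vs v x : open U ->
  Cclass k alpha U f -> (size vs < k)%N -> U x ->
  iterdiff f (rcons vs v) x = \sum_i l i v *: iterdiff f (rcons vs (e i)) x.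
Proof.
move=> oU fC vsk Ux; rewrite iterdiff_rcons.
have -> : (fun y => 'd f y v) = (fun y => \sum_i l i v *: 'd f y (e i)).
  apply/funext => y; rewrite {1}(lE v) linear_sum.
  by apply: eq_bigr => i _; rewrite linearZ.
rewrite (iterdiff_lincomb (U := U))//; first by under [RHS]eq_bigr do rewrite iterdiff_rcons.
move=> i ws y wsvs Uy; rewrite -iterdiff_rcons.
apply: Cclass_iterdiff_differentiable fC _ Uy; rewrite size_rcons.
by apply: leq_ltn_trans vsk.
Qed.

(** Expanding one direction at a time over [e] reduces the operator norm to finitely many
    evaluations. With [b i] a bound for [l i], [K] is the [k]-th power of the sum of the [b i],
    hence independent of [f] and of the points. *)
Lemma iterdiff_bound k : exists2 K : R, 0 <= K &
  forall alpha (U : set V) (f : V -> W) y z (c : R), open U ->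
    Cclass k alpha U f -> U y -> U z ->
    (forall s : seq 'I_d, size s = k ->
       `|iterdiff f (map e s) y - iterdiff f (map e s) z| <= c) ->
    forall vs, size vs = k ->
      `|iterdiff f vs y - iterdiff f vs z| <= K * c * \prod_(v <- vs) `|v|.
Proof.
have [b b0 lb] : exists2 b : 'I_d -> R, (forall i, 0 < b i) &
    forall i x, `|l i x| <= b i * `|x|.
  have /choice[b bP] : forall i, exists b : R,
      0 < b /\ forall x, `|l i x| <= b * `|x|.
    by move=> i; have [b b0 bP] := linear_lipschitz (@lc i); exists b.
  by exists b => i => [|x]; have [] := bP i.
elim: k => [|k [K K0 ih]].
  exists 1 => // alpha U f y z c _ _ _ _ h [|//] _.
  by rewrite big_nil mulr1 mul1r (h [::]).
exists (K * \sum_i b i); first by rewrite mulr_ge0// sumr_ge0// => i _; rewrite ltW.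
move=> alpha U f y z c oU fC Uy Uz h vs; case/lastP: vs => // vs v.
rewrite size_rcons => -[vsk].
rewrite !(iterdiff_rconsE v oU fC) ?vsk// -sumrB.
apply: le_trans (ler_norm_sum _ _ _) _.
rewrite -cats1 big_cat big_seq1 /=.
have -> : K * (\sum_i b i) * c * (\prod_(v <- vs) `|v| * `|v|) =
    \sum_i b i * `|v| * (K * c * \prod_(v <- vs) `|v|).
  by rewrite -2!mulr_suml; ring.
apply: ler_sum => i _; rewrite -scalerBr normrZ.
apply: ler_pM => //; rewrite !iterdiff_rcons; have [_ /(_ (e i)) diC] := fC.
apply: (ih alpha U _ y z c oU diC Uy Uz _ vs vsk) => s sk.
by rewrite -!iterdiff_rcons -map_rcons; apply: h; rewrite size_rcons sk.
Qed.

End Multilinear.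

Lemma iterdiff_continuous V W k alpha (U : set V) (f : V -> W) x (e : R) :
  findim V -> open U -> Cclass k alpha U f -> U x -> 0 < e ->
  \forall y \near x, forall vs, size vs = k ->
    `|iterdiff f vs y - iterdiff f vs x| <= e * \prod_(v <- vs) `|v|.
Proof.
move=> [d [b [l [lc lE]]]] oU fC Ux e0.
have [K K0 KP] := iterdiff_bound W lc lE k.
have c0 : 0 < e / (K + 1) by rewrite divr_gt0// ltr_wpDl.
have : \forall y \near x, forall t : k.-tuple 'I_d,
    `|iterdiff f (map b t) y - iterdiff f (map b t) x| <= e / (K + 1).
  apply: filter_forall => t.
  have /Cclass_iterdiff/(_ x Ux)[/cvgrPdist_le/(_ _ c0) + _] :
      Cclass (0 + size (map b t)) alpha U f by rewrite size_map size_tuple.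
  by apply: filterS => y; rewrite distrC.
have UN : nbhs x U by apply: open_nbhs_nbhs.
apply: filterS2 UN => y Uy h vs vsk.
apply: le_trans (KP alpha U f y x (e / (K + 1)) oU fC Uy Ux _ vs vsk) _.
  by move=> s sk; have := h (Tuple (introT eqP sk)).
rewrite ler_wpM2r ?prodr_ge0// mulrCA ger_pMr// ler_pdivrMr ?mul1r ?lerDl//.
by rewrite ltr_wpDl.
Qed.

Lemma iterdiff_holder V W k alpha (U : set V) (f : V -> W) x :
  findim V -> open U -> Cclass k alpha U f -> U x -> 0 < alpha ->
  exists2 N, nbhs x N & exists C : R, forall y z, N y -> N z ->
    forall vs, size vs = k -> `|iterdiff f vs y - iterdiff f vs z|
      <= C * `|y - z| `^ alpha * \prod_(v <- vs) `|v|.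
Proof.
move=> [d [b [l [lc lE]]]] oU fC Ux a0.
have [K K0 KP] := iterdiff_bound W lc lE k.
have /choice[C CP] : forall t : k.-tuple 'I_d, exists C : R,
    exists2 N, nbhs x N & forall y z, N y -> N z ->
    `|iterdiff f (map b t) y - iterdiff f (map b t) z| <= C * `|y - z| `^ alpha.
  move=> t; have /Cclass_iterdiff/(_ x Ux)[_ /(_ a0)[N Nx [C NC]]] :
    Cclass (0 + size (map b t)) alpha U f by rewrite size_map size_tuple.
  by exists C, N.
have /choice[N NP] : forall t : k.-tuple 'I_d, exists N, nbhs x N /\ forall y z, N y -> N z ->
    `|iterdiff f (map b t) y - iterdiff f (map b t) z| <= C t * `|y - z| `^ alpha.
  by move=> t; have [N Nx NP] := CP t; exists N.
exists ([set y | forall t, N t y] `&` U).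
  apply: filterI; first by apply: filter_forall => t; have [] := NP t.
  by apply: open_nbhs_nbhs.
(* The sum serves all tuples at once; absolute values are taken because a Hölder constant [C t] may
   be negative. *)
exists (K * \sum_t `|C t|) => y z [Ny Uy] [Nz Uz] vs vsk.
rewrite -[_ * _ * _ `^ _]mulrA.
apply: (KP alpha U f y z _ oU fC Uy Uz _ vs vsk) => s sk.
have [_ /(_ y z (Ny _) (Nz _))] := NP (Tuple (introT eqP sk)).
move=> /le_trans; apply; rewrite ler_wpM2r ?powR_ge0//.
rewrite (bigD1 (Tuple (introT eqP sk)))//=.
apply: le_trans (ler_norm _) _; rewrite lerDl sumr_ge0//.
Qed.

(** Finite dimension turns the directionwise recursion back into bounds uniform in the directions;
    afterwards all work on classes uses the recursion. *)
Lemma of_classE V W k alpha (U : set V) (f : V -> W) : findim V ->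
  of_class k alpha U f <-> open U /\ Cclass k alpha U f.
Proof.
move=> Vfin; split=> [fC|[oU fC]].
  by split; [case: fC|exact: of_class_Cclass].
split=> // [vs vsk x|vs vsk x|a0 x Ux].
- exact: Cclass_iterdiff_differentiable fC vsk.
- have /Cclass_iterdiff h : Cclass (0 + size vs) alpha U f by rewrite vsk.
  by move=> /h[].
exact: (iterdiff_holder Vfin oU fC Ux a0).
Qed.

End Class.

(** * Operations on functions of class (k, alpha) *)

Section ClassAlgebra.
Variable R : realType.
Implicit Types (V W Z : normedModType R) (alpha : R).

(** The mean value inequality is applied to [f] minus its differential at [x]: by continuity of the
    differential, the differential of this map is small near [x]. *)
Lemma strict_diff V W alpha (U : set V) (f : V -> W) x (e : R) :
  findim V -> open U -> Cclass 1 alpha U f -> U x -> 0 < e ->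
  exists2 d : R, 0 < d & (forall y, `|y - x| < d -> U y) /\
    forall y z, `|y - x| < d -> `|z - x| < d ->
      `|f y - f z - 'd f x (y - z)| <= e * `|y - z|.
Proof.
move=> Vfin oU fC Ux e0.
have UN : nbhs x U by apply: open_nbhs_nbhs.
have [d d0 dP] := (near_normP x _).1
  (filterI UN (iterdiff_continuous Vfin oU fC Ux e0)).
exists d => //; split=> [y /dP[]//|y z yd zd].
have [df _] := fC.
have dfx : continuous ('d f x) by exact/diff_continuous/df.
pose g := f - ('d f x : V -> W).
have dg w : `|w - x| < d -> differentiable g w /\
    'd g w = 'd f w \- 'd f x :> (V -> W).
  move=> wd; have dfw : differentiable f w by apply: df; case: (dP w wd).
  have dxw : differentiable ('d f x) w by exact: linear_differentiable.
  split; first exact: differentiableB.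
  exact: etrans (diffB dfw dxw)
    (congr1 (fun h : V -> W => 'd f w \- h) (diff_lin w dfx)).
have -> : f y - f z - 'd f x (y - z) = g y - g z.
  by rewrite (linearB ('d f x)) /g !fctE [- (f z - _)]opprD [RHS]addrACA -opprD.
apply: mean_value_segment => t t01.
have wd := ball_convex zd yd t01; have [? ->] := dg _ wd; split=> //.
have [_ /(_ [:: y - z] erefl)] := dP _ wd.
by rewrite /= big_seq1.
Qed.

Lemma Cclass1_lipschitz V W alpha (U : set V) (f : V -> W) x :
  findim V -> open U -> Cclass 1 alpha U f -> U x ->
  exists C : R, 0 < C /\ exists2 d : R, 0 < d &
    (forall y, `|y - x| < d -> U y) /\
    forall y z, `|y - x| < d -> `|z - x| < d -> `|f y - f z| <= C * `|y - z|.
Proof.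
move=> Vfin oU fC Ux; have [df _] := fC.
have [b b0 bP] := linear_lipschitz (diff_continuous (df x Ux)).
have [d d0 [dU dP]] := strict_diff Vfin oU fC Ux ltr01.
exists (1 + b); split; first by rewrite addr_gt0.
exists d => //; split=> // y z yd zd.
rewrite -[f y - f z](subrK ('d f x (y - z))) mulrDl.
by apply: le_trans (ler_normD _ _) _; rewrite lerD// dP.
Qed.

Lemma Cclass0_lipschitz V W alpha (U : set V) (f : V -> W) : alpha <= 1 ->
  (forall x, U x -> exists C : R, 0 < C /\ exists2 d : R, 0 < d &
    forall y z, `|y - x| < d -> `|z - x| < d -> `|f y - f z| <= C * `|y - z|) ->
  Cclass 0 alpha U f.
Proof.
move=> a1 h x /h[C [C0 [d d0 dP]]]; split.
  apply/cvgrPdist_le => e e0; apply/near_normP.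
  exists (Num.min d (e / C)); first by rewrite lt_min d0 divr_gt0.
  move=> y; rewrite lt_min => /andP[yd ye]; rewrite distrC.
  apply: le_trans (dP y x yd _) _; first by rewrite subrr normr0.
  by rewrite mulrC -ler_pdivlMr// ltW.
(* Radius 1/2 keeps two points at distance at most 1, where a distance is at most its power with
   exponent [alpha <= 1]. *)
move=> a0; exists [set y | `|y - x| < Num.min d (1 / 2)].
  by apply/near_normP; exists (Num.min d (1 / 2)); rewrite // lt_min d0/=.
exists C => y z; rewrite /= !lt_min => /andP[yd y1] /andP[zd z1].
apply: le_trans (dP y z yd zd) _; rewrite ler_wpM2l ?(ltW C0)//.
have [->|yz] := eqVneq y z; first by rewrite subrr normr0 powR_ge0.
apply: ger1_powR a1; rewrite normr_gt0 subr_eq0 yz/=.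
have -> : y - z = (y - x) - (z - x) by rewrite opprB addrA subrK.
apply: le_trans (ler_normB _ _) _; lra.
Qed.

(** At the bottom of the induction a continuously differentiable map is locally Lipschitz, hence
    locally Hölder with every exponent up to 1. *)
Lemma CclassW V W k alpha (U : set V) (f : V -> W) :
  findim V -> open U -> alpha <= 1 ->
  Cclass k.+1 alpha U f -> Cclass k alpha U f.
Proof.
move=> Vfin oU a1; elim: k f => [|k ih] f fC.
  apply: Cclass0_lipschitz => // x Ux.
  have [C [C0 [d d0 [_ dP]]]] := Cclass1_lipschitz Vfin oU fC Ux.
  by exists C; split=> //; exists d.
by have [df dC] := fC; split=> // v; exact/ih/dC.
Qed.

Lemma Cclass_leq V W j k alpha (U : set V) (f : V -> W) :
  findim V -> open U -> alpha <= 1 -> (j <= k)%N ->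
  Cclass k alpha U f -> Cclass j alpha U f.
Proof.
move=> Vfin oU a1 /subnK <-; elim: (k - j)%N => // i ih.
by rewrite addSn => /CclassW h; apply/ih/h.
Qed.

Lemma Cclass_cst V W k alpha (U : set V) (c : W) : Cclass k alpha U (cst c).
Proof.
elim: k c => [|k ih] c /=.
  move=> x Ux; split; first exact: cvg_cst.
  move=> _; exists setT; first exact: filterT.
  by exists 0 => y z _ _; rewrite subrr normr0 mul0r.
split=> [x _|v]; first exact: differentiable_cst.
have -> : (fun x : V => 'd (cst c) x v) = cst (0 : W); last exact: ih.
by apply/funext => x; rewrite diff_cst.
Qed.

Lemma CclassD V W k alpha (U : set V) (f g : V -> W) : open U ->
  Cclass k alpha U f -> Cclass k alpha U g -> Cclass k alpha U (f \+ g).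
Proof.
move=> oU; elim: k f g => [|k ih] f g /=.
  move=> fC gC x Ux; have [fc fh] := fC x Ux; have [gc gh] := gC x Ux.
  split; first exact: continuousD.
  move=> a0; have [N Nx [C CP]] := fh a0; have [M Mx [D DP]] := gh a0.
  exists (N `&` M); first exact: filterI.
  exists (C + D) => y z [Ny My] [Nz Mz].
  by rewrite opprD addrACA mulrDl (le_trans (ler_normD _ _))// lerD ?CP ?DP.
move=> [df dfC] [dg dgC]; split=> [x Ux|v].
  by apply: differentiableD; [exact: df|exact: dg].
apply: Cclass_eq oU _ (ih _ _ (dfC v) (dgC v)) => x Ux.
by rewrite diffD//; [exact: df|exact: dg].
Qed.

Lemma Cclass_lin_comp V W Z k alpha (U : set V) (f : V -> W)
    (L : {linear W -> Z}) : open U -> continuous L ->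
  Cclass k alpha U f -> Cclass k alpha U (L \o f).
Proof.
move=> oU Lc; elim: k f => [|k ih] f /=.
  move=> fC x Ux; have [fc fh] := fC x Ux.
  split; first by apply: continuous_comp => //; exact: Lc.
  move=> a0; have [N Nx [C CP]] := fh a0; exists N => //.
  have [b b0 bP] := linear_lipschitz Lc; exists (b * C) => y z Ny Nz.
  rewrite -linearB (le_trans (bP _))// -mulrA ler_wpM2l ?(ltW b0)//.
  exact: CP.
move=> [df dfC]; split=> [x Ux|v].
  by apply: differentiable_comp; [exact: df|exact: linear_differentiable].
apply: Cclass_eq oU _ (ih _ (dfC v)) => x Ux /=.
have dL := linear_differentiable (f x) Lc.
by rewrite (diff_comp (df x Ux) dL)/= (diff_lin _ Lc).
Qed.

Lemma Cclass_lin V W k alpha (U : set V) (L : {linear V -> W}) : alpha <= 1 ->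
  continuous L -> Cclass k alpha U L.
Proof.
move=> a1 Lc; case: k => [|k].
  have [b b0 bP] := linear_lipschitz Lc.
  apply: Cclass0_lipschitz => // x Ux; exists b; split=> //; exists 1 => //.
  by move=> y z _ _; rewrite -linearB.
split=> [x _|v]; first exact: linear_differentiable.
have -> : (fun x : V => 'd L x v) = cst (L v); last exact: Cclass_cst.
by apply/funext => x; rewrite diff_lin.
Qed.

Lemma Cclass_id V k alpha (U : set V) : alpha <= 1 -> Cclass k alpha U (@id V).
Proof. by move=> a1; apply: (@Cclass_lin V V k alpha U idfun a1) => x. Qed.

Lemma CclassB V W k alpha (U : set V) (f g : V -> W) : open U ->
  Cclass k alpha U f -> Cclass k alpha U g -> Cclass k alpha U (f \- g).
Proof.
move=> oU fC gC; apply: CclassD => //.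
by apply: (Cclass_lin_comp (L := -%R : {linear W -> W})) gC => //; exact: opp_continuous.
Qed.

Lemma diff_scale V W (f : V -> R) (g : V -> W) x :
  differentiable f x -> differentiable g x ->
  differentiable (fun y => f y *: g y) x /\
  forall v, 'd (fun y => f y *: g y) x v = 'd f x v *: g x + f x *: 'd g x v.
Proof.
move=> df dg; set L := fun v : V => 'd f x v *: g x + f x *: 'd g x v.
have Llin : linear L.
  move=> a u v; rewrite /L (linearP ('d f x)) (linearP ('d g x)) !scalerDl !scalerDr.
  rewrite -!scalerA addrACA.
  by rewrite !scalerA (mulrC a (f x)).
pose LM := GRing.isLinear.Build _ _ _ _ _ Llin.
pose LL : {linear V -> W} := HB.pack L LM.
suff [? h] : differentiable (fun y => f y *: g y) x /\
  'd (fun y => f y *: g y) x = LL :> (V -> W) by split=> // v; rewrite h.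
have dfc := diff_continuous df; have dgc := diff_continuous dg.
have Lc : continuous (fun v => 'd f x v *: g x + f x *: 'd g x v).
  move=> v; apply: cvgD; first by apply: cvgZ; [exact: dfc|exact: cvg_cst].
  by apply: cvgZ; [exact: cvg_cst|exact: dgc].
apply: eps_diff; first exact: Lc.
have [b b0 bP] := linear_lipschitz dgc.
(* Three errors are collected: the remainder of [f] times [|g x|], the remainder of [g] times
   [|f y| <= |f x| + 1], and the increment of [f] times the differential of [g], bounded by [b]. *)
move=> e e0; pose c := `|g x| + `|f x| + 1 + b.
have c0 : 0 < c by rewrite /c; have := normr_ge0 (g x); have := normr_ge0 (f x); lra.
pose e1 := Num.min 1 (e / c).
have e10 : 0 < e1 by rewrite lt_min ltr01 divr_gt0.
have e11 : e1 <= 1 by rewrite ge_min lexx.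
have e1c : e1 * c <= e by rewrite -ler_pdivlMr// ge_min lexx orbT.
have fc := differentiable_continuous df.
apply: filterS (filterI (diff_epsP df e10)
  (filterI (diff_epsP dg e10) (cvgr_dist_le _ _ fc _ e10))).
move=> y [fy [gy fxy]] /=.
rewrite /L; set h := y - x.
have -> : f y *: g y - f x *: g x - ('d f x h *: g x + f x *: 'd g x h) =
    (f y - f x - 'd f x h) *: g x + f y *: (g y - g x - 'd g x h) +
    (f y - f x) *: 'd g x h.
  have zmod_id (A B C D F : W) : C - B - D + (A - C - F) = A - B - (D + F).
    by rewrite addrACA -opprD; congr (_ - _); rewrite addrC addrA subrK.
  rewrite !scalerBl !scalerBr -(zmod_id _ _ (f y *: g x)) -[RHS]addrA; congr (_ + _).
  by rewrite addrA subrK.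
have fyb : `|f y| <= `|f x| + 1.
  rewrite -[f y](subrK (f x)) addrC (le_trans (ler_normD _ _))// lerD2l distrC.
  exact: le_trans fxy e11.
apply: le_trans (ler_normD _ _) _.
apply: le_trans (lerD (ler_normD _ _) (lexx _)) _; rewrite !normrZ.
have h1 : `|f y - f x - 'd f x h| * `|g x| <= (e1 * `|h|) * `|g x|.
  by rewrite ler_wpM2r.
have h2 : `|f y| * `|g y - g x - 'd g x h| <= (`|f x| + 1) * (e1 * `|h|).
  by rewrite ler_pM.
have h3 : `|f y - f x| * `|'d g x h| <= e1 * (b * `|h|).
  by rewrite ler_pM// distrC.
apply: le_trans (lerD (lerD h1 h2) h3) _.
apply: (@le_trans _ _ ((e1 * c) * `|h|)); last by rewrite ler_wpM2r.
by rewrite /c le_eqVlt; apply/orP; left; apply/eqP; ring.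
Qed.

Lemma CclassZ V W k alpha (U : set V) (f : V -> R) (g : V -> W) :
  findim V -> open U -> alpha <= 1 ->
  Cclass k alpha U f -> Cclass k alpha U g ->
  Cclass k alpha U (fun x => f x *: g x).
Proof.
move=> Vfin oU a1; elim: k f g => [|k ih] f g.
  move=> fC gC x Ux; have [fc fh] := fC x Ux; have [gc gh] := gC x Ux.
  split; first exact: cvgZ.
  move=> a0; have [N Nx [C CP]] := fh a0; have [M Mx [D DP]] := gh a0.
  exists ((N `&` M) `&`
      [set y | `|f x - f y| <= 1] `&` [set y | `|g x - g y| <= 1]).
    apply: filterI; last exact: cvgr_dist_le gc _ ltr01.
    by apply: filterI; [exact: filterI|exact: cvgr_dist_le fc _ ltr01].
  exists (`|C| * (`|g x| + 1) + (`|f x| + 1) * `|D|).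
  move=> y z [[[Ny My] fy] _] [[[Nz Mz] _] gz].
  have -> : f y *: g y - f z *: g z =
      (f y - f z) *: g z + f y *: (g y - g z).
    by rewrite scalerBl scalerBr [RHS]addrC addrA subrK.
  have fyb : `|f y| <= `|f x| + 1.
    rewrite -[f y](subrK (f x)) addrC (le_trans (ler_normD _ _))// lerD2l distrC.
    exact: fy.
  have gzb : `|g z| <= `|g x| + 1.
    rewrite -[g z](subrK (g x)) addrC (le_trans (ler_normD _ _))// lerD2l distrC.
    exact: gz.
  have p0 := powR_ge0 `|y - z| alpha.
  have CPy : `|f y - f z| <= `|C| * `|y - z| `^ alpha.
    by apply: le_trans (CP _ _ Ny Nz) _; rewrite ler_wpM2r// ler_norm.
  have DPy : `|g y - g z| <= `|D| * `|y - z| `^ alpha.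
    by apply: le_trans (DP _ _ My Mz) _; rewrite ler_wpM2r// ler_norm.
  apply: le_trans (ler_normD _ _) _; rewrite !normrZ mulrDl; apply: lerD.
    by rewrite mulrAC ler_pM.
  by rewrite -mulrA ler_pM.
move=> fC gC; have fC' := CclassW Vfin oU a1 fC.
have gC' := CclassW Vfin oU a1 gC; move: fC gC => [df dfC] [dg dgC].
split=> [x Ux|v]; first by have [] := diff_scale (df x Ux) (dg x Ux).
apply: Cclass_eq oU _ (CclassD oU (ih _ _ (dfC v) gC') (ih _ _ fC' (dgC v))).
by move=> x Ux; have [_ ->] := diff_scale (df x Ux) (dg x Ux).
Qed.

Lemma Cclass_sum V W (I : Type) (r : seq I) (P : pred I) k alpha (U : set V)
    (F : I -> V -> W) : open U -> (forall i, P i -> Cclass k alpha U (F i)) ->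
  Cclass k alpha U (fun x => \sum_(i <- r | P i) F i x).
Proof.
move=> oU FC; elim: r => [|i r ih].
  have -> : (fun x => \sum_(i <- [::] | P i) F i x) = cst 0.
    by apply/funext => x; rewrite big_nil.
  exact: Cclass_cst.
have [Pi|Pi] := boolP (P i).
  have -> : (fun x => \sum_(j <- i :: r | P j) F j x) =
      F i \+ (fun x => \sum_(j <- r | P j) F j x).
    by apply/funext => x; rewrite big_cons Pi.
  by apply: CclassD => //; exact: FC.
have -> : (fun x => \sum_(j <- i :: r | P j) F j x) =
    (fun x => \sum_(j <- r | P j) F j x) => //.
by apply/funext => x; rewrite big_cons (negbTE Pi).
Qed.

Lemma Cclass_prod V (I : Type) (r : seq I) (P : pred I) k alpha (U : set V)
    (F : I -> V -> R) : findim V -> open U -> alpha <= 1 ->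
  (forall i, P i -> Cclass k alpha U (F i)) ->
  Cclass k alpha U (fun x => \prod_(i <- r | P i) F i x).
Proof.
move=> Vfin oU a1 FC; elim: r => [|i r ih].
  have -> : (fun x => \prod_(i <- [::] | P i) F i x) = cst 1.
    by apply/funext => x; rewrite big_nil.
  exact: Cclass_cst.
have [Pi|Pi] := boolP (P i).
  have -> : (fun x => \prod_(j <- i :: r | P j) F j x) =
      (fun x => F i x *: (\prod_(j <- r | P j) F j x : R)).
    by apply/funext => x; rewrite big_cons Pi.
  by apply: CclassZ => //; exact: FC.
have -> : (fun x => \prod_(j <- i :: r | P j) F j x) =
    (fun x => \prod_(j <- r | P j) F j x) => //.
by apply/funext => x; rewrite big_cons (negbTE Pi).
Qed.

Lemma diffV_apply V (f : V -> R) x v : differentiable f x -> f x != 0 ->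
  'd (fun y => (f y)^-1) x v = - (((f x)^-1 *: (f x)^-1 : R) *: 'd f x v).
Proof.
move=> df fx0; rewrite (diffV df fx0).
have -> : (f x)^-1 *: (f x)^-1 = (f x) ^- 2 by rewrite expr2 invfM.
by rewrite -scaleNr.
Qed.

Lemma CclassV V k alpha (U : set V) (f : V -> R) :
  findim V -> open U -> alpha <= 1 -> (forall x, U x -> f x != 0) ->
  Cclass k alpha U f -> Cclass k alpha U (fun x => (f x)^-1).
Proof.
move=> Vfin oU a1 f0; elim: k => [|k ih].
  move=> fC x Ux; have [fc fh] := fC x Ux; have fx0 := f0 x Ux.
  split; first exact: cvgV.
  move=> a0; have [N Nx [C CP]] := fh a0.
  have h0 : 0 < `|f x| / 2 by rewrite divr_gt0// normr_gt0.
  exists (N `&` [set y | `|f x - f y| <= `|f x| / 2]).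
    by apply: filterI => //; exact: cvgr_dist_le fc _ h0.
  have lb y : `|f x - f y| <= `|f x| / 2 -> `|f x| / 2 <= `|f y|.
    have : `|f x| <= `|f x - f y| + `|f y|.
      by rewrite -{1}[f x](subrK (f y)); exact: ler_normD.
    lra.
  exists (`|C| * (`|f x| / 2) ^- 2) => y z [Ny /lb fy] [Nz /lb fz].
  have fy0 : 0 < `|f y| by exact: lt_le_trans fy.
  have fz0 : 0 < `|f z| by exact: lt_le_trans fz.
  have fyN : f y != 0 by rewrite -normr_gt0.
  have fzN : f z != 0 by rewrite -normr_gt0.
  have -> : (f y)^-1 - (f z)^-1 = (f z - f y) * ((f y)^-1 * (f z)^-1).
    by field; rewrite ?fyN ?fzN.
  rewrite normrM distrC mulrAC ler_pM//.
    by apply: le_trans (CP _ _ Ny Nz) _; rewrite ler_wpM2r ?powR_ge0// ler_norm.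
  rewrite normrM !normfV expr2 invfM ler_pM ?invr_ge0// lef_pV2//.
move=> fC; have fC' := CclassW Vfin oU a1 fC; move: fC => [df dfC].
split=> [x Ux|v]; first by apply: differentiableV; [exact: df|exact: f0].
have VC := ih fC'.
have h := CclassZ Vfin oU a1 (CclassZ Vfin oU a1 VC VC) (dfC v).
apply: (Cclass_eq oU _
  (Cclass_lin_comp (L := -%R : {linear R -> R}) oU _ h)); last first.
  exact: opp_continuous.
move=> x Ux /=.
by rewrite diffV_apply//; [exact: df|exact: f0].
Qed.

Lemma Cclass_det V n k alpha (U : set V) (M : V -> 'M[R]_n) :
  findim V -> open U -> alpha <= 1 ->
  (forall i j, Cclass k alpha U (fun x => M x i j)) ->
  Cclass k alpha U (fun x => \det (M x)).
Proof.
move=> Vfin oU a1 MC; apply: Cclass_sum => // s _.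
apply: (@CclassZ _ R) => //; first exact: Cclass_cst.
by apply: Cclass_prod.
Qed.

Definition locally_lipschitz V W (U : set V) (f : V -> W) :=
  forall x, U x -> exists C : R, 0 < C /\ exists2 d : R, 0 < d &
    forall y z, `|y - x| < d -> `|z - x| < d -> `|f y - f z| <= C * `|y - z|.

Lemma Cclass0_comp V W Z alpha (U : set V) (U' : set W) (f : V -> W)
    (g : W -> Z) : 0 <= alpha <= 1 -> (forall x, U x -> U' (f x)) ->
  locally_lipschitz U f -> Cclass 0 alpha U' g -> Cclass 0 alpha U (g \o f).
Proof.
move=> /andP[a_ge0 a1] fU fL gC x Ux; have [gc gh] := gC (f x) (fU x Ux).
have fc : {for x, continuous f} by have [] := Cclass0_lipschitz a1 fL Ux.
split; first by apply: continuous_comp.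
move=> a0; have [N Nx [C CP]] := gh a0.
have [b [b0 [d d0 dP]]] := fL x Ux.
exists ([set y | N (f y)] `&` [set y | `|y - x| < d]).
  by apply: filterI; [exact: fc|apply/near_normP; exists d].
exists (`|C| * b `^ alpha) => y z [Ny yd] [Nz zd] /=.
apply: le_trans (CP _ _ Ny Nz) _.
apply: le_trans (ler_wpM2r (powR_ge0 _ _) (ler_norm C)) _.
rewrite -mulrA -powRM// ?(ltW b0)// ler_wpM2l//.
by apply: ge0_ler_powR; rewrite ?nnegrE ?mulr_ge0 ?(ltW b0)//; exact: dP.
Qed.

(** The [maxn k 1] matters at [k = 0]: composing two Hölder maps would multiply the exponents, so
    the inner map is taken continuously differentiable and hence locally Lipschitz. *)
Lemma Cclass_comp V W Z k alpha (U : set V) (U' : set W) (f : V -> W)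
    (g : W -> Z) : findim V -> findim W -> open U -> open U' ->
  0 <= alpha <= 1 -> (forall x, U x -> U' (f x)) ->
  Cclass (maxn k 1) alpha U f -> Cclass k alpha U' g ->
  Cclass k alpha U (g \o f).
Proof.
move=> Vfin Wfin oU oU' a01 fU; have /andP[a_ge0 a1] := a01.
elim: k g => [|k ih] g fC gC.
  apply: Cclass0_comp gC => // x Ux.
  have [C [C0 [d d0 [_ dP]]]] := Cclass1_lipschitz Vfin oU fC Ux.
  by exists C; split=> //; exists d.
have [d [e [l [lc lE]]]] := Wfin.
have fC' : Cclass k.+1 alpha U f by move: fC; rewrite maxnSS maxn0.
have fC1 : Cclass (maxn k 1) alpha U f.
  by apply: Cclass_leq fC' => //; rewrite geq_max leqnSn.
move: gC => [dg dgC]; have [df dfC] := fC'.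
split=> [x Ux|v].
  by apply: differentiable_comp; [exact: df|exact/dg/fU].
(* In coordinates of [W] the chain rule is a sum of products, whose factors have class [k] by
   hypothesis on [f] and by induction on [g]. *)
have h : Cclass k alpha U (fun x =>
    \sum_i l i ('d f x v) *: 'd g (f x) (e i)).
  apply: Cclass_sum => // i _; apply: CclassZ => //.
    by apply: (Cclass_lin_comp (L := l i)) (dfC v) => //; exact: lc.
  exact: ih fC1 (dgC (e i)).
apply: Cclass_eq oU _ h => x Ux.
rewrite (diff_comp (df x Ux) (dg _ (fU x Ux)))/= {2}(lE ('d f x v)).
rewrite linear_sum; apply: eq_bigr => i _.
by rewrite linearZ.
Qed.

End ClassAlgebra.

(** * Finite dimension and orthogonal projections *)

Section FiniteDimension.
Variable R : realType.
Implicit Types (V W : normedModType R) (n : nat).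

Lemma findim_retract V W (i : {linear V -> W}) (p : {linear W -> V}) :
  continuous i -> cancel i p -> findim W -> findim V.
Proof.
move=> ic ip [d [e [l [lc lE]]]]; exists d, (p \o e), (fun j => l j \o i).
split=> [j x|x].
  by apply: continuous_comp; [exact: ic|exact: lc].
rewrite -{1}[x]ip [i x]lE linear_sum; apply: eq_bigr => j _.
by rewrite linearZ.
Qed.

Lemma bounded_linear_continuous V W (L : {linear V -> W}) (C : R) :
  (forall x, `|L x| <= C * `|x|) -> continuous L.
Proof.
move=> LC x; apply/cvgrPdist_le => e e0; apply/near_normP.
have C0 : 0 < `|C| + 1 by rewrite ltr_wpDl.
exists (e / (`|C| + 1)); first by rewrite divr_gt0.
move=> y; rewrite ltr_pdivlMr// => yx; rewrite distrC -linearB.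
apply: le_trans (LC _) _.
apply: le_trans (ltW yx); rewrite mulrC ler_wpM2l//.
by apply: le_trans (ler_norm C) _; rewrite lerDl.
Qed.

Lemma findim_complete V (F : set_system V) : findim V ->
  ProperFilter F -> cauchy F -> cvg F.
Proof.
move=> [d [b [l [lc lE]]]] FF /cauchyP Fc; apply/cvg_ex.
have Fi i : cvg (l i x @[x --> F]).
  apply/cauchy_cvgP/cauchyP => e e0.
  have [k k0 kP] := linear_lipschitz (@lc i).
  have [x xP] := Fc (e / k) (divr_gt0 e0 k0).
  exists (l i x); suff : \forall y \near F, ball (l i x) e (l i y) by [].
  apply: filterS xP => y; rewrite -!ball_normE/=.
  have -> : l i x - l i y = l i (x - y) by rewrite linearB.
  by rewrite ltr_pdivlMr// mulrC; apply: le_lt_trans.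
exists (\sum_i lim (l i x @[x --> F]) *: b i).
have : \sum_i l i x *: b i @[x --> F] -->
    \sum_i lim (l i x @[x --> F]) *: b i.
  apply: cvg_big => [|i _]; first exact: add_continuous.
  by apply: cvgZ; [exact: Fi|exact: cvg_cst].
have -> // : (fun x => \sum_i l i x *: b i) = id.
by apply/funext => x; rewrite -lE.
Qed.

Lemma findim_R : findim R.
Proof.
exists 1%N, (fun=> 1), (fun=> [the {linear R -> R} of idfun]); split=> [_ x|x].
  exact: cvg_id.
by rewrite big_ord1 /GRing.scale/= mulr1.
Qed.

Lemma normE n (x : euclid R n) : `|x| = Num.sqrt (edot x x).
Proof. by []. Qed.

Lemma normE2 n (x : euclid R n) : `|x| ^+ 2 = edot x x.
Proof. by rewrite normE sqr_sqrtr// edot_ge0. Qed.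

Lemma coord_le n (x : euclid R n) i : `|(x : 'rV[R]_n) ord0 i| <= `|x|.
Proof.
rewrite -(@ler_pXn2r _ 2)// ?nnegrE// normE2 real_normK ?num_real//.
rewrite /edot (bigD1 i)//= -expr2 lerDl sumr_ge0// => j _.
by rewrite -expr2 sqr_ge0.
Qed.

Definition ecoord n (i : 'I_n) (x : euclid R n) : R := (x : 'rV[R]_n) ord0 i.

Lemma ecoord_linear n (i : 'I_n) : linear (@ecoord n i).
Proof. by move=> a x y; rewrite /ecoord !mxE. Qed.

HB.instance Definition _ n (i : 'I_n) :=
  GRing.isLinear.Build R (euclid R n) R _ (@ecoord n i) (@ecoord_linear n i).

Lemma ecoord_continuous n (i : 'I_n) : continuous (@ecoord n i).
Proof.
apply: (@bounded_linear_continuous _ _ [the {linear _ -> _} of @ecoord n i] 1).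
by move=> x; rewrite mul1r; exact: coord_le.
Qed.

Definition edelta n (i : 'I_n) : euclid R n := delta_mx ord0 i : 'rV[R]_n.

Lemma ecoordE n (x : euclid R n) : x = \sum_i ecoord i x *: edelta i.
Proof. exact: row_sum_delta. Qed.

Lemma findim_euclid n : findim (euclid R n).
Proof.
exists n, (@edelta n), (fun i => [the {linear _ -> _} of @ecoord n i]).
by split=> [i|x]; [exact: ecoord_continuous|exact: ecoordE].
Qed.

(** Supplies the completeness for the contraction principle in the inverse function theorem. *)
Lemma euclid_complete n (F : set_system (euclid R n)) :
  ProperFilter F -> cauchy F -> cvg F.
Proof. by apply: findim_complete; exact: findim_euclid. Qed.

HB.instance Definition _ n :=
  Uniform_isComplete.Build (euclid R n) (@euclid_complete n).

Section Subspace.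
Variables (n : nat) (S : {vspace euclid R n}).

Lemma vsval_continuous : continuous (vsval : subvs_of S -> euclid R n).
Proof.
apply: (@bounded_linear_continuous _ _ [the {linear _ -> _} of @vsval _ _ S] 1).
by move=> x; rewrite mul1r.
Qed.

Lemma vsval_norm (u : subvs_of S) : `|vsval u| = `|u|.
Proof. by []. Qed.

Lemma findim_subvs : findim (subvs_of S).
Proof.
apply: (findim_retract (i := [the {linear _ -> _} of @vsval _ _ S])
  (p := [the {linear _ -> _} of @vsproj _ _ S])).
- exact: vsval_continuous.
- exact: vsvalK.
exact: findim_euclid.
Qed.

End Subspace.

Section Projection.
Variables (n : nat).
Implicit Types (S : {vspace euclid R n}) (x : euclid R n).

Lemma oproj_linear S : linear (oproj S).
Proof. by move=> a x y; apply/val_inj; rewrite /= !linearP. Qed.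

HB.instance Definition _ S := GRing.isLinear.Build R (euclid R n) (subvs_of S) _
  (@oproj R n S) (oproj_linear S).

Lemma oproj_continuous S : continuous (oproj S).
Proof. exact/findim_linear_continuous/findim_euclid. Qed.

Local Arguments oproj : simpl never.

Lemma oprojK S (u : subvs_of S) : oproj S (vsval u) = u.
Proof. by apply/val_inj; exact: oproj_id (subvsP u). Qed.

Lemma edot_orthc S x y : x \in S -> y \in orthc S -> edot x y = 0.
Proof. by move=> xS /mem_orthovP/(_ _ xS); rewrite /= edotC. Qed.

Lemma edotD_orth x y : edot x y = 0 ->
  edot (x + y) (x + y) = edot x x + edot y y.
Proof.
move=> xy; rewrite edotDl (edotC x) (edotC y) !edotDl (edotC y x) xy.
by rewrite addr0 add0r.
Qed.

(** Both [x] and [x - z] are orthogonal to the complement of [S], hence so is the component [z],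
    which also lies in that complement and is therefore orthogonal to itself. *)
Lemma oproj_orthc_id S x : x \in S -> vsval (oproj (orthc S) x) = 0.
Proof.
move=> xS; have h := oproj_orth (orthc S) x.
set z := vsval (oproj (orthc S) x) in h *.
have zS : z \in orthc S by exact: subvsP.
have zS' : z \in orthc (orthc S).
  rewrite -[z](subKr x) rpredB//.
  by apply/mem_orthovP => v vS; exact: edot_orthc xS vS.
exact: edot_eq0 (edot_orthc zS zS').
Qed.

Lemma vsval_oproj_orthc S x :
  vsval (oproj (orthc S) x) = x - vsval (oproj S x).
Proof.
have wS : x - vsval (oproj S x) \in orthc S by exact: oproj_orth.
have -> : oproj (orthc S) x = oproj (orthc S) (x - vsval (oproj S x)) +
    oproj (orthc S) (vsval (oproj S x)) by rewrite -linearD subrK.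
rewrite raddfD/=; have /= -> := oproj_id wS.
by have /= -> := oproj_orthc_id (subvsP (oproj S x)); rewrite addr0.
Qed.

Lemma oproj_add S x : x = vsval (oproj S x) + vsval (oproj (orthc S) x).
Proof. by rewrite vsval_oproj_orthc addrC subrK. Qed.

Lemma oproj_norm_le S x : `|oproj S x| <= `|x|.
Proof.
rewrite -vsval_norm -(@ler_pXn2r _ 2)// ?nnegrE// !normE2.
have wS : x - vsval (oproj S x) \in orthc S by exact: oproj_orth.
have := edotD_orth (edot_orthc (subvsP (oproj S x)) wS).
rewrite (addrC (vsval _)) subrK => ->.
by rewrite lerDl edot_ge0.
Qed.

Lemma norm_le_oproj S x : `|x| <= `|oproj S x| + `|oproj (orthc S) x|.
Proof. by rewrite {1}(oproj_add S x) ler_normD. Qed.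

Lemma oproj_orthc_vsval S (u : subvs_of S) : oproj (orthc S) (vsval u) = 0.
Proof. by apply/val_inj; exact: oproj_orthc_id (subvsP u). Qed.

Lemma oproj_vsval_orthc S (w : subvs_of (orthc S)) : oproj S (vsval w) = 0.
Proof.
apply/val_inj; have := vsval_oproj_orthc S (vsval w).
rewrite oprojK => h; have := subKr (vsval w) (vsval (oproj S (vsval w))).
by rewrite -h subrr => {}h; exact: esym h.
Qed.

End Projection.
End FiniteDimension.

(** * Taylor's formula *)

Section Taylor.
Variable R : realType.
Implicit Types (V W : normedModType R).

Lemma has_vderiv_cst W (c : W) (t : R) : has_vderiv (cst c) t 0.
Proof.
move=> e e0; apply/near_normP; exists 1 => // u _.
by rewrite /cst scaler0 !subrr normr0 mulr_ge0// ltW.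
Qed.

(** Induction on [k] through the directional derivative in direction [v]. The remainder is measured
    by the oscillation of the [k]-th differential itself, so no differential of order [k + 1]
    occurs; the factor 1/k! is given up, and the mean value inequality costs only [T <= 1]. *)
Lemma taylor_le V W k alpha (f : V -> W) x v (M T : R) :
  Cclass k alpha setT f -> 0 <= T <= 1 ->
  (forall t : R, 0 <= t <= 1 ->
    `|iterdiff f (nseq k v) (x + t *: v) - iterdiff f (nseq k v) x| <= M) ->
  `|f (x + T *: v) - \sum_(i < k.+1)
      ((i`!%:R)^-1 * T ^+ i) *: iterdiff f (nseq i v) x| <= M.
Proof.
move=> fC T01 fM; have M0 : 0 <= M.
  by apply: le_trans (fM 0 _) => //; rewrite lexx ler01.
elim: k f T T01 fC fM => [|k ih] f T T01 fC fM.
  by rewrite big_ord1 fact0 expr0 invr1 mulr1 scale1r; exact: fM.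
have [df dC] := fC; have /andP[T0 T1] := T01.
pose w i := iterdiff f (nseq i v) x.
pose g t := f (x + t *: v) - \sum_(i < k.+2) ((i`!%:R)^-1 * t ^+ i) *: w i.
(* Differentiating [g] drops the constant term and shifts the exponents: [dg] is the remainder of
   order [k] for the directional derivative, to which the induction hypothesis applies. *)
pose dg t := 'd f (x + t *: v) v -
  \sum_(i < k.+1) ((i`!%:R)^-1 * t ^+ i) *: w i.+1.
have g0 : g 0 = 0.
  rewrite /g scale0r addr0 big_ord_recl big1 => [|i _].
    by rewrite addr0 fact0 expr0 invr1 mulr1 scale1r subrr.
  by rewrite expr0n/= mulr0 scale0r.
have := @mean_value_le _ _ g dg M T T0; rewrite g0 subr0 => h.
apply: (@le_trans _ _ (M * T)); last by rewrite ler_piMr.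
have rcE i : rcons (nseq i v) v = nseq i.+1 v.
  by elim: i => //= i ->.
apply: h => t /andP[t0 tT]; last first.
  have := ih (fun y => 'd f y v) t; rewrite /dg => h.
  have t01 : 0 <= t <= 1 by rewrite t0 (le_trans tT).
  have {}h := h t01 (dC v) _; move: h.
  under eq_bigr do rewrite -iterdiff_rcons rcE.
  by apply=> s s01; rewrite -!iterdiff_rcons rcE; exact: fM.
(* The polynomial part is differentiated over an arbitrary list of exponents, to allow induction;
   exponent 0 contributes 0. *)
suff h (r : seq nat) : has_vderiv
    (fun s => - \sum_(i <- r) ((i`!%:R)^-1 * s ^+ i) *: w i) t
    (- \sum_(i <- r) (if i is j.+1 then ((j`!%:R)^-1 * t ^+ j) *: w i else 0)).
  have := has_vderivD (vderiv_line (df (x + t *: v) I)) (h (iota 0 k.+2)).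
  have -> : iota 0 k.+2 = index_iota 0 k.+2 by rewrite /index_iota subn0.
  rewrite big_mkord big_ord_recl/= add0r /dg; congr (has_vderiv _ t _).
  by apply/funext => s; rewrite /= big_mkord.
elim: r => [|i r ihr].
  have -> : (fun s => - \sum_(i <- [::]) ((i`!%:R)^-1 * s ^+ i) *: w i) = cst 0.
    by apply/funext => s; rewrite big_nil oppr0.
  by rewrite big_nil oppr0; exact: has_vderiv_cst.
have -> : (fun s => - \sum_(j <- i :: r) ((j`!%:R)^-1 * s ^+ j) *: w j) =
    (fun s => ((i`!%:R)^-1 * s ^+ i) *: - w i) \+
    (fun s => - \sum_(j <- r) ((j`!%:R)^-1 * s ^+ j) *: w j).
  by apply/funext => s; rewrite /= big_cons opprD scalerN.
rewrite big_cons opprD; apply: has_vderivD ihr.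
case: i => [|i].
  have -> : (fun s => (0`!%:R^-1 * s ^+ 0) *: - w 0%N) = cst (- w 0%N).
    by apply/funext => s; rewrite fact0 invr1 expr0 mulr1 scale1r.
  by rewrite oppr0; exact: has_vderiv_cst.
have -> : - ((i`!%:R^-1 * t ^+ i) *: w i.+1) =
    ((i.+1)`!%:R^-1 * i.+1%:R * t ^+ i) *: - w i.+1.
  rewrite scalerN; congr (- (_ * _ *: _)).
  by rewrite factS natrM invfM mulrAC mulVf ?mul1r// pnatr_eq0.
exact: vderiv_monomial.
Qed.

Lemma jet_taylor V W k alpha (f : V -> W) x y (M : R) :
  Cclass k alpha setT f ->
  (forall t : R, 0 <= t <= 1 ->
    `|iterdiff f (nseq k (y - x)) (x + t *: (y - x)) -
      iterdiff f (nseq k (y - x)) x| <= M) ->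
  `|f y - jet k f x y| <= M.
Proof.
move=> fC fM; have := taylor_le fC (_ : 0 <= 1 <= 1) fM.
rewrite ler01 lexx scale1r [x + _]addrC subrK => /(_ isT).
by under eq_bigr do rewrite expr1n mulr1.
Qed.

Lemma jet_littleo V W k alpha (f : V -> W) x (e : R) : findim V ->
  Cclass k alpha setT f -> 0 < e ->
  exists2 d : R, 0 < d & forall y, `|y - x| < d ->
    `|f y - jet k f x y| <= e * `|y - x| ^+ k.
Proof.
move=> Vfin fC e0.
have /near_normP[d d0 dP] := iterdiff_continuous Vfin openT fC (I : setT x) e0.
exists d => // y yd; apply: (jet_taylor fC) => t t01.
have td : `|x + t *: (y - x) - x| < d.
  by apply: ball_convex => //; rewrite subrr normr0.
apply: le_trans (dP _ td (nseq k (y - x)) _) _; first by rewrite size_nseq.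
rewrite ler_pM2l//.
by rewrite big_nseq; elim: k {fC dP} => [|k ih]; rewrite ?expr0// iterS exprS ler_wpM2l.
Qed.

Lemma jet_bigO V W k alpha (f : V -> W) x : findim V -> 0 < alpha ->
  Cclass k alpha setT f ->
  exists C : R, exists2 d : R, 0 < d & forall y, `|y - x| < d ->
    `|f y - jet k f x y| <= C * (`|y - x| ^+ k * `|y - x| `^ alpha).
Proof.
move=> Vfin a0 fC.
have [N /near_normP[d d0 dP] [C CP]] := iterdiff_holder Vfin openT fC (I : setT x) a0.
exists `|C|; exists d => // y yd; apply: (jet_taylor fC) => t t01.
have xd : `|x - x| < d by rewrite subrr normr0.
have td : `|x + t *: (y - x) - x| < d by apply: ball_convex.
apply: le_trans (CP _ _ (dP _ td) (dP _ xd) (nseq k (y - x)) _) _.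
  by rewrite size_nseq.
have -> : \prod_(v <- nseq k (y - x)) `|v| = `|y - x| ^+ k.
  by rewrite big_nseq; elim: k {fC dP CP} => //= k ->; rewrite exprS.
rewrite -mulrA [_ * _ ^+ k]mulrC.
apply: le_trans (ler_wpM2r _ (ler_norm C)) _; first by rewrite mulr_ge0 ?powR_ge0.
rewrite !ler_wpM2l//; apply: ge0_ler_powR; rewrite ?nnegrE ?(ltW a0)//.
rewrite [x + _]addrC addrK normrZ; case/andP: t01 => t0 t1.
by rewrite ger0_norm// ler_piMl.
Qed.

Lemma iterdiffB V W k alpha (f g : V -> W) vs x :
  Cclass k alpha setT f -> Cclass k alpha setT g -> (size vs <= k)%N ->
  iterdiff (f \- g) vs x = iterdiff f vs x - iterdiff g vs x.
Proof.
move=> fC gC; elim: vs x => //= v vs ih x vsk.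
have df := Cclass_iterdiff_differentiable fC vsk (I : setT x).
have dg := Cclass_iterdiff_differentiable gC vsk (I : setT x).
have -> : iterdiff (f \- g) vs = iterdiff f vs - iterdiff g vs.
  by apply/funext => y; rewrite ih// ltnW.
by rewrite diffB.
Qed.

Lemma jetB V W k alpha (f g : V -> W) x y :
  Cclass k alpha setT f -> Cclass k alpha setT g ->
  jet k (f \- g) x y = jet k f x y - jet k g x y.
Proof.
move=> fC gC; rewrite /jet -sumrB; apply: eq_bigr => i _.
by rewrite -scalerBr (iterdiffB _ fC gC)// size_nseq -ltnS.
Qed.

Lemma iterdiff_nseq_continuous V W k alpha (f : V -> W) i x : findim V ->
  Cclass k alpha setT f -> (i <= k)%N ->
  continuous (fun v => iterdiff f (nseq i v) x).
Proof.
move=> [d [b [l [lc lE]]]]; elim: i k f => [|i ih] k f fC ik.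
  by move=> v; exact: cvg_cst.
have -> : (fun v => iterdiff f (nseq i.+1 v) x) =
    (fun v => \sum_j l j v *: iterdiff (fun y => 'd f y (b j)) (nseq i v) x).
  apply/funext => v.
  have -> : nseq i.+1 v = rcons (nseq i v) v by elim: i {ih ik} => //= i ->.
  rewrite (iterdiff_rconsE lE v openT fC) ?size_nseq//.
  by apply: eq_bigr => j _; rewrite iterdiff_rcons.
case: k fC ik => // k [df dC] ik v.
apply: cvg_big => [|j _]; first exact: add_continuous.
apply: cvgZ; first exact: lc.
exact: (ih k _ (dC (b j)) ik v).
Qed.

Lemma iterdiff_nseqZ V W k alpha (f : V -> W) i x (c : R) v :
  Cclass k alpha setT f -> (i <= k)%N ->
  iterdiff f (nseq i (c *: v)) x = c ^+ i *: iterdiff f (nseq i v) x.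
Proof.
move=> fC; elim: i x => [|i ih] x ik; first by rewrite expr0 scale1r.
rewrite /= linearZ/=.
have -> : iterdiff f (nseq i (c *: v)) = c ^+ i *: iterdiff f (nseq i v).
  by apply/funext => y; rewrite ih// ltnW.
rewrite diffZ ?exprS ?scalerA//.
by apply: Cclass_iterdiff_differentiable fC _ _; rewrite ?size_nseq.
Qed.

(** If [f] vanishes to order [k] along a set whose tangent cone at [p] is the
    whole space, its lowest nonzero homogeneous Taylor term of order at most
    [k] would have to vanish in every direction. *)
Lemma iterdiff_eq0 V W k alpha (f : V -> W) (D : set V) p : findim V ->
  Cclass k alpha setT f ->
  (forall v (e : R), 0 < e -> exists s (r : R),
     [/\ D s, 0 < r, `|s - p| < e & `|r *: (s - p) - v| < e]) ->
  (forall e : R, 0 < e -> exists2 d : R, 0 < d & forall s, D s ->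
     `|s - p| < d -> `|f s| <= e * `|s - p| ^+ k) ->
  alpha <= 1 ->
  forall i v, (i <= k)%N -> iterdiff f (nseq i v) p = 0.
Proof.
move=> Vfin fC tanD fD a1 i; have [j] := ubnP i; elim: j i => // j ih i ij v ik.
have fCi : Cclass i alpha setT f by exact: (Cclass_leq Vfin openT a1 ik fC).
pose F := fun v => iterdiff f (nseq i v) p.
have Fc : continuous F by exact: iterdiff_nseq_continuous fC ik.
(* The lower terms vanish by induction, leaving only the top homogeneous term of the jet. *)
have jetE y : jet i f p y = (i`!%:R)^-1 *: F (y - p).
  rewrite /jet big_ord_recr/= big1 ?add0r// => h _.
  have hi := ltn_ord h; have hj : (h < j)%N by exact: leq_trans hi ij.
  by rewrite ih ?scaler0// (leq_trans (ltnW hi) ik).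
suff : `|F v| <= 0 by rewrite normr_le0 => /eqP.
apply/ler_addgt0Pl => e e0; rewrite addr0; apply/ltW.
pose c : R := i`!%:R; have c0 : 0 < c by rewrite ltr0n fact_gt0.
pose B := (`|v| + 1) ^+ i.
have B0 : 0 < B by rewrite exprn_gt0// ltr_wpDl.
(* [c] undoes the division by the factorial and [B] bounds the [i]-th power of [r * |s - p|], so
   that the rescaled term is at most [2 * c * e1 * B = e / 2]. *)
pose e1 := e / 4 / (c * B).
have e10 : 0 < e1 by rewrite !divr_gt0// mulr_gt0.
have [d1 d10 d1P] := fD _ e10.
have [d2 d20 d2P] := jet_littleo p Vfin fCi e10.
have e20 : 0 < e / 4 by rewrite divr_gt0.
have [d3 d30 d3P] := (near_normP v _).1 (cvgr_dist_le _ _ (Fc v) _ e20).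
(* The entry 1 gives both [|s - p|^k <= |s - p|^i] and [|r (s - p)| <= |v| + 1]. *)
pose m := Num.min (Num.min d1 d2) (Num.min d3 1).
have m0 : 0 < m by rewrite !lt_min d10 d20 d30 ltr01.
have [s [r [Ds r0]]] := tanD v m m0.
rewrite !lt_min => /andP[/andP[s1 s2] /andP[_ s4]] /andP[_ /andP[r3 r4]].
have fs : `|f s| <= e1 * `|s - p| ^+ i.
  apply: le_trans (d1P s Ds s1) _; rewrite ler_wpM2l ?(ltW e10)//.
  by apply: ler_wiXn2l => //; exact: ltW.
have fj := d2P s s2.
have Fs : `|F (s - p)| <= c * (2 * e1 * `|s - p| ^+ i).
  have -> : F (s - p) = c *: jet i f p s.
    by rewrite jetE scalerA divff ?scale1r// gt_eqF.
  rewrite normrZ gtr0_norm// ler_pM2l// -[jet i f p s](subrK (f s)).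
  apply: le_trans (ler_normD _ _) _; rewrite distrC.
  by move: fs fj; set q := _ ^+ i; lra.
have Fr : `|F (r *: (s - p))| <= e / 2.
  rewrite /F (iterdiff_nseqZ _ _ _ fC ik) normrZ normrX (gtr0_norm r0).
  have rB : (r * `|s - p|) ^+ i <= B.
    apply: lerXn2r; rewrite ?nnegrE ?mulr_ge0 ?addr_ge0 ?(ltW r0)//.
    rewrite -[X in X * _](gtr0_norm r0) -normrZ.
    rewrite -[r *: _](subrK v) addrC; apply: le_trans (ler_normD _ _) _.
    by rewrite lerD2l ltW.
  apply: le_trans (ler_wpM2l (exprn_ge0 _ (ltW r0)) Fs) _.
  have -> : r ^+ i * (c * (2 * e1 * `|s - p| ^+ i)) =
      2 * c * e1 * (r * `|s - p|) ^+ i by rewrite exprMn; ring.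
  have -> : e / 2 = 2 * c * e1 * B.
    by rewrite /e1; field; rewrite !gt_eqF.
  by apply: ler_wpM2l => //; apply/ltW/mulr_gt0 => //; exact: mulr_gt0.
have h := d3P _ r3; rewrite -[F v](subrK (F (r *: (s - p)))).
apply: le_lt_trans (ler_normD _ _) _.
lra.
Qed.

End Taylor.

(** * The inverse function theorem *)

Section InverseFunction.
Variables (R : realType) (V : completeNormedModType R) (d : nat).
Variables (e : 'I_d -> V) (l : 'I_d -> {linear V -> R}).
Hypothesis lc : forall i, continuous (l i).
Hypothesis lE : forall x, x = \sum_i l i x *: e i.
Hypothesis le_dual : forall i j, l i (e j) = (i == j)%:R.

Let Vfin : findim V. Proof. by exists d, e, l. Qed.

Let rowof (v : V) : 'rV[R]_d := \row_i l i v.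
Let vecof (u : 'rV[R]_d) : V := \sum_i u ord0 i *: e i.

Let rowofK : cancel rowof vecof.
Proof.
by move=> v; rewrite /vecof [RHS]lE; apply: eq_bigr => i _; rewrite mxE.
Qed.

Let vecofK : cancel vecof rowof.
Proof.
move=> u; apply/rowP => i; rewrite mxE /vecof linear_sum (bigD1 i)//= big1 => [|j ji].
  by rewrite linearZ/= le_dual eqxx addr0 /GRing.scale/= mulr1.
by rewrite linearZ/= le_dual eq_sym (negbTE ji) scaler0.
Qed.

Let matof (M : V -> V) : 'M[R]_d := \matrix_(i, j) l j (M (e i)).

Let matofE (M : {linear V -> V}) v : rowof (M v) = rowof v *m matof M.
Proof.
apply/rowP => j; rewrite !mxE {1}(lE v) linear_sum linear_sum.
by apply: eq_bigr => i _; rewrite !mxE !linearZ.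
Qed.

Lemma injective_matof_unit (M : {linear V -> V}) :
  (forall v, M v = 0 -> v = 0) -> matof M \in unitmx.
Proof.
move=> M0; rewrite -row_free_unit; apply/inj_row_free => u uM.
have : M (vecof u) = 0.
  rewrite -[LHS]rowofK matofE vecofK uM /vecof big1// => i _.
  by rewrite mxE scale0r.
move=> /M0 h; rewrite -[u]vecofK h.
by apply/rowP => i; rewrite !mxE linear0.
Qed.

Let inverse (M : V -> V) (v : V) : V := vecof (rowof v *m invmx (matof M)).

Let inverse_linear (M : V -> V) : linear (inverse M).
Proof.
move=> a u v; rewrite /inverse.
have -> : rowof (a *: u + v) = a *: rowof u + rowof v.
  by apply/rowP => i; rewrite !mxE linearP.
rewrite mulmxDl -scalemxAl /vecof scaler_sumr -big_split; apply: eq_bigr => i _.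
by rewrite mxE [X in (X + _) *: _]mxE scalerDl scalerA.
Qed.

Lemma linear_inverse (M : {linear V -> V}) : (forall v, M v = 0 -> v = 0) ->
  exists N : {linear V -> V}, [/\ N = inverse M :> (V -> V), cancel M N & cancel N M].
Proof.
move=> M0; have Mu := injective_matof_unit M0.
pose NM := GRing.isLinear.Build _ _ _ _ _ (inverse_linear M).
pose N : {linear V -> V} := HB.pack (inverse M) NM.
exists N; split=> // v.
  by rewrite /N/= /inverse matofE mulmxK// rowofK.
by rewrite -[LHS]rowofK matofE /N/= /inverse vecofK mulmxKV// rowofK.
Qed.

(** By Cramer's rule the entries of the inverse matrix are polynomials in those of [M x] divided by
    a determinant that does not vanish. *)
Lemma Cclass_inverse (W : normedModType R) k alpha (U : set W)
    (M : W -> {linear V -> V}) w : findim W -> open U -> alpha <= 1 ->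
  (forall x, U x -> forall v, M x v = 0 -> v = 0) ->
  (forall i, Cclass k alpha U (fun x => M x (e i))) ->
  Cclass k alpha U (fun x => inverse (M x) w).
Proof.
move=> Wfin oU a1 M0 MC.
have MijC i j : Cclass k alpha U (fun x => matof (M x) i j).
  have := Cclass_lin_comp (L := l j) oU (@lc j) (MC i).
  by apply: Cclass_eq => // x _; rewrite mxE.
apply: Cclass_sum => // j _; apply: CclassZ => //; last exact: Cclass_cst.
have h : Cclass k alpha U (fun x => \sum_i rowof w ord0 i *:
    ((\det (matof (M x)))^-1 *: ((\adj (matof (M x))) i j : R) : R)).
  apply: Cclass_sum => // i _; apply: CclassZ => //; first exact: Cclass_cst.
  apply: CclassZ => //.
    apply: CclassV => //; last exact: Cclass_det.
    move=> x Ux; have := injective_matof_unit (M0 x Ux).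
    by rewrite unitmxE unitfE.
  have -> : (fun x => (\adj (matof (M x))) i j) = (fun x => (-1) ^+ (j + i) *:
      (\det (row' j (col' i (matof (M x)))) : R)).
    by apply/funext => x; rewrite mxE.
  apply: CclassZ => //; first exact: Cclass_cst.
  apply: Cclass_det => // i' j'.
  have := MijC (lift j i') (lift i j').
  by apply: Cclass_eq => // x _; rewrite !mxE.
apply: Cclass_eq oU _ h => x Ux; rewrite mxE; apply: eq_bigr => i _.
apply: (congr1 (fun z => rowof w ord0 i * z)).
by rewrite /invmx (injective_matof_unit (M0 x Ux)) [RHS]mxE.
Qed.

Variables (k : nat) (alpha : R) (U : set V) (f : V -> V) (a : V).
Hypotheses (alpha01 : 0 <= alpha <= 1) (oU : open U) (Ua : U a).
Hypothesis fC : Cclass k.+1 alpha U f.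
Hypothesis dfa0 : forall v, 'd f a v = 0 -> v = 0.

Let a1 : alpha <= 1. Proof. by case/andP: alpha01. Qed.
Let fC1 : Cclass 1 alpha U f. Proof. exact: (Cclass_leq Vfin oU a1 _ fC). Qed.

(** With [L] the inverse of the differential at [a], strict differentiability makes [L \o f] differ
    from the identity by a map with Lipschitz constant 1/2. Injectivity of [f] and the contraction
    used for surjectivity both follow. *)
Let strict_injective : exists r b : R, [/\ 0 < r, 0 < b,
  forall x, `|x - a| < r -> U x &
  exists2 L : {linear V -> V}, (forall v, `|L v| <= b * `|v|) /\
    (forall v, L v = 0 -> v = 0) &
    forall x y, `|x - a| < r -> `|y - a| < r ->
      `|L (f x - f y) - (x - y)| <= 1 / 2 * `|x - y|].
Proof.
have [L [_ LK KL]] := linear_inverse dfa0.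
have [b b0 bP] := linear_lipschitz (findim_linear_continuous (L := L) Vfin).
have e0 : 0 < 1 / 2 / b by rewrite !divr_gt0.
have [r r0 [rU rP]] := strict_diff Vfin oU fC1 Ua e0.
exists r, b; split=> //; exists L.
  by split=> // v Lv; rewrite -[v]KL Lv linear0.
move=> x y xr yr.
have -> : L (f x - f y) - (x - y) = L (f x - f y - 'd f a (x - y)).
  by rewrite [RHS]linearB LK.
apply: le_trans (bP _) _; apply: le_trans (ler_wpM2l (ltW b0) (rP x y xr yr)) _.
by rewrite mulrA mulrCA divff ?mulr1// gt_eqF.
Qed.

(** Solutions of [f x = y] are the fixed points of [x |-> x - L (f x - y)]. Regularity is
    bootstrapped: the differential of [g] is the inverse of that of [f] at [g y], so each class
    reached by [g] is reached by its differential. *)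
Lemma inverse_function : exists (W : set V) (g : V -> V),
  [/\ open W /\ W (f a),
      forall y, W y -> U (g y) /\ f (g y) = y,
      \forall x \near a, W (f x) /\ g (f x) = x &
      Cclass k.+1 alpha W g].
Proof.
have [r [b [r0 b0 rU [L [bP L0] LP]]]] := strict_injective.
(* [f] shrinks distances at most by the factor [1 / (2 * b)]; hence [f] is injective and [g] will
   have Lipschitz constant [2 * b]. *)
have lower x y : `|x - a| < r -> `|y - a| < r ->
    `|x - y| <= 2 * b * `|f x - f y|.
  move=> xr yr; have h := LP x y xr yr; have h2 := bP (f x - f y).
  rewrite -[x - y](subKr (L (f x - f y))) in h *.
  have := ler_normB (L (f x - f y)) (L (f x - f y) - (x - y)).
  by move: h; rewrite subKr; lra.
pose rho := r / 2; have rho0 : 0 < rho by rewrite divr_gt0.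
have rhor : rho < r by rewrite /rho; lra.
(* This radius makes [|L (y - f a)|] at most [rho / 2]; the contraction contributes at most another
   [rho / 2], so the closed ball of radius [rho] is mapped into itself. *)
pose W := [set y | `|y - f a| < rho / (2 * b)].
have oW : open W.
  rewrite openE => y /= yW; apply/near_normP.
  exists (rho / (2 * b) - `|y - f a|); first by rewrite subr_gt0.
  move=> z zy; rewrite /W/=.
  have -> : z - f a = (z - y) + (y - f a) by rewrite addrA subrK.
  by apply: le_lt_trans (ler_normD _ _) _; lra.
have Wfa : W (f a) by rewrite /W/= subrr normr0 divr_gt0// mulr_gt0.
have exg y : exists x, W y -> `|x - a| <= rho /\ f x = y.
  have [Wy|nWy] := pselect (W y); last by exists a.
  pose B := [set x | `|x - a| <= rho].
  pose T x := x - L (f x - y).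
  have Lya : `|L (y - f a)| <= rho / 2.
    apply: le_trans (bP _) _; move: Wy; rewrite /W/= ltr_pdivlMr ?mulr_gt0//.
    lra.
  have ar : `|a - a| < r by rewrite subrr normr0.
  have TB : set_fun B B T.
    move=> x; rewrite /B/= => xB; have xr := le_lt_trans xB rhor.
    have -> : T x - a = L (y - f a) - (L (f x - f a) - (x - a)).
      rewrite /T (linearB L (f x) y) (linearB L y) (linearB L (f x) (f a)).
      set u := L (f x); set v := L y; set w := L (f a).
      have e1 : - (u - w) + (v - w) = v - u by rewrite opprB addrC addrA subrK.
      by rewrite [- (u - w - _)]opprB [RHS]addrC -[RHS]addrA e1 opprB addrAC.
    have := LP x a xr ar; have := ler_normB (L (y - f a)) (L (f x - f a) - (x - a)).
    by rewrite /rho in xB Lya *; lra.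
  have ctr : is_contraction (mkfun TB).
    have h12 : 0 <= 1 / 2 :> R by lra.
    exists (NngNum h12); split => /=; first by lra.
    move=> [x z] [/= xB zB]; rewrite /T.
    have xr := le_lt_trans xB rhor; have zr := le_lt_trans zB rhor.
    have -> : x - L (f x - y) - (z - L (f z - y)) =
        - (L (f x - f z) - (x - z)).
      have -> : L (f x - f z) = L (f x - y) - L (f z - y).
        by rewrite -linearB opprB addrA subrK.
      by rewrite [RHS]opprB [- (z - _)]opprD addrACA -opprD.
    by rewrite normrN; exact: LP.
  have cB : closed B.
    have -> : B = closed_ball_ Num.norm a rho; last exact: closed_closed_ball_.
    by apply/seteqP; split=> x; rewrite /B/closed_ball_/= distrC.
  have [|x Bx /= xE] := banach_fixed_point ctr cB.
    by exists a; rewrite /B/= subrr normr0 ltW.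
  exists x => _; split => //; apply/eqP; rewrite -subr_eq0; apply/eqP/L0.
  by move/eqP: xE; rewrite /T eq_sym subr_eq addrC -subr_eq subrr eq_sym => /eqP.
have /choice[g gP] := exg.
have gr y : W y -> `|g y - a| < r by move=> /gP[+ _]; move/le_lt_trans; apply.
have gL y z : W y -> W z -> `|g y - g z| <= 2 * b * `|y - z|.
  move=> Wy Wz; have := lower _ _ (gr y Wy) (gr z Wz).
  by have [_ ->] := gP y Wy; have [_ ->] := gP z Wz.
have gU y : W y -> U (g y) by move=> /gr/rU.
have [df dfC] := fC.
exists W, g; split=> //.
- by move=> y Wy; split; [exact: gU|have [] := gP y Wy].
- have fc := differentiable_continuous (df a Ua).
  have WN : nbhs (f a) W by apply: open_nbhs_nbhs.
  have rN : \forall x \near a, `|x - a| < r by apply/near_normP; exists r.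
  have WfN : \forall x \near a, W (f x) by exact: (fc _ WN).
  apply: filterS (filterI WfN rN) => x [Wfx xr]; split=> //.
  apply/eqP; rewrite -subr_eq0 -normr_le0.
  apply: le_trans (lower _ _ (gr _ Wfx) xr) _.
  by have [_ ->] := gP _ Wfx; rewrite subrr normr0 mulr0.
(* Along a vector of the kernel [f] would move by at most [1 / (4 * b)] times the displacement,
   while it moves by at least [1 / (2 * b)] times it. *)
have inj y : W y -> forall v, 'd f (g y) v = 0 -> v = 0.
  move=> Wy v dv0; set x := g y in dv0; have xr : `|x - a| < r by exact: gr.
  have c0 : 0 < 1 / (4 * b) by rewrite divr_gt0// mulr_gt0.
  have [t t0 tP] := (near_normP _ _).1 (diff_epsP (df _ (gU y Wy)) c0).
  have v1 : 0 < `|v| + 1 by rewrite ltr_wpDl.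
  pose m := Num.min t (r - `|x - a|) / (`|v| + 1).
  have m0 : 0 < m by rewrite divr_gt0// lt_min t0 subr_gt0.
  have mv : m * `|v| < Num.min t (r - `|x - a|).
    by rewrite /m mulrAC ltr_pdivrMr// ltr_pM2l ?ltrDl// lt_min t0 subr_gt0.
  have zxE : (x + m *: v) - x = m *: v by rewrite addrC addKr.
  move: mv; rewrite lt_min => /andP[mt mr].
  have := tP (x + m *: v); rewrite zxE normrZ (gtr0_norm m0) => /(_ mt).
  have -> : 'd f (g y) (m *: v) = 0 by rewrite linearZ/= -/x dv0 scaler0.
  rewrite subr0 => fz.
  have zr : `|x + m *: v - a| < r.
    rewrite addrAC; apply: le_lt_trans (ler_normD _ _) _.
    by rewrite normrZ (gtr0_norm m0); lra.
  have := lower _ _ zr xr; rewrite zxE normrZ (gtr0_norm m0) => mvf.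
  have : m * `|v| <= 1 / 2 * (m * `|v|).
    apply: le_trans mvf _; apply: le_trans (ler_wpM2l _ fz) _.
      by rewrite mulr_ge0// ltW.
    by rewrite le_eqVlt; apply/orP; left; apply/eqP; field; rewrite gt_eqF.
  move=> h; have {}h : m * `|v| <= 0 by lra.
  by apply/eqP; rewrite -normr_le0 -(pmulr_rle0 _ m0).
have dg y : W y -> differentiable g y /\ 'd g y = inverse ('d f (g y)) :> (V -> V).
  move=> Wy; have [N [NE MN NM]] := linear_inverse (inj y Wy).
  rewrite -NE; have Nc : continuous N by exact: findim_linear_continuous.
  apply: eps_diff => // c c0.
  have [q q0 qP] := linear_lipschitz Nc.
  have b2 : 0 < 2 * b by rewrite mulr_gt0.
  have c'0 : 0 < c / (q * (2 * b)) by rewrite divr_gt0// mulr_gt0.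
  have [t t0 tP] := (near_normP _ _).1 (diff_epsP (df _ (gU y Wy)) c'0).
  have WN : nbhs y W by apply: open_nbhs_nbhs.
  have tN : \forall z \near y, `|z - y| < t / (2 * b).
    by apply/near_normP; exists (t / (2 * b)); rewrite ?divr_gt0.
  apply: filterS2 WN tN => z Wz; rewrite ltr_pdivlMr// mulrC => zy.
  have gzy := gL z y Wz Wy.
  have := tP (g z) (le_lt_trans gzy zy).
  have [_ ->] := gP z Wz; have [_ ->] := gP y Wy => h.
  have -> : g z - g y - N (z - y) = - N (z - y - 'd f (g y) (g z - g y)).
    by rewrite (linearB N (z - y)) MN opprB.
  rewrite normrN; apply: le_trans (qP _) _.
  apply: le_trans (ler_wpM2l (ltW q0) h) _.
  apply: le_trans (ler_wpM2l (ltW q0) (ler_wpM2l (ltW c'0) gzy)) _.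
  by rewrite le_eqVlt; apply/orP; left; apply/eqP; field; rewrite !gt_eqF.
have gLip : locally_lipschitz W g.
  move=> y Wy; exists (2 * b); split; first by rewrite mulr_gt0.
  have [t t0 tP] := (near_normP _ _).1 (open_nbhs_nbhs (conj oW Wy)).
  by exists t => // z w /tP Wz /tP Ww; exact: gL.
suff h j : (j <= k)%N -> Cclass j.+1 alpha W g by exact: h.
(* At the base only the Lipschitz bound on [g] is available; it suffices for composing with the
   Hölder continuous differential of [f]. *)
elim: j => [|j ih] jk.
  split=> [y /dg[]//|v].
  have h : Cclass 0 alpha W (fun y => inverse ('d f (g y)) v).
    apply: Cclass_inverse => // i.
    apply: Cclass0_comp (Cclass_leq Vfin oU a1 _ (dfC (e i))) => //.
  by apply: Cclass_eq oW _ h => y /dg[_ ->].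
split=> [y /dg[]//|v].
have h : Cclass j.+1 alpha W (fun y => inverse ('d f (g y)) v).
  apply: Cclass_inverse => // i.
  have gC : Cclass (maxn j.+1 1) alpha W g.
    by rewrite maxnSS maxn0; apply: ih; exact: ltnW.
  exact: (Cclass_comp Vfin Vfin oW oU alpha01 (fun y => gU y) gC
    (Cclass_leq Vfin oU a1 jk (dfC (e i)))).
by apply: Cclass_eq oW _ h => y /dg[_ ->].
Qed.

End InverseFunction.

(** * Smooth retractions onto small balls *)

Section Cutoff.
Variable R : realType.

Lemma CclassS_comp (V W Z : normedModType R) k (alpha : R) (U : set V)
    (U' : set W) (f : V -> W) (g : W -> Z) : findim V -> findim W ->
  open U -> open U' -> 0 <= alpha <= 1 -> (forall x, U x -> U' (f x)) ->
  Cclass k.+1 alpha U f -> Cclass k.+1 alpha U' g ->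
  Cclass k.+1 alpha U (g \o f).
Proof.
by move=> Vf Wf oU oU' a01 fU fC; apply: Cclass_comp fU _ => //; rewrite maxnSS maxn0.
Qed.

(** The building block of the cutoff, of finite smoothness: its [j]-th derivative is a multiple of
    the positive part, hence Lipschitz, so the class is [(j, alpha)] for every [alpha <= 1]. *)
Definition pospow (j : nat) (t : R) : R := Num.max 0 t ^+ j.+1.

Lemma pospow_diff j (t : R) : differentiable (pospow j.+1) t /\
  forall v, 'd (pospow j.+1) t v = (j.+2%:R * v) *: (pospow j t : R).
Proof.
have expd (n : nat) : differentiable (fun u : R => u ^+ n.+1) t /\
    forall v, 'd (fun u : R => u ^+ n.+1) t v = (n.+1%:R * v) *: (t ^+ n : R).
  have dn : differentiable (fun u : R => u ^+ n.+1) t.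
    by apply/derivable1_diffP; exact: exprn_derivable.
  split=> // v; have -> : v = v *: (1 : R) by rewrite /GRing.scale/= mulr1.
  rewrite linearZ/= -deriveE// exp_derive /GRing.scale/= !mulr1.
  by rewrite mulrCA mulrA.
have [t0|t0|t0] := ltrgtP t 0.
- have tN : \forall u \near t, cst (0 : R) u = pospow j.+1 u.
    apply/near_normP; exists (- t); first by rewrite oppr_gt0.
    move=> u ut; rewrite /pospow max_l ?expr0n//.
    by have := ler_norm (u - t); lra.
  have [? ->] := near_eq_diff tN (differentiable_cst _ _); split=> // v.
  by rewrite diff_cst /pospow max_l ?(ltW t0)// expr0n/= scaler0.
- have tN : \forall u \near t, u ^+ j.+2 = pospow j.+1 u.
    apply/near_normP; exists t => // u; rewrite distrC => ut.
    by rewrite /pospow max_r//; have := ler_norm (t - u); lra.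
  have [dn dE] := expd j.+1.
  have [? ->] := near_eq_diff tN dn; split=> // v.
  by rewrite dE /pospow max_r// ltW.
(* At the corner the derivative is 0, since [|u|^(j+2) <= |u|^2 <= e * |u|] for [|u|] below 1 and
   [e]. *)
- pose L : {linear R -> R} := [the {linear R -> R} of \0%R : R -> R].
  have h : differentiable (pospow j.+1) t /\ 'd (pospow j.+1) t = L :> (R -> R).
    apply: eps_diff; first by move=> ?; exact: cvg_cst.
    move=> e e0; apply/near_normP; exists (Num.min 1 e).
      by rewrite lt_min ltr01.
    move=> u; rewrite lt_min => /andP[u1 ue].
    have p0 : pospow j.+1 t = 0 by rewrite /pospow t0 maxxx expr0n.
    rewrite p0 (_ : L (u - t) = 0)// t0 !subr0.
    rewrite t0 subr0 in u1 ue.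
    have m0 : 0 <= Num.max 0 u by rewrite le_max lexx.
    have mu : Num.max 0 u <= `|u| by rewrite ge_max normr_ge0 ler_norm.
    rewrite /pospow ger0_norm ?exprn_ge0//.
    apply: (@le_trans _ _ (`|u| ^+ j.+2)); first by rewrite lerXn2r ?nnegrE.
    rewrite exprSr ler_wpM2r//.
    apply: (@le_trans _ _ (`|u| ^+ 1)); last by rewrite expr1 ltW.
    by apply: ler_wiXn2l => //; exact: ltW.
  have [? ->] := h; split=> // v.
  by rewrite /L/= t0 /pospow maxxx expr0n/= scaler0.
Qed.

Lemma Cclass_pospow j (alpha : R) : alpha <= 1 ->
  Cclass j alpha setT (pospow j).
Proof.
move=> a1; elim: j => [|j ih].
  apply: Cclass0_lipschitz => // x _; exists 1; split=> //; exists 1 => //.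
  move=> y z _ _; rewrite mul1r /pospow !expr1.
  have := ler_norm (y - z); have := ler_norm (z - y); rewrite (distrC z).
  rewrite ler_norml /Num.max /Order.max.
  by case: ifP => [y0|/negbT]; case: ifP => [z0|/negbT]; rewrite -?leNgt; lra.
split=> [x _|v]; first by have [] := pospow_diff j x.
have -> : (fun x => 'd (pospow j.+1) x v) =
    (fun x => cst (j.+2%:R * v) x *: (pospow j x : R)).
  by apply/funext => x; have [_ ->] := pospow_diff j x.
apply: CclassZ => //; [exact: (findim_R R)|exact: openT|exact: Cclass_cst].
Qed.

(** The inner power vanishes up to [t = 1] and reaches 1 at [t = 2], where the outer positive part
    becomes 0. *)
Definition cutoff (k : nat) (t : R) : R := pospow k (1 - pospow k (t - 1)).

Lemma cutoff_ge0 k t : 0 <= cutoff k t.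
Proof. by rewrite exprn_ge0// le_max lexx. Qed.

Lemma cutoff_le1 k t : cutoff k t <= 1.
Proof.
apply: exprn_ile1; first by rewrite le_max lexx.
by rewrite ge_max ler01/= gerBl exprn_ge0// le_max lexx.
Qed.

Lemma cutoff1 k t : t <= 1 -> cutoff k t = 1.
Proof.
move=> t1; rewrite /cutoff {2}/pospow max_l ?subr_le0// expr0n/= subr0.
by rewrite /pospow max_r// expr1n.
Qed.

Lemma cutoff0 k t : 2 <= t -> cutoff k t = 0.
Proof.
move=> t2; rewrite /cutoff [pospow k (1 - _)]/pospow max_l ?expr0n//.
rewrite subr_le0 /pospow max_r; last lra.
by apply: exprn_ege1; lra.
Qed.

Lemma Cclass_cutoff k (alpha : R) : 0 <= alpha <= 1 ->
  Cclass k.+1 alpha setT (cutoff k.+1).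
Proof.
move=> a01; have /andP[_ a1] := a01.
have pC := Cclass_pospow k.+1 a1.
have shiftC : Cclass k.+1 alpha setT (fun t : R => t - 1).
  apply: CclassB; [exact: openT|exact: Cclass_id|exact: Cclass_cst].
have innerC : Cclass k.+1 alpha setT (fun t : R => 1 - pospow k.+1 (t - 1)).
  apply: CclassB; [exact: openT|exact: Cclass_cst|].
  have h := CclassS_comp (findim_R R) (findim_R R) openT openT a01 (fun _ _ => I) shiftC pC.
  exact: h.
have h := CclassS_comp (findim_R R) (findim_R R) openT openT a01 (fun _ _ => I) innerC pC.
exact: h.
Qed.

(** The displacement from [p] is multiplied by a cutoff of its squared norm; the square is used
    because the norm is not differentiable at 0. *)
Lemma smooth_retraction (V : normedModType R) k (alpha : R) (p : V) (delta : R) :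
  findim V -> 0 <= alpha <= 1 -> 0 < delta ->
  Cclass k.+1 alpha setT (fun x : V => `|x| ^+ 2 : R) ->
  exists rho : V -> V, [/\ Cclass k.+1 alpha setT rho,
    forall x, `|rho x - p| < delta & \forall x \near p, rho x = x].
Proof.
move=> Vfin a01 d0 nC; have /andP[_ a1] := a01.
(* The argument of the cutoff is at least 2 from distance [delta] on, where everything is sent to
   [p], and at most 1/2 up to distance [delta / 2], where nothing moves. *)
pose c := 2 / delta ^+ 2; have c0 : 0 < c by rewrite divr_gt0// exprn_gt0.
pose th x := cutoff k.+1 (c * `|x - p| ^+ 2).
have shiftC : Cclass k.+1 alpha setT (fun x : V => x - p).
  apply: CclassB; [exact: openT|exact: Cclass_id|exact: Cclass_cst].
have n2C : Cclass k.+1 alpha setT (fun x : V => c * `|x - p| ^+ 2).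
  apply: (@CclassZ _ _ R _ _ _ (cst c)) => //; [exact: openT|exact: Cclass_cst|].
  exact: (CclassS_comp Vfin Vfin openT openT a01 _ shiftC nC).
have thC : Cclass k.+1 alpha setT th.
  have h := CclassS_comp Vfin (findim_R R) openT openT a01 (fun _ _ => I) n2C
    (Cclass_cutoff k a01).
  exact: h.
exists (fun x => p + th x *: (x - p)); split.
- apply: CclassD; [exact: openT|exact: Cclass_cst|].
  by apply: CclassZ => //; exact: openT.
- move=> x; rewrite addrC addKr normrZ ger0_norm ?cutoff_ge0//.
  have [xd|xd] := ltP `|x - p| delta.
    by apply: le_lt_trans xd; rewrite ler_piMl// cutoff_le1.
  rewrite /th cutoff0 ?mul0r// /c mulrAC ler_pdivlMr ?exprn_gt0//.
  by rewrite ler_pM2l// lerXn2r ?nnegrE// ltW.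
- apply/near_normP; exists (delta / 2); first by rewrite divr_gt0.
  move=> x xd; rewrite /th cutoff1 ?scale1r; first by rewrite addrC subrK.
  rewrite /c mulrAC ler_pdivrMr ?exprn_gt0// mul1r.
  have h : `|x - p| ^+ 2 <= (delta / 2) ^+ 2.
    by apply: lerXn2r; rewrite ?nnegrE// ?(ltW xd)// divr_ge0// ltW.
  have d20 : 0 < delta ^+ 2 by rewrite exprn_gt0.
  move: h; rewrite expr_div_n; lra.
Qed.

Lemma Cclass_norm2 n (S : {vspace euclid R n}) k (alpha : R) : alpha <= 1 ->
  Cclass k alpha setT (fun x : subvs_of S => `|x| ^+ 2 : R).
Proof.
move=> a1; have Sfin := findim_subvs S.
have -> : (fun x : subvs_of S => `|x| ^+ 2 : R) =
    (fun x => \sum_(i < n) ecoord i (vsval x) *: (ecoord i (vsval x) : R)).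
  by apply/funext => x; rewrite -vsval_norm normE2.
apply: Cclass_sum => [|i _]; first exact: openT.
have lC : Cclass k alpha setT (fun x : subvs_of S => ecoord i (vsval x)).
  apply: (Cclass_lin_comp (L := [the {linear euclid R n -> R} of ecoord i])).
  - exact: openT.
  - exact: ecoord_continuous.
  - exact: (@Cclass_lin R _ _ k alpha _
      [the {linear subvs_of S -> euclid R n} of vsval] a1
      (@vsval_continuous R n S)).
by apply: CclassZ => //; exact: openT.
Qed.

End Cutoff.

(** * Pointwise smallness *)

Section Smallness.
Variable R : realType.
Implicit Types (k : nat) (alpha : R).

Definition gauge k alpha (r : R) : R := r ^+ k * r `^ alpha.

Lemma gauge_ge0 k alpha r : 0 <= r -> 0 <= gauge k alpha r.
Proof. by move=> r0; rewrite mulr_ge0 ?exprn_ge0 ?powR_ge0. Qed.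

Lemma gauge_gt0 k alpha r : 0 < r -> 0 < gauge k alpha r.
Proof. by move=> r0; rewrite mulr_gt0 ?exprn_gt0 ?powR_gt0. Qed.

Lemma gauge_le k alpha r s : 0 <= alpha -> 0 <= r <= s ->
  gauge k alpha r <= gauge k alpha s.
Proof.
move=> a0 /andP[r0 rs]; have s0 := le_trans r0 rs.
apply: ler_pM; rewrite ?exprn_ge0 ?powR_ge0 ?lerXn2r ?nnegrE//.
by apply: ge0_ler_powR; rewrite ?nnegrE.
Qed.

Lemma gaugeM k alpha c r : 0 <= c -> 0 <= r ->
  gauge k alpha (c * r) = gauge k alpha c * gauge k alpha r.
Proof. by move=> c0 r0; rewrite /gauge exprMn powRM// mulrACA. Qed.

Lemma gauge_le_id k alpha r : 0 <= alpha -> 0 <= r -> r <= 1 ->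
  gauge k.+1 alpha r <= r.
Proof.
move=> a0 r0 r1; rewrite /gauge -[leRHS]mulr1.
apply: ler_pM; rewrite ?exprn_ge0 ?powR_ge0//.
  by rewrite exprS ler_piMr// exprn_ile1.
have -> : 1 = 1 `^ alpha :> R by rewrite powR1.
by apply: ge0_ler_powR; rewrite ?nnegrE.
Qed.

Lemma gauge0 k alpha : gauge k.+1 alpha 0 = 0.
Proof. by rewrite /gauge expr0n mul0r. Qed.

(** The little-o condition quantifies universally over the constant and the
    big-O condition existentially; both are handled by the same lemmas. *)
Definition ohquant alpha (P : R -> Prop) : Prop :=
  if alpha == 0 then forall e : R, 0 < e -> P e else exists2 e : R, 0 < e & P e.

Lemma ohquant_imp alpha (c : R) (P Q : R -> Prop) : 0 < c ->
  (forall e : R, 0 < e -> P e -> Q (c * e)) ->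
  ohquant alpha P -> ohquant alpha Q.
Proof.
move=> c0 PQ; rewrite /ohquant; case: ifP => _ h.
  move=> e e0; have -> : e = c * (e / c) by rewrite mulrC divfK ?gt_eqF.
  by apply: PQ; rewrite ?divr_gt0//; apply: h; rewrite divr_gt0.
by have [e e0 Pe] := h; exists (c * e); [rewrite mulr_gt0|exact: PQ].
Qed.

Lemma ohquant_and alpha (P Q : R -> Prop) :
  (forall e f : R, 0 < e -> e <= f -> P e -> P f) ->
  (forall e f : R, 0 < e -> e <= f -> Q e -> Q f) ->
  ohquant alpha P -> ohquant alpha Q -> ohquant alpha (fun e => P e /\ Q e).
Proof.
move=> PM QM; rewrite /ohquant; case: ifP => _ hP hQ.
  by move=> e e0; split; [exact: hP|exact: hQ].
have [e e0 Pe] := hP; have [f f0 Qf] := hQ; exists (e + f).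
  by rewrite addr_gt0.
by split; [apply: PM Pe|apply: QM Qf] => //; rewrite ?lerDl ?lerDr ltW.
Qed.

(** The radius is an arbitrary function [rho], so that points of A, of B and of the subspace can be
    compared although some are measured by [|x - a|] and others by their projection. *)
Definition small_on k alpha (T : Type) (X : set T) (rho q : T -> R) : Prop :=
  ohquant alpha (fun e => exists2 d : R, 0 < d &
    forall x, X x -> rho x < d -> q x <= e * gauge k alpha (rho x)).

Lemma small_on_mon k alpha (T : Type) (X : set T) (rho q : T -> R) (e f : R) :
  (forall x, 0 <= rho x) -> 0 < e -> e <= f ->
  (exists2 d : R, 0 < d &
    forall x, X x -> rho x < d -> q x <= e * gauge k alpha (rho x)) ->
  exists2 d : R, 0 < d &
    forall x, X x -> rho x < d -> q x <= f * gauge k alpha (rho x).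
Proof.
move=> r0 e0 ef [d d0 dP]; exists d => // x Xx xd.
by apply: le_trans (dP x Xx xd) _; rewrite ler_wpM2r// gauge_ge0.
Qed.

(** [eta] absorbs the error from choosing almost nearest points of a set. *)
Lemma small_on2 k alpha (T T1 T2 : Type) (X : set T) (X1 : set T1)
    (X2 : set T2) (rho q : T -> R) (rho1 q1 : T1 -> R) (rho2 q2 : T2 -> R)
    (c C d0 : R) : 0 <= alpha -> 0 < d0 -> 0 < c -> 0 < C ->
  (forall x, 0 <= rho x) -> (forall x, 0 <= rho1 x) -> (forall x, 0 <= rho2 x) ->
  (forall x, X x -> rho x = 0 -> q x <= 0) ->
  (forall x, X x -> 0 < rho x -> rho x < d0 -> forall eta : R, 0 < eta ->
     exists y1 y2, [/\ X1 y1, X2 y2, rho1 y1 <= c * rho x,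
       rho2 y2 <= c * rho x & q x <= C * (q1 y1 + q2 y2) + eta]) ->
  small_on k alpha X1 rho1 q1 -> small_on k alpha X2 rho2 q2 ->
  small_on k alpha X rho q.
Proof.
move=> a0 d00 c0 C0 r0 r10 r20 q0 h h1 h2.
have := ohquant_and
  (fun e f => @small_on_mon k alpha T1 X1 rho1 q1 e f r10)
  (fun e f => @small_on_mon k alpha T2 X2 rho2 q2 e f r20) h1 h2.
(* [C] comes from the comparison, 2 from the two summands, and [gauge k alpha c] from enlarging the
   radius by [c]. *)
have K0 : 0 < C * 2 * gauge k alpha c by rewrite mulr_gt0 ?gauge_gt0// mulr_gt0.
apply: (ohquant_imp K0) => e e0 [[d1 d10 d1P] [d2 d20 d2P]].
pose d := Num.min d0 (Num.min (d1 / c) (d2 / c)).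
exists d; first by rewrite !lt_min d00 !divr_gt0.
move=> x Xx; rewrite !lt_min !ltr_pdivlMr// => /and3P[xd0 xd1 xd2].
have g0 : 0 <= gauge k alpha (rho x) by rewrite gauge_ge0.
have [rx0|rx0] := eqVneq (rho x) 0.
  apply: le_trans (q0 x Xx rx0) _; rewrite mulr_ge0// ltW// mulr_gt0//.
have {}rx0 : 0 < rho x by rewrite lt_def rx0 r0.
apply/ler_addgt0Pr => eta eta0.
have [y1 [y2 [Xy1 Xy2 ry1 ry2 qx]]] := h x Xx rx0 xd0 eta eta0.
apply: le_trans qx _; rewrite lerD2r.
have bound1 : q1 y1 <= e * gauge k alpha (c * rho x).
  apply: le_trans (d1P y1 Xy1 _) _; first by rewrite (le_lt_trans ry1)// mulrC.
  by rewrite ler_wpM2l ?(ltW e0)// gauge_le// r10.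
have bound2 : q2 y2 <= e * gauge k alpha (c * rho x).
  apply: le_trans (d2P y2 Xy2 _) _; first by rewrite (le_lt_trans ry2)// mulrC.
  by rewrite ler_wpM2l ?(ltW e0)// gauge_le// r20.
apply: le_trans (ler_wpM2l (ltW C0) (lerD bound1 bound2)) _.
rewrite gaugeM ?(ltW c0)//.
by rewrite le_eqVlt; apply/orP; left; apply/eqP; ring.
Qed.

Lemma small_on1 k alpha (T T1 : Type) (X : set T) (X1 : set T1)
    (rho q : T -> R) (rho1 q1 : T1 -> R) (c C d0 : R) :
  0 <= alpha -> 0 < d0 -> 0 < c -> 0 < C ->
  (forall x, 0 <= rho x) -> (forall x, 0 <= rho1 x) ->
  (forall y, X1 y -> 0 <= q1 y) ->
  (forall x, X x -> rho x = 0 -> q x <= 0) ->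
  (forall x, X x -> 0 < rho x -> rho x < d0 -> forall eta : R, 0 < eta ->
     exists y1, [/\ X1 y1, rho1 y1 <= c * rho x & q x <= C * q1 y1 + eta]) ->
  small_on k alpha X1 rho1 q1 -> small_on k alpha X rho q.
Proof.
move=> a0 d00 c0 C0 r0 r10 q10 q0 h h1.
apply: (@small_on2 k alpha T T1 T1 X X1 X1 rho q rho1 q1 rho1 q1 c C d0) => //.
move=> x Xx rx0 xd eta eta0; have [y [Xy ry qy]] := h x Xx rx0 xd eta eta0.
exists y, y; split=> //; apply: le_trans qy _; rewrite lerD2r.
by rewrite ler_wpM2l ?(ltW C0)// lerDl q10.
Qed.

Lemma small_onW k alpha (T : Type) (X : set T) (rho q : T -> R) :
  0 <= alpha -> (forall x, 0 <= rho x) ->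
  small_on k.+1 alpha X rho q -> small_on 1 0 X rho q.
Proof.
move=> a0 r0 h; rewrite /small_on /ohquant eqxx => e e0.
have g10 (r : R) : gauge 1 0 r = r by rewrite /gauge expr1 powRr0 mulr1.
move: h; rewrite /small_on /ohquant; case: eqVneq => [a00 /(_ e e0)|an0 [C C0]].
  move=> [d d0 dP]; exists (Num.min d 1); first by rewrite lt_min d0 ltr01.
  move=> x Xx; rewrite lt_min => /andP[xd x1]; apply: le_trans (dP x Xx xd) _.
  by rewrite ler_wpM2l ?(ltW e0)// g10; apply: gauge_le_id => //; exact: ltW.
have agt0 : 0 < alpha by rewrite lt_def an0.
move=> [d d0 dP].
(* Below radius [t] the factor [rho^alpha] is at most [e / C] and turns the given constant [C] into
   the required [e]. *)
pose t := (e / C) `^ alpha^-1.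
have t0 : 0 < t by rewrite powR_gt0// divr_gt0.
have tE : t `^ alpha = e / C.
  by rewrite /t -powRrM mulVf// powRr1// ltW// divr_gt0.
exists (Num.min d (Num.min 1 t)); first by rewrite !lt_min d0 ltr01.
move=> x Xx; rewrite !lt_min => /and3P[xd x1 xt].
apply: le_trans (dP x Xx xd) _; rewrite g10.
have xa : rho x `^ alpha <= e / C.
  by rewrite -tE; apply: ge0_ler_powR; rewrite ?nnegrE ?(ltW t0)// ?(ltW xt)// r0.
have xk : rho x ^+ k.+1 <= rho x.
  by rewrite exprS ler_piMr ?r0// exprn_ile1// ltW.
apply: (@le_trans _ _ (C * (rho x * (e / C)))).
  by rewrite ler_wpM2l ?(ltW C0)// /gauge ler_pM ?exprn_ge0 ?powR_ge0.
by rewrite le_eqVlt; apply/orP; left; apply/eqP; field; rewrite gt_eqF.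
Qed.

Lemma small_on_le0 k alpha (T : Type) (X : set T) (rho q : T -> R) :
  (forall x, 0 <= rho x) -> (forall x, X x -> q x <= 0) ->
  small_on k alpha X rho q.
Proof.
move=> r0 q0; rewrite /small_on /ohquant.
have h (e : R) : 0 < e -> exists2 d : R, 0 < d &
    forall x, X x -> rho x < d -> q x <= e * gauge k alpha (rho x).
  move=> e0; exists 1 => // x Xx _; apply: le_trans (q0 x Xx) _.
  by rewrite mulr_ge0 ?(ltW e0)// gauge_ge0.
by case: ifP => // _; exists 1 => //; exact: h.
Qed.

(** The common consequence of both kinds of smallness: for positive [alpha] the surplus power of the
    radius absorbs the constant. It is the form in which jets are compared. *)
Lemma small_on_littleo k alpha (T : Type) (X : set T) (rho q : T -> R)
    (e : R) : 0 <= alpha -> (forall x, 0 <= rho x) ->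
  small_on k alpha X rho q -> 0 < e -> exists2 d : R, 0 < d &
    forall x, X x -> rho x < d -> q x <= e * rho x ^+ k.
Proof.
move=> a0 r0; rewrite /small_on /ohquant.
case: eqVneq => [-> /(_ e) h e0|an0 [C C0]].
  have [d d0 dP] := h e0; exists d => // x Xx xd.
  by apply: le_trans (dP x Xx xd) _; rewrite /gauge powRr0 mulr1.
have agt0 : 0 < alpha by rewrite lt_def an0.
move=> [d d0 dP] e0; pose t := (e / C) `^ alpha^-1.
have t0 : 0 < t by rewrite powR_gt0// divr_gt0.
have tE : t `^ alpha = e / C.
  by rewrite /t -powRrM mulVf// powRr1// ltW// divr_gt0.
exists (Num.min d t); first by rewrite lt_min d0.
move=> x Xx; rewrite lt_min => /andP[xd xt].
apply: le_trans (dP x Xx xd) _.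
have xa : rho x `^ alpha <= e / C.
  by rewrite -tE; apply: ge0_ler_powR; rewrite ?nnegrE ?(ltW t0)// ?(ltW xt)// r0.
apply: (@le_trans _ _ (C * (rho x ^+ k * (e / C)))).
  by rewrite ler_wpM2l ?(ltW C0)// /gauge ler_wpM2l ?exprn_ge0.
by rewrite le_eqVlt; apply/orP; left; apply/eqP; field; rewrite gt_eqF.
Qed.

Lemma near_right0P (P : R -> Prop) : (\forall r \near (0 : R)^'+, P r) <->
  exists2 d : R, 0 < d & forall r, 0 < r -> r < d -> P r.
Proof.
split=> [/near_normP[d d0 dP]|[d d0 dP]].
  by exists d => // r r0 rd; apply: dP => //; rewrite subr0 gtr0_norm.
apply: ((near_normP (0 : R) (fun r => 0 < r -> P r)).2).
exists d => // r; rewrite subr0 => rd r0; apply: dP => //.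
by rewrite -(gtr0_norm r0).
Qed.

Lemma small_orderE k alpha (h : R -> \bar R) : 0 <= alpha ->
  (forall r : R, 0 < r -> (0 <= h r)%E) ->
  small_order k alpha h <-> ohquant alpha (fun e => exists2 d : R, 0 < d &
    forall r : R, 0 < r -> r < d -> (h r <= (e * gauge k alpha r)%:E)%E).
Proof.
move=> a0 h0; rewrite /small_order /ohquant; case: eqVneq => [->|an0].
  have gE (r : R) : gauge k 0 r = r ^+ k by rewrite /gauge powRr0 mulr1.
  split.
    move=> /fine_cvgP[hf hc] e e0; apply/near_right0P.
    have hc' : \forall r \near (0 : R)^'+,
        `|0 - fine ((r ^- k)%:E * h r)%E| <= e by exact: cvgr_dist_le hc _ e0.
    have r0N : \forall r \near (0 : R)^'+, 0 < r by apply/near_right0P; exists 1.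
    apply: filterS3 r0N hf hc' => r rgt0 rf; rewrite sub0r normrN => re.
    have : ((r ^- k)%:E * h r <= e%:E)%E.
      by rewrite -(fineK rf) lee_fin; apply: le_trans (ler_norm _) re.
    by rewrite lee_pdivrMl ?exprn_gt0// gE mulrC EFinM.
  move=> hP; apply/fine_cvgP.
  have hr (e : R) : 0 < e -> \forall r \near (0 : R)^'+,
      (0 <= (r ^- k)%:E * h r <= e%:E)%E.
    move=> e0; have [d d0 dP] := hP e e0.
    apply/near_right0P; exists d => // r r0 rd; apply/andP; split.
      by rewrite mule_ge0 ?h0// lee_fin invr_ge0 exprn_ge0// ltW.
    by rewrite lee_pdivrMl ?exprn_gt0// -EFinM mulrC -gE; exact: dP.
  have fin (e : R) (x : \bar R) : (0 <= x <= e%:E)%E -> x \is a fin_num.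
    by case/andP=> x0 xe; rewrite ge0_fin_numE// (le_lt_trans xe)// ltry.
  split; first by apply: filterS (hr 1 ltr01) => r; exact: fin.
  apply/cvgrPdist_le => e e0; apply: filterS (hr e e0) => r re /=.
  have rf := fin _ _ re; move: re; rewrite sub0r normrN -(fineK rf) !lee_fin/=.
  by case/andP=> x0 xe; rewrite ger0_norm.
have {an0} agt0 : 0 < alpha by rewrite lt_def an0.
have gE (r : R) : 0 < r -> r `^ (- (k%:R + alpha)) = (gauge k alpha r)^-1.
  move=> r0; rewrite powRN powRD ?(gt_eqF r0) ?implybT//.
  by rewrite powR_mulrn// ltW.
split.
  move=> /ereal_inf_lt[_ [V V0 <-] Vlt].
  (* The supremum over [V] is below [+oo], yet it may be negative or [-oo]; a positive real bound is
     chosen in each case. *)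
  have [C [C0 VC]] : exists C : R, 0 < C /\
      (ereal_sup ((fun r => (r `^ (- (k%:R + alpha)))%:E * h r)%E @` V) <= C%:E)%E.
    case: ereal_sup Vlt => [s _|//|_].
      exists (`|s| + 1); split; first by rewrite ltr_wpDl.
      by rewrite lee_fin (le_trans (ler_norm s))// lerDl.
    by exists 1; split=> //; rewrite leNye.
  exists C => //.
  have : \forall r \near (0 : R)^'+, V r by [].
  move=> /near_right0P[d d0 dV]; exists d => // r r0 rd.
  have : ((r `^ (- (k%:R + alpha)))%:E * h r <= C%:E)%E.
    by apply: le_trans VC; apply: ereal_sup_ubound; exists r => //; exact: dV.
  by rewrite gE// lee_pdivrMl ?gauge_gt0// -EFinM mulrC.
move=> [C C0 [d d0 dP]].
apply: (@le_lt_trans _ _ C%:E); last by rewrite ltry.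
apply: (@le_trans _ _ (ereal_sup
    ((fun r => (r `^ (- (k%:R + alpha)))%:E * h r)%E @` [set r | 0 < r < d]))).
  apply: ereal_inf_lbound; exists [set r | 0 < r < d] => //.
  suff : \forall r \near (0 : R)^'+, 0 < r < d by [].
  by apply/near_right0P; exists d => // r r0 rd; rewrite r0.
apply: ge_ereal_sup => _ [r /andP[r0 rd] <-].
by rewrite gE// lee_pdivrMl ?gauge_gt0// -EFinM mulrC; exact: dP.
Qed.

(** A point is tested at the radius [r = rho x], except when [rho x = 0], since radii are positive;
    then [q x] is bounded by arbitrarily small numbers. The order [k.+1] makes the gauge tend to 0
    there. *)
Lemma small_order_sup k alpha (T : Type) (X : set T) (rho q : T -> R)
    (h : R -> \bar R) : 0 <= alpha ->
  (forall x, 0 <= rho x) -> (forall x, X x -> 0 <= q x) ->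
  (forall r : R, 0 < r -> exists2 x, X x & rho x <= r) ->
  (forall r : R, 0 < r -> h r = ereal_sup [set (q x)%:E | x in X `&` [set x | rho x <= r]]) ->
  small_order k.+1 alpha h <-> small_on k.+1 alpha X rho q.
Proof.
move=> a0 r0 q0 Xr hE.
have h0 (r : R) : 0 < r -> (0 <= h r)%E.
  move=> rgt0; have [x Xx xr] := Xr r rgt0; rewrite hE//.
  apply: (@le_trans _ _ (q x)%:E); first by rewrite lee_fin q0.
  by apply: ereal_sup_ubound; exists x.
apply: (iff_trans (small_orderE _ a0 h0)); split.
  apply: (ohquant_imp ltr01) => e e0 [d d0 dP]; rewrite mul1r; exists d => // x Xx xd.
  have qr (r : R) : 0 < r -> r < d -> rho x <= r -> q x <= e * gauge k.+1 alpha r.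
    move=> rgt0 rd xr; rewrite -lee_fin; apply: le_trans (dP r rgt0 rd).
    by rewrite hE//; apply: ereal_sup_ubound; exists x.
  have [rx0|rx0] := eqVneq (rho x) 0; last first.
    by apply: qr => //; rewrite lt_def rx0 r0.
  rewrite rx0 gauge0 mulr0; apply/ler_addgt0Pl => eta eta0; rewrite addr0.
  pose r := Num.min (d / 2) (Num.min 1 (eta / e)).
  have rgt0 : 0 < r by rewrite !lt_min ltr01 !divr_gt0.
  have r1 : r <= 1 by rewrite !ge_min lexx !orbT.
  have rd : r < d by apply: (@le_lt_trans _ _ (d / 2)); [rewrite ge_min lexx|lra].
  have re : r <= eta / e by rewrite !ge_min lexx !orbT.
  apply: le_trans (qr r rgt0 rd _) _; first by rewrite rx0 ltW.
  apply: le_trans (ler_wpM2l (ltW e0) (gauge_le_id k a0 (ltW rgt0) r1)) _.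
  by rewrite mulrC -ler_pdivlMr.
apply: (ohquant_imp ltr01) => e e0 [d d0 dP]; rewrite mul1r; exists d => // r rgt0 rd.
rewrite hE//; apply: ge_ereal_sup => _ [x [Xx xr] <-].
rewrite lee_fin; apply: le_trans (dP x Xx (le_lt_trans xr rd)) _.
by rewrite ler_wpM2l ?(ltW e0)// gauge_le// r0.
Qed.

(** * Distance to a set and nearly nearest points *)

Section Distance.
Variable V : normedModType R.
Implicit Types (x y a : V) (A B : set V).

(** [fine] sends the infinite distance to the empty set to 0, so comparisons with actual distances
    carry a point of the set as a witness. *)
Definition dist x A : R := fine (edist_set x A).

Lemma edist_setE x A b : A b -> edist_set x A = (dist x A)%:E.
Proof.
move=> Ab; rewrite /dist fineK// ge0_fin_numE.
  apply: (@le_lt_trans _ _ `|x - b|%:E); last by rewrite ltry.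
  by apply: ereal_inf_lbound; exists b.
by apply: le_ereal_inf_tmp => _ [y _ <-]; rewrite lee_fin.
Qed.

Lemma dist_le x A b : A b -> dist x A <= `|x - b|.
Proof.
move=> Ab; rewrite -lee_fin -(edist_setE x Ab).
by apply: ereal_inf_lbound; exists b.
Qed.

Lemma dist_ge0 x A : 0 <= dist x A.
Proof.
by apply: fine_ge0; apply: le_ereal_inf_tmp => _ [y _ <-]; rewrite lee_fin.
Qed.

Lemma dist_adherent x A b (e : R) : A b -> 0 < e ->
  exists y, A y /\ `|x - y| < dist x A + e.
Proof.
move=> Ab e0.
have : (edist_set x A < (dist x A + e)%:E)%E.
  by rewrite (edist_setE x Ab) lte_fin ltrDl.
by move=> /ereal_inf_lt[_ [y Ay <-]]; rewrite lte_fin; exists y.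
Qed.

Lemma dist_lipschitz x y A b : A b -> dist x A <= `|x - y| + dist y A.
Proof.
move=> Ab; apply/ler_addgt0Pr => e e0; have [z [Az yz]] := dist_adherent y Ab e0.
apply: le_trans (dist_le x Az) _.
by apply: le_trans (ler_distD y _ _) _; rewrite -addrA lerD2l ltW.
Qed.

Lemma closure_dist A a (e : R) : closure A a -> 0 < e ->
  exists y, A y /\ `|y - a| < e.
Proof.
move=> cA e0; have [|y [Ay ye]] := cA [set y | `|y - a| < e].
  by apply/near_normP; exists e.
by exists y.
Qed.

Lemma dist_closure A a : closure A a -> dist a A = 0.
Proof.
move=> cA; apply/eqP; rewrite eq_le dist_ge0 andbT.
apply/ler_addgt0Pl => e e0; rewrite addr0.
have [y [Ay ye]] := closure_dist cA e0.
by apply: le_trans (dist_le a Ay) _; rewrite distrC ltW.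
Qed.

(** For nearly nearest points [y1] of A and [y2] of B to [x], the triangle inequality bounds the
    difference of the distances by [dist y1 B + dist y2 A] up to [eta]. Conversely one of the two
    distances vanishes on each set. *)
Lemma small_on_gap k alpha A B a : 0 <= alpha -> closure A a -> B a ->
  small_on k alpha setT (fun x => `|x - a|) (fun x => `|dist x A - dist x B|) <->
  small_on k alpha A (fun x => `|x - a|) (fun x => dist x B) /\
  small_on k alpha B (fun x => `|x - a|) (fun x => dist x A).
Proof.
move=> a0 cA Ba; have cB : closure B a by exact: subset_closure.
have [a1 [Aa1 _]] := closure_dist cA ltr01.
have dist0 (C : set V) x : C x -> dist x C = 0.
  by move=> Cx; apply: dist_closure; exact: subset_closure.
have nE (x : V) : `|x - a| = 0 -> x = a.
  by move=> /normr0_eq0/eqP; rewrite subr_eq0 => /eqP.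
split=> [h|[hA hB]].
  split; apply: (small_on1 (c := 1) (C := 1) (d0 := 1)) h => // x Xx.
  - by move=> /nE ->; rewrite dist_closure.
  - move=> _ _ eta eta0; exists x; split; rewrite ?mul1r// (dist0 A)// sub0r normrN.
    by rewrite (le_trans (ler_norm _))// lerDl ltW.
  - by move=> /nE ->; rewrite dist_closure.
  - move=> _ _ eta eta0; exists x; split; rewrite ?mul1r// (dist0 B)// subr0.
    by rewrite (le_trans (ler_norm _))// lerDl ltW.
(* A nearly nearest point is within [2 * |x - a|] of [x], hence within [3 * |x - a|] of [a]. *)
apply: (small_on2 (c := 3) (C := 1) (d0 := 1)) hA hB => //.
  by move=> x _ /nE ->; rewrite !dist_closure// subrr normr0.
move=> x _ xa _ eta eta0.
have close C c : C c -> closure C a -> exists y, [/\ C y, `|y - a| <= 3 * `|x - a| &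
    `|x - y| <= dist x C + eta].
  move=> Cc cC; have [|y [Cy xy]] := dist_adherent x (e := Num.min eta `|x - a|) Cc.
    by rewrite lt_min eta0.
  have m1 : Num.min eta `|x - a| <= eta by rewrite ge_min lexx.
  have m2 : Num.min eta `|x - a| <= `|x - a| by rewrite ge_min lexx orbT.
  exists y; split=> //; last by apply: le_trans (ltW xy) _; rewrite lerD2l.
  have xC : dist x C <= `|x - a|.
    by have := dist_lipschitz x a Cc; rewrite (dist_closure cC) addr0.
  have := ler_distD x y a; rewrite (distrC y x); lra.
have [y1 [Ay1 y1a xy1]] := close A a1 Aa1 cA.
have [y2 [By2 y2a xy2]] := close B a Ba cB.
exists y1, y2; split=> //; rewrite mul1r ler_norml.
have := dist_lipschitz x y1 Ba; have := dist_lipschitz x y2 Aa1.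
have := dist_ge0 y1 B; have := dist_ge0 y2 A.
by move=> *; apply/andP; split; lra.
Qed.

End Distance.

Section GapExcess.
Variables (n : nat).
Implicit Types (A B : set (euclid R n)) (a : euclid R n).

Lemma excess_small k alpha A B a : 0 <= alpha -> closure A a -> B !=set0 ->
  small_order k.+1 alpha (excess A B a) <->
  small_on k.+1 alpha A (fun x => `|x - a|) (fun x => dist x B).
Proof.
move=> a0 cA [b Bb]; apply: small_order_sup => //.
- by move=> x _; exact: dist_ge0.
- by move=> r r0; have [y [Ay ya]] := closure_dist cA r0; exists y => //; exact: ltW.
move=> r r0; rewrite /excess; congr ereal_sup; apply/seteqP; split=> _ [x [Ax xr] <-].
  by exists x; [split=> //; rewrite /= distrC|rewrite (edist_setE _ Bb)].
by exists x; [split=> //; rewrite /closedB/closed_ball_/= distrC|rewrite (edist_setE _ Bb)].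
Qed.

Lemma gap_small k alpha A B a : 0 <= alpha -> closure A a -> B a ->
  small_order k.+1 alpha (gap A B a) <->
  small_on k.+1 alpha A (fun x => `|x - a|) (fun x => dist x B) /\
  small_on k.+1 alpha B (fun x => `|x - a|) (fun x => dist x A).
Proof.
move=> a0 cA Ba; apply: iff_trans (small_on_gap _ a0 cA Ba).
have [a1 [Aa1 _]] := closure_dist cA ltr01.
apply: small_order_sup => //.
- by move=> r r0; exists a => //; rewrite subrr normr0 ltW.
move=> r r0; rewrite /gap; congr ereal_sup.
have eE x : `|edist_set x A - edist_set x B|%E = `|dist x A - dist x B|%:E.
  by rewrite (edist_setE _ Aa1) (edist_setE _ Ba).
apply/seteqP; split=> _ [x xr <-].
  by exists x => //; split=> //=; rewrite distrC.
by case: xr => _ xr; exists x => //; rewrite /closedB/closed_ball_/= distrC.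
Qed.

End GapExcess.

End Smallness.

(** * Charts and local graphs *)

Section Chart.
Variables (R : realType) (V : normedModType R) (k : nat) (alpha : R).
Variables (U : set V) (f g : V -> V) (a : V) (T B : set V).
Hypotheses (oU : open U) (ofU : open (f @` U)).
Hypothesis fC : Cclass k.+1 alpha U f.
Hypothesis gC : Cclass k.+1 alpha (f @` U) g.
Hypothesis gK : forall x, U x -> g (f x) = x.
Hypothesis Ua : U a.

Let dfa : differentiable f a. Proof. by have [df _] := fC; exact: df. Qed.
Let dga : differentiable g (f a).
Proof. by have [dg _] := gC; apply: dg; exists a. Qed.
Let UN : nbhs a U. Proof. exact: open_nbhs_nbhs. Qed.
Let fUN : nbhs (f a) (f @` U).
Proof. by apply: open_nbhs_nbhs; split=> //; exists a. Qed.

Lemma chart_diffK v : 'd g (f a) ('d f a v) = v.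
Proof.
have e1 : \forall x \near a, id x = (g \o f) x.
  by apply: filterS UN => x Ux; rewrite /= gK.
have [_] := near_eq_diff e1 (ex_diff : differentiable id a).
rewrite (diff_comp dfa dga) => /(congr1 (@^~ v)) /= ->.
by rewrite diff_val.
Qed.

Lemma chart_diffKV w : 'd f a ('d g (f a) w) = w.
Proof.
have e1 : \forall y \near f a, id y = (f \o g) y.
  by apply: filterS fUN => _ [x Ux <-]; rewrite /= gK.
have dfg : differentiable f (g (f a)) by rewrite gK.
have [_] := near_eq_diff e1 (ex_diff : differentiable id (f a)).
rewrite (diff_comp dga dfg) => /(congr1 (@^~ w)) /=; rewrite gK// => ->.
by rewrite diff_val.
Qed.

Hypothesis Ba : B a.
Hypothesis fBT : f @` (B `&` U) = T `&` (f @` U).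
Hypothesis TZ : forall x y c, T x -> T y -> T (x + c *: y).

Let Tfa : T (f a).
Proof.
have : (f @` (B `&` U)) (f a) by exists a.
by rewrite fBT => -[].
Qed.

(** The straight line through [f a] in direction ['d f a v] stays in [T]; its image under [g] is a
    curve in [B] with velocity [v] at [a]. *)
Lemma chart_curve v (e : R) : T ('d f a v) -> 0 < e ->
  exists2 d : R, 0 < d & forall t : R, 0 < t -> t < d ->
    exists b, B b /\ `|b - (a + t *: v)| <= e * t.
Proof.
move=> Tv e0; set w := 'd f a v.
have w0 : 0 < `|w| + 1 by rewrite ltr_wpDl.
have e'0 : 0 < e / (`|w| + 1) by rewrite divr_gt0.
have [d d0 dP] := (near_normP _ _).1 (filterI fUN (diff_epsP dga e'0)).
exists (d / (`|w| + 1)); first by rewrite divr_gt0.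
move=> t t0 td; have twE : (f a + t *: w) - f a = t *: w by rewrite addrC addKr.
have tw : `|t *: w| <= t * (`|w| + 1).
  by rewrite normrZ gtr0_norm// ler_pM2l// lerDl.
have twd : `|(f a + t *: w) - f a| < d.
  by rewrite twE; apply: le_lt_trans tw _; rewrite -ltr_pdivlMr.
have [fUy hg] := dP _ twd.
have : (T `&` (f @` U)) (f a + t *: w) by split=> //; exact: TZ.
rewrite -fBT => -[b [Bb Ub] fb]; exists b; split=> //.
move: hg; rewrite -fb gK// gK// fb twE linearZ/= chart_diffK => hg.
rewrite opprD addrA; apply: le_trans hg _.
apply: le_trans (ler_wpM2l (ltW e'0) tw) _.
by rewrite mulrCA divfK 1?mulrC// gt_eqF.
Qed.

(** The chord [f b - f a] lies in [T], and the differential of [g] takes it to a tangent vector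
    close to [b - a]. The constant [1 + c] bounds the chord in terms of [b - a]. *)
Lemma chart_secant (e : R) : 0 < e ->
  exists2 d : R, 0 < d & forall b, B b -> `|b - a| < d ->
    exists v, T ('d f a v) /\ `|b - a - v| <= e * `|b - a|.
Proof.
move=> e0; have [c c0 cP] := linear_lipschitz (diff_continuous dfa).
have e'0 : 0 < e / (1 + c) by rewrite divr_gt0// addr_gt0.
have [d1 d10 d1P] := (near_normP _ _).1 (diff_epsP dga e'0).
have [d2 d20 d2P] := (near_normP _ _).1 (filterI UN (diff_epsP dfa ltr01)).
have c1 : 0 < 1 + c by rewrite addr_gt0.
exists (Num.min d2 (d1 / (1 + c))); first by rewrite lt_min d20 divr_gt0.
move=> b Bb; rewrite lt_min => /andP[bd2 bd1].
have [Ub fb] := d2P b bd2.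
have fba : `|f b - f a| <= (1 + c) * `|b - a|.
  rewrite -[f b - f a](subrK ('d f a (b - a))) mulrDl.
  by apply: le_trans (ler_normD _ _) _; rewrite lerD.
exists ('d g (f a) (f b - f a)); rewrite chart_diffKV; split.
  have : (T `&` (f @` U)) (f b) by rewrite -fBT; exists b.
  by move=> [Tfb _]; rewrite -scaleN1r; exact: TZ.
have := d1P (f b); rewrite !gK// => h; apply: le_trans (h _) _.
  by apply: le_lt_trans fba _; rewrite mulrC -ltr_pdivlMr.
apply: le_trans (ler_wpM2l (ltW e'0) fba) _.
by rewrite mulrA divfK// gt_eqF.
Qed.

End Chart.

Lemma diff_lin_add_comp (R : realType) (V W Z : normedModType R)
    (P : {linear V -> Z}) (N : {linear W -> Z}) (f : V -> W) a v :
  continuous P -> continuous N -> differentiable f a ->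
  'd (P \+ (N \o f)) a v = P v + N ('d f a v).
Proof.
move=> Pc Nc df.
have dN := linear_differentiable (f a) Nc.
have dNf := differentiable_comp df dN.
rewrite (diffD (linear_differentiable a Pc) dNf)/= (diff_lin a Pc).
by rewrite (diff_comp df dN)/= (diff_lin _ Nc).
Qed.

Section LocalGraph.
Variables (R : realType) (n : nat).
Local Notation E := (euclid R n).
Implicit Types (S T : {vspace E}).

Lemma dim_orthc S : (\dim S + \dim (orthc S))%N = n.
Proof.
rewrite -dimv_disjoint_sum ?orthc_capv// orthc_addv dimvf.
by rewrite /dim/= mul1n.
Qed.

Lemma oprojD S (x y : E) : oproj S (x + y) = oproj S x + oproj S y.
Proof. exact: (linearD [the {linear E -> subvs_of S} of oproj S]). Qed.

Lemma oprojB S (x y : E) : oproj S (x - y) = oproj S x - oproj S y.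
Proof. exact: (linearB [the {linear E -> subvs_of S} of oproj S]). Qed.

Lemma oproj0 S : oproj S (0 : E) = 0.
Proof. exact: (linear0 [the {linear E -> subvs_of S} of oproj S]). Qed.

Lemma vsval0 S : vsval (0 : subvs_of S) = 0 :> E.
Proof. by []. Qed.

Lemma vsvalD S (u v : subvs_of S) : vsval (u + v) = vsval u + vsval v :> E.
Proof. exact: (linearD [the {linear subvs_of S -> E} of vsval]). Qed.

Lemma vsvalB S (u v : subvs_of S) : vsval (u - v) = vsval u - vsval v :> E.
Proof. exact: (linearB [the {linear subvs_of S -> E} of vsval]). Qed.

Lemma vsvalZ S (c : R) (u : subvs_of S) : vsval (c *: u) = c *: vsval u :> E.
Proof. exact: (linearZZ [the {linear subvs_of S -> E} of vsval]). Qed.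

Lemma vsval_oprojP S (c : R) (x y : E) : vsval (oproj S (c *: x + y)) =
  c *: vsval (oproj S x) + vsval (oproj S y).
Proof. exact: (linearP (daddv_pi S (orthc S))). Qed.

(** The complements have equal dimension, so coordinates in a basis of the complement of [T] can be
    transferred to a basis of the complement of [S]. *)
Lemma linear_with_kernel S T : \dim T = \dim S ->
  exists N : {linear E -> E}, (forall x, N x \in orthc S) /\
    forall x, N x = 0 <-> x \in T.
Proof.
move=> TS.
have dd : \dim (orthc T) = \dim (orthc S).
  by apply/eqP; rewrite -(eqn_add2l (\dim S)) dim_orthc -TS dim_orthc.
have [bS [bSf bSS]] : exists bS : (\dim (orthc T)).-tuple E,
    free bS /\ forall i, bS`_i \in orthc S.
  rewrite dd; exists (vbasis (orthc S)).
  split; first exact: basis_free (vbasisP _).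
  move=> i; have [ilt|] := ltnP i (size (vbasis (orthc S))).
    by apply: vbasis_mem; exact: mem_nth.
  by move=> /(nth_default 0) ->; rewrite mem0v.
pose Nf x := \sum_(i < \dim (orthc T))
  coord (vbasis (orthc T)) i (vsval (oproj (orthc T) x)) *: bS`_i.
have Nlin : linear Nf.
  move=> c x y; rewrite /Nf scaler_sumr -big_split; apply: eq_bigr => i _.
  by rewrite vsval_oprojP (linearP (coord _ i)) scalerDl scalerA.
pose NM := GRing.isLinear.Build _ _ _ _ _ Nlin.
pose N : {linear E -> E} := HB.pack Nf NM.
exists N; split=> x.
  by apply: memv_suml => i _; exact: memvZ.
have -> : x \in T = (vsval (oproj (orthc T) x) == 0).
  apply/idP/eqP => [xT|h]; first exact: oproj_orthc_id.
  by rewrite (oproj_add T x) h addr0 subvsP.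
split=> [Nx0|/eqP xT].
  rewrite (coord_vbasis (subvsP (oproj (orthc T) x))); apply/eqP.
  rewrite big1// => i _; move/freeP: bSf => /(_ _ Nx0 i) ->.
  by rewrite scale0r.
by rewrite /N/= /Nf xT big1// => i _; rewrite linear0 scale0r.
Qed.

Lemma local_graph k alpha S T (U : set E) (f g : E -> E) (a : E) (B : set E) :
  0 <= alpha <= 1 -> open U -> Cclass k.+1 alpha U f ->
  (forall x, U x -> g (f x) = x) -> U a -> B a ->
  f @` (B `&` U) = [set` T] `&` (f @` U) -> \dim T = \dim S ->
  (forall v, 'd f a v \in T -> v \in orthc S -> v = 0) ->
  exists2 h : subvs_of S -> subvs_of (orthc S), Cclass k.+1 alpha setT h &
    exists2 N, nbhs a N & B `&` N = graph_of h `&` N.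
Proof.
move=> a01 oU fC gK Ua Ba fBT TS tr; have /andP[_ a1] := a01.
have Sfin := findim_subvs S; have Efin := findim_euclid R n.
have [N [NS NT]] := linear_with_kernel TS.
have Nc : continuous N by exact: findim_linear_continuous.
have [pS pSE] : exists pS : {linear E -> E}, forall x, pS x = vsval (oproj S x).
  by exists [the {linear E -> E} of vsval \o oproj S].
have pSc : continuous pS by exact: findim_linear_continuous.
pose Phi := pS \+ (N \o f).
have PhiC : Cclass k.+1 alpha U Phi.
  exact: (CclassD oU (@Cclass_lin R _ _ k.+1 alpha U pS a1 pSc)
    (Cclass_lin_comp oU Nc fC)).
have [df _] := fC.
have dPhi v : 'd Phi a v = pS v + N ('d f a v).
  have h := @diff_lin_add_comp R E E E pS N f a v pSc Nc (df a Ua).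
  exact: h.
have oprojN x : oproj S (N x) = 0.
  by rewrite -(oproj_id (NS x)) oproj_vsval_orthc.
have PhiE x : Phi x = pS x + N (f x) by [].
(* [Phi] preserves the component in [S], so the inverse sends a point of [S] to a point lying over
   it. *)
have oprojPhi x : oproj S (Phi x) = oproj S x.
  by rewrite PhiE pSE oprojD oprojK oprojN addr0.
have PhiT x : f x \in T -> Phi x = vsval (oproj S x).
  by move=> /NT fx0; rewrite PhiE fx0 addr0 pSE.
have dPhi0 v : 'd Phi a v = 0 -> v = 0.
  rewrite dPhi => h.
  have pv : oproj S v = 0.
    have := congr1 (oproj S) h.
    by rewrite oprojD oprojN addr0 oproj0 pSE oprojK.
  apply: tr; last by have := oproj_orth S v; rewrite pv vsval0 subr0.
  by apply/NT; move: h; rewrite pSE pv vsval0 add0r.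
have fT b : B b -> U b -> f b \in T.
  move=> Bb Ub; have : (f @` (B `&` U)) (f b) by exists b.
  by rewrite fBT => -[].
have eD i j : ecoord i (@edelta R n j) = (i == j)%:R :> R.
  by rewrite /ecoord /edelta mxE eqxx.
have [W [Psi [[oW WPa] PsiP nearPsi PsiC]]] := inverse_function
  (l := fun i => [the {linear E -> R} of ecoord i])
  (@ecoord_continuous R n) (@ecoordE R n) eD a01 oU Ua PhiC dPhi0.
pose p := oproj S a.
have PhiaE : Phi a = vsval p by apply/PhiT/fT.
have [d d0 dW] := (near_normP _ _).1 (open_nbhs_nbhs (conj oW WPa)).
have [rho [rhoC rhod rhoid]] :=
  smooth_retraction p Sfin a01 d0 (Cclass_norm2 S k.+1 a1).
have Wrho s : W (vsval (rho s)).
  by apply: dW; rewrite PhiaE -vsvalB; exact: rhod.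
pose h s := oproj (orthc S) (Psi (vsval (rho s))).
exists h.
  apply: (Cclass_lin_comp (L := [the {linear E -> subvs_of (orthc S)} of oproj (orthc S)])
    (f := fun s => Psi (vsval (rho s)))).
  - exact: openT.
  - exact: oproj_continuous.
  have vrC : Cclass k.+1 alpha setT (fun s => vsval (rho s)).
    apply: (Cclass_lin_comp (L := [the {linear subvs_of S -> E} of vsval])) rhoC.
      exact: openT.
    exact: vsval_continuous.
  exact: (CclassS_comp Sfin Efin openT oW a01 (fun s _ => Wrho s) vrC PsiC).
have rhoN : \forall x \near a, rho (oproj S x) = oproj S x.
  exact: (@oproj_continuous R n S a _ rhoid).
have UN : nbhs a U by apply: open_nbhs_nbhs.
exists [set x | [/\ U x, W (Phi x) /\ Psi (Phi x) = x & rho (oproj S x) = oproj S x]].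
  by apply: filterS3 UN nearPsi rhoN => x.
apply/seteqP; split=> x [Xx [Ux [WPx PsiPx] rx]]; split=> //.
  exists (oproj S x) => //; rewrite /h rx.
  have -> : Psi (vsval (oproj S x)) = x by rewrite -(PhiT x (fT x Xx Ux)).
  by rewrite -oproj_add.
(* Conversely, [y] lies over [s], and [Phi y] in [S] forces [f y] into [T]. Both [x] and [y] are the
   graph point over [s]; injectivity of the chart then puts [x] in [B]. *)
move: Xx => [s _ sx].
have sE : oproj S x = s by rewrite -sx oprojD oprojK oproj_vsval_orthc addr0.
rewrite sE in rx; set y := Psi (vsval s).
have Ws : W (vsval s) by rewrite -rx.
have [Uy Phiy] := PsiP _ Ws; rewrite -/y in Uy Phiy.
have sy : oproj S y = s by rewrite -oprojPhi Phiy oprojK.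
have fyT : f y \in T.
  apply/NT; move: Phiy; rewrite PhiE pSE sy => /eqP.
  by rewrite -subr_eq0 addrAC subrr add0r => /eqP.
have xy : x = y by rewrite -sx /h rx -/y -sy -oproj_add.
have : ([set` T] `&` (f @` U)) (f x) by rewrite xy; split=> //; exists y.
by rewrite -fBT => -[b [Bb Ub] fb]; rewrite -(gK x Ux) -fb gK.
Qed.

End LocalGraph.

(** * Contact of functions with equal jets *)

Section JetUniqueness.
Variable R : realType.
Implicit Types V W : normedModType R.

(** Brings functions with different Hölder exponents into one class, where they can be
    subtracted. *)
Lemma Cclass_alpha0 V W k (alpha : R) (U : set V) (f : V -> W) :
  Cclass k alpha U f -> Cclass k 0 U f.
Proof.
elim: k f => [|k ih] f /=; last by move=> [df dC]; split=> // v; exact/ih/dC.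
by move=> h x /h[fc _]; split=> //; rewrite ltxx.
Qed.

Lemma jet_value V W k (f : V -> W) x : jet k f x x = f x.
Proof.
rewrite /jet big_ord_recl big1 => [|i _].
  by rewrite /= fact0 invr1 scale1r addr0.
by rewrite /= subrr linear0 scaler0.
Qed.

Lemma jet_small V W k (alpha : R) (f g : V -> W) p : findim V ->
  0 <= alpha <= 1 -> Cclass k alpha setT f -> Cclass k alpha setT g ->
  jet k f p = jet k g p ->
  small_on k alpha setT (fun s => `|s - p|) (fun s => `|f s - g s|).
Proof.
move=> Vfin /andP[a0 a1] fC gC fg.
have hC : Cclass k alpha setT (f \- g) by exact: CclassB openT fC gC.
have jet0 y : jet k (f \- g) p y = 0 by rewrite (jetB _ _ fC gC) fg subrr.
rewrite /small_on /ohquant; case: eqVneq => [a00 e e0|an0].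
  have [d d0 dP] := jet_littleo p Vfin hC e0; exists d => // s _ sd.
  by have := dP s sd; rewrite jet0 subr0 /gauge a00 powRr0 mulr1.
have agt0 : 0 < alpha by rewrite lt_def an0.
have [C [d d0 dP]] := jet_bigO p Vfin agt0 hC.
exists (`|C| + 1); first by rewrite ltr_wpDl.
exists d => // s _ sd; have := dP s sd; rewrite jet0 subr0 => /le_trans; apply.
by rewrite ler_wpM2r ?gauge_ge0// (le_trans (ler_norm C))// lerDl.
Qed.

End JetUniqueness.

(** * Sets in a cone, their shadows and graphs *)

Section Splitting.
Variables (R : realType) (V X Y : normedModType R).
Variables (P : {linear V -> X}) (Q : {linear V -> Y}).
Variables (i : {linear X -> V}) (j : {linear Y -> V}).

(** [P] and [Q] are the orthogonal projections onto a subspace and its complement,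
    [i] and [j] the inclusions. *)
Record splitting : Prop := Splitting {
  split_P_le : forall x, `|P x| <= `|x|;
  split_Q_le : forall x, `|Q x| <= `|x|;
  split_le : forall x, `|x| <= `|P x| + `|Q x|;
  split_add : forall x, x = i (P x) + j (Q x);
  split_Pi : forall s, P (i s) = s;
  split_Qi : forall s, Q (i s) = 0;
  split_Pj : forall w, P (j w) = 0;
  split_Qj : forall w, Q (j w) = w;
  split_i_norm : forall s, `|i s| = `|s| }.

Hypothesis sp : splitting.
Hypothesis Xfin : findim X.

Let P_le := split_P_le sp.
Let Q_le := split_Q_le sp.
Let PQ_le := split_le sp.
Let iN := split_i_norm sp.
Let PB x y : P (x - y) = P x - P y. Proof. exact: linearB. Qed.
Let QB x y : Q (x - y) = Q x - Q y. Proof. exact: linearB. Qed.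
Let iB s t : i (s - t) = i s - i t. Proof. exact: linearB. Qed.
Let PZ c x : P (c *: x) = c *: P x. Proof. exact: linearZZ. Qed.
Let iZ c s : i (c *: s) = c *: i s. Proof. exact: linearZZ. Qed.

Variables (A : set V) (a : V) (kappa : R).
Hypotheses (cA : closure A a) (kappa_ge0 : 0 <= kappa).
Hypothesis cone : forall x, A x -> `|Q (x - a)| <= kappa * `|P (x - a)|.

Local Notation p := (P a).
Local Notation D := [set i (P x) | x in A].
Local Notation G f := [set i s + j (f s) | s in setT].

Lemma P_dist_le x y : `|P x - P y| <= `|x - y|.
Proof. by rewrite -PB P_le. Qed.

Lemma Q_dist_le x y : `|Q x - Q y| <= `|x - y|.
Proof. by rewrite -QB Q_le. Qed.

Lemma PQ_dist_le x y : `|x - y| <= `|P x - P y| + `|Q x - Q y|.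
Proof. by rewrite -PB -QB PQ_le. Qed.

Lemma cone_dist x : A x -> `|x - a| <= (1 + kappa) * `|P x - p|.
Proof.
move=> /cone; rewrite PB QB => h; apply: le_trans (PQ_dist_le x a) _.
by rewrite mulrDl mul1r lerD2l.
Qed.

Lemma cone_eq x : A x -> `|P x - p| = 0 -> x = a.
Proof.
move=> /cone_dist + h; rewrite h mulr0 normr_le0 subr_eq0.
by move/eqP.
Qed.

Lemma closure_shadow : closure D (i p).
Proof.
move=> B /near_normP[e e0 eB]; have [x [Ax xa]] := closure_dist cA e0.
exists (i (P x)); split; first by exists x.
by apply: eB; rewrite -iB iN; apply: le_lt_trans xa; exact: P_dist_le.
Qed.

Lemma dist_shadow (s : X) (x : V) : A x -> dist (i s) D <= `|s - P x|.
Proof. by move=> Ax; rewrite -iN iB; apply: dist_le; exists x. Qed.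

Lemma dist_shadow_adherent (s : X) (e : R) : 0 < e ->
  exists x, A x /\ `|s - P x| < dist (i s) D + e.
Proof.
move=> e0; have [x0 [Ax0 _]] := closure_dist cA ltr01.
have Dx0 : D (i (P x0)) by exists x0.
have [_ [[x Ax <-] xe]] := dist_adherent (i s) Dx0 e0.
by exists x; split=> //; rewrite -iN iB.
Qed.

Lemma P_graph (f : X -> Y) s : P (i s + j (f s)) = s.
Proof. by rewrite linearD split_Pi// split_Pj// addr0. Qed.

Lemma Q_graph (f : X -> Y) s : Q (i s + j (f s)) = f s.
Proof. by rewrite linearD split_Qi// split_Qj// add0r. Qed.

Lemma graphP (f : X -> Y) x : G f x <-> Q x = f (P x).
Proof.
split=> [[s _ <-]|xf]; first by rewrite P_graph Q_graph.
by exists (P x) => //; rewrite -xf -split_add.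
Qed.

Section Graph.
Variables (B : set V) (f : X -> Y) (N : set V).
Variables (k : nat) (alpha : R).
Hypotheses (a01 : 0 <= alpha <= 1) (fC : Cclass k.+1 alpha setT f).
Hypotheses (Na : nbhs a N) (BN : B `&` N = G f `&` N) (Ba : B a).

Let BgraphE x : N x -> B x <-> Q x = f (P x).
Proof.
move=> Nx; rewrite -graphP; split=> [Bx|gx].
  by have : (B `&` N) x by []; rewrite BN => -[].
by have : (G f `&` N) x by []; rewrite -BN => -[].
Qed.

Lemma graph_value : f p = Q a.
Proof. by have /(BgraphE (nbhs_singleton Na)) := Ba. Qed.

Let local_data : exists L d : R, [/\ 0 < L, 0 < d,
  forall x, `|x - a| < d -> N x &
  forall s t, `|s - p| < d -> `|t - p| < d -> `|f s - f t| <= L * `|s - t|].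
Proof.
have /andP[_ a1] := a01.
have fC1 := Cclass_leq Xfin openT a1 (isT : (1 <= k.+1)%N) fC.
have [L [L0 [d d0 [_ dP]]]] :=
  Cclass1_lipschitz Xfin openT fC1 (I : setT p).
have [r r0 rP] := (near_normP a N).1 Na.
exists L, (Num.min d r); split=> //; first by rewrite lt_min d0.
  by move=> x; rewrite lt_min => /andP[_ /rP].
by move=> s t; rewrite !lt_min => /andP[sd _] /andP[td _]; exact: dP.
Qed.

(** The graph point over [P x] bounds the distance by the vertical deviation. Conversely, for [b] in
    [B] near [x], the deviation is at most [|Q x - Q b| + L * |P b - P x|], hence at most
    [(1 + L) * |x - b|]. The cone condition converts the radius [|x - a|] into [|P x - p|]. *)
Lemma excess_graph l beta : 0 <= beta ->
  small_on l beta A (fun x => `|x - a|) (fun x => dist x B) <->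
  small_on l beta A (fun x => `|P x - p|)
    (fun x => `|Q x - f (P x)|).
Proof.
move=> b0; have [L [d [L0 d0 dN dL]]] := local_data.
have L1 : 0 < 1 + L by rewrite addr_gt0.
have k1 : 0 < 1 + kappa by rewrite ltr_pwDl.
split.
  (* With [|x - a| < d / 3] and slack at most [d / 3], a nearly nearest [b] stays within [d] of [a],
     where [B] is the graph. *)
  apply: (small_on1 (c := 1 + kappa) (C := 1 + L) (d0 := d / 3 / (1 + kappa))) => //.
  - by rewrite !divr_gt0.
  - by move=> y _; exact: dist_ge0.
  - move=> x Ax x0; rewrite (cone_eq Ax x0) graph_value subrr normr0//.
  move=> x Ax _; rewrite ltr_pdivlMr// mulrC => xd eta eta0.
  have xa := cone_dist Ax; exists x; split=> //.
  have xd' : `|x - a| < d / 3 by exact: le_lt_trans xd.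
  pose m := Num.min (eta / (1 + L)) (d / 3).
  have m0 : 0 < m by rewrite lt_min !divr_gt0.
  have meta : (1 + L) * m <= eta.
    by rewrite mulrC -ler_pdivlMr// ge_min lexx.
  have md : m <= d / 3 by rewrite ge_min lexx orbT.
  have [b [Bb xb]] := dist_adherent x Ba m0.
  have xBa : dist x B <= `|x - a| by exact: dist_le.
  have ba : `|b - a| < d.
    have := ler_distD x b a; rewrite (distrC b x); lra.
  have bE := (BgraphE (dN b ba)).1 Bb.
  have sb : `|P b - p| < d by exact: le_lt_trans (P_dist_le _ _) ba.
  have sx : `|P x - p| < d.
    by apply: le_lt_trans (P_dist_le _ _) _; lra.
  have h1 := Q_dist_le x b.
  have h2 := dL _ _ sb sx.
  have h3 : L * `|P b - P x| <= L * `|x - b|.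
    by rewrite ler_pM2l// distrC P_dist_le.
  have h4 := ler_distD (Q b) (Q x) (f (P x)).
  rewrite {2}bE in h4.
  have h5 : (1 + L) * `|x - b| <= (1 + L) * (dist x B + m).
    by rewrite ler_pM2l// ltW.
  lra.
apply: (small_on1 (c := 1) (C := 1) (d0 := d / (1 + L))) => //.
- by rewrite divr_gt0.
- move=> x Ax /normr0_eq0/eqP; rewrite subr_eq0 => /eqP ->.
  by rewrite dist_closure//; exact: subset_closure.
move=> x Ax _; rewrite ltr_pdivlMr// => xd eta eta0; exists x; split=> //.
  by rewrite mul1r P_dist_le.
rewrite mul1r; set y := i (P x) + j (f (P x)).
have xd' : `|x - a| < d.
  apply: le_lt_trans xd; rewrite mulrC -[leLHS]mul1r ler_wpM2r// lerDl.
  exact: ltW.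
have sx : `|P x - p| < d by exact: le_lt_trans (P_dist_le _ _) xd'.
have pd : `|p - p| < d by rewrite subrr normr0.
have By : B y.
  apply/BgraphE; last by rewrite P_graph Q_graph.
  apply: dN; apply: le_lt_trans (PQ_dist_le _ _) _.
  rewrite P_graph Q_graph -graph_value.
  apply: le_lt_trans xd; rewrite mulrC mulrDl mul1r.
  have h1 := P_dist_le x a; have h2 := dL _ _ sx pd.
  by apply: lerD => //; apply: le_trans h2 _; rewrite ler_pM2l.
apply: le_trans (dist_le x By) _.
apply: le_trans (PQ_dist_le _ _) _.
by rewrite P_graph Q_graph subrr normr0 add0r lerDl ltW.
Qed.

(** A point [s] is lifted to the graph; a point of A close to the lift projects to a point of the
    shadow at least as close to [s]. *)
Lemma excess_shadow l beta : 0 <= beta ->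
  small_on l beta B (fun x => `|x - a|) (fun x => dist x A) ->
  small_on l beta setT (fun s => `|s - p|)
    (fun s => dist (i s) D).
Proof.
move=> b0; have [L [d [L0 d0 dN dL]]] := local_data.
have L1 : 0 < 1 + L by rewrite addr_gt0.
have [x0 [Ax0 _]] := closure_dist cA ltr01.
apply: (small_on1 (c := 1 + L) (C := 1) (d0 := d / (1 + L))) => //.
- by rewrite divr_gt0.
- by move=> x _; exact: dist_ge0.
- move=> s _ /normr0_eq0/eqP; rewrite subr_eq0 => /eqP ->.
  by rewrite dist_closure//; exact: closure_shadow.
move=> s _ _; rewrite ltr_pdivlMr// => sd eta eta0.
have sd' : `|s - p| < d.
  apply: le_lt_trans sd; rewrite mulrC -[leLHS]mul1r ler_wpM2r// lerDl.
  exact: ltW.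
have pd : `|p - p| < d by rewrite subrr normr0.
set y := i s + j (f s).
have ya : `|y - a| <= (1 + L) * `|s - p|.
  apply: le_trans (PQ_dist_le _ _) _.
  rewrite P_graph Q_graph -graph_value mulrDl mul1r.
  by rewrite lerD2l; exact: dL.
exists y; split=> //.
  apply/BgraphE; last by rewrite P_graph Q_graph.
  by apply: dN; apply: le_lt_trans ya _; rewrite mulrC.
rewrite mul1r; have [x [Ax yx]] := dist_adherent y Ax0 eta0.
apply: le_trans (dist_shadow s Ax) _.
apply: le_trans (ltW yx); have := P_dist_le y x.
by rewrite P_graph.
Qed.

(** A point [x] of A whose projection is nearly nearest to [s = P b] satisfies [|b - x| <= (1 + L) *
    |s - P x| + |Q x - f (P x)|]: the shadow controls the first term, the estimate on A the
    second. *)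
Lemma shadow_excess l beta : 0 <= beta ->
  small_on l beta A (fun x => `|P x - p|)
    (fun x => `|Q x - f (P x)|) ->
  small_on l beta setT (fun s => `|s - p|)
    (fun s => dist (i s) D) ->
  small_on l beta B (fun x => `|x - a|) (fun x => dist x A).
Proof.
move=> b0; have [L [d [L0 d0 dN dL]]] := local_data.
have L1 : 0 < 1 + L by rewrite addr_gt0.
apply: (small_on2 (c := 3) (C := 1 + L) (d0 := d / 3)) => //.
- by rewrite divr_gt0.
- move=> x _ /normr0_eq0/eqP; rewrite subr_eq0 => /eqP ->.
  by rewrite dist_closure.
move=> b Bb b_gt0 bd eta eta0; set s := P b.
have sa : `|s - p| <= `|b - a| by exact: P_dist_le.
have bE : Q b = f s.
  by apply: (BgraphE _).1 => //; apply: dN; lra.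
pose m := Num.min (eta / (1 + L)) `|b - a|.
have m0 : 0 < m by rewrite lt_min b_gt0 divr_gt0.
have meta : (1 + L) * m <= eta.
  by rewrite mulrC -ler_pdivlMr// ge_min lexx.
have mb : m <= `|b - a| by rewrite ge_min lexx orbT.
have [x [Ax sx]] := dist_shadow_adherent s m0.
have Dp : dist (i s) D <= `|s - p|.
  have [x0 [Ax0 _]] := closure_dist cA ltr01.
  have Dx0 : D (i (P x0)) by exists x0.
  have := dist_lipschitz (i s) (i p) Dx0.
  by rewrite (dist_closure closure_shadow) addr0 -iB iN.
have xp : `|P x - p| <= 3 * `|b - a|.
  have := ler_distD s (P x) p; rewrite (distrC _ s); lra.
exists x, s; split=> //; first by lra.
apply: le_trans (dist_le b Ax) _.
apply: le_trans (PQ_dist_le _ _) _; rewrite -/s bE.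
have sd : `|s - p| < d by lra.
have xd : `|P x - p| < d by lra.
have h1 := dL _ _ sd xd.
have h2 := ler_distD (f (P x)) (f s) (Q x).
have h3 : (1 + L) * `|s - P x| <= (1 + L) * (dist (i s) D + m).
  by rewrite ler_pM2l// ltW.
rewrite (distrC (f (P x)) (Q x)) in h2.
set q1 := `|Q x - _| in h2 *.
have h4 : q1 <= (1 + L) * q1 by rewrite ler_peMl ?normr_ge0// lerDl ltW.
lra.
Qed.

End Graph.

Definition graph_estimate k alpha (f : X -> Y) : Prop :=
  small_on k alpha A (fun x => `|P x - p|)
    (fun x => `|Q x - f (P x)|).

(** The estimate speaks of points of A, and [a] may lie outside A; the value follows along points of
    A tending to [a]. *)
Lemma graph_estimate_value k (alpha : R) f : 0 <= alpha <= 1 ->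
  Cclass k.+1 alpha setT f -> graph_estimate k.+1 alpha f ->
  f p = Q a.
Proof.
move=> a01 fC fE; have /andP[a0 a1] := a01.
have fC1 := Cclass_leq Xfin openT a1 (isT : (1 <= k.+1)%N) fC.
have [L [L0 [d d0 [_ dP]]]] :=
  Cclass1_lipschitz Xfin openT fC1 (I : setT p).
apply/eqP; rewrite -subr_eq0 -normr_le0; apply/ler_addgt0Pl => e e0.
rewrite addr0.
have [r r0 rP] := small_on_littleo a0 (fun x => normr_ge0 (P x - p)) fE ltr01.
(* The estimate at [x] and the difference [Q x - Q a] cost [|x - a|] each, and the variation of [f]
   costs [L * |x - a|]. *)
pose m := Num.min (Num.min d r) (Num.min 1 (e / (2 + L))).
have L2 : 0 < 2 + L by rewrite addr_gt0.
have m0 : 0 < m by rewrite !lt_min d0 r0 ltr01 divr_gt0.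
have [x [Ax]] := closure_dist cA m0; rewrite !lt_min.
move=> /andP[/andP[xd xr] /andP[x1 xe]].
have sx := P_dist_le x a.
have pd : `|p - p| < d by rewrite subrr normr0.
have h1 := dP _ _ pd (le_lt_trans sx xd).
have h2 := rP x Ax (le_lt_trans sx xr).
have h3 := Q_dist_le x a.
have h2' : `|P x - p| ^+ k.+1 <= `|x - a|.
  apply: le_trans (sx); rewrite exprS ler_piMr// exprn_ile1//.
  by apply: le_trans sx (ltW x1).
have h4 := ler_distD (f (P x)) (f p) (Q a).
have h5 := ler_distD (Q x) (f (P x)) (Q a).
rewrite (distrC (f (P x)) (Q x)) in h5.
have h6 : L * `|p - P x| <= L * `|x - a| by rewrite ler_pM2l// distrC.
move: xe; rewrite ltr_pdivlMr// => xe.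
lra.
Qed.

Lemma graph_estimate_jet k (alpha : R) f g : 0 <= alpha <= 1 ->
  Cclass k.+1 alpha setT f -> Cclass k.+1 alpha setT g ->
  jet k.+1 f p = jet k.+1 g p -> graph_estimate k.+1 alpha f ->
  graph_estimate k.+1 alpha g.
Proof.
move=> a01 fC gC fg fE; have /andP[a0 a1] := a01.
have := jet_small Xfin a01 fC gC fg.
move: (fE); apply: (small_on2 (c := 1) (C := 1) (d0 := 1)) => //.
  move=> x Ax x0; have xa := cone_eq Ax x0.
  have fpa : f p = Q a := graph_estimate_value a01 fC fE.
  rewrite xa -fpa -(jet_value k.+1 f) fg jet_value subrr normr0//.
move=> x Ax _ _ eta eta0; exists x, (P x); split=> //; rewrite !mul1r//.
have := ler_distD (f (P x)) (Q x) (g (P x)).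
lra.
Qed.

(** Two exponents are allowed because the jet has to be the same for all of them. Both estimates
    give [o(r^(k+1))], so the difference vanishes to that order along the shadow. *)
Lemma graph_estimate_unique k (alpha beta : R) f g :
  0 <= alpha <= 1 -> 0 <= beta <= 1 ->
  Cclass k.+1 alpha setT f -> Cclass k.+1 beta setT g ->
  graph_estimate k.+1 alpha f -> graph_estimate k.+1 beta g ->
  (forall s, tangent_cone D (i p) (i s)) ->
  jet k.+1 f p = jet k.+1 g p.
Proof.
move=> /andP[a0 a1] /andP[b0 b1] /Cclass_alpha0 fC /Cclass_alpha0 gC fE gE tan.
have hC : Cclass k.+1 0 setT (f \- g) by exact: CclassB openT fC gC.
apply/funext => y; apply/eqP; rewrite -subr_eq0 -(jetB _ _ fC gC); apply/eqP.
rewrite /jet big1// => l _.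
suff -> : iterdiff (f \- g) (nseq l (y - p)) p = 0 by rewrite scaler0.
apply: (iterdiff_eq0 (D := [set P x | x in A]) Xfin hC).
- move=> v e e0; have := tan v.
  move=> /(_ e e0)[_ [r [[x Ax <-] r0 xe re]]].
  exists (P x), r; split=> //; first by exists x.
    by rewrite -iN iB.
  by rewrite -iN iB iZ iB.
- move=> e e0; have e2 : 0 < e / 2 by rewrite divr_gt0.
  have [d1 d10 d1P] := small_on_littleo a0 (fun x => normr_ge0 (P x - p)) fE e2.
  have [d2 d20 d2P] := small_on_littleo b0 (fun x => normr_ge0 (P x - p)) gE e2.
  exists (Num.min d1 d2); first by rewrite lt_min d10.
  move=> _ [x Ax <-]; rewrite lt_min => /andP[x1 x2] /=.
  have h1 := d1P x Ax x1; have h2 := d2P x Ax x2.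
  have := ler_distD (Q x) (f (P x)) (g (P x)).
  rewrite (distrC (f (P x)) (Q x)); set q := _ ^+ _ in h1 h2 *; lra.
- exact: ler01.
- by case: l.
Qed.

(** * Tangent plane, cone condition and shadow *)

Section Transversality.
Variables (T : V -> Prop) (B : set V) (L : {linear V -> V}).
Hypotheses (Ba : B a) (TZ : forall c v, T v -> T (c *: v)).

(** A tangent vector [v] with [P v = 0] yields [c] in A with [c - a - t v] of size [O(e * t)]. The
    projection of [c - a] is then [O(e * t)], by the cone condition so is [c - a] itself, and
    [|v| = O(e)]. *)
Lemma cone_transversal :
  (forall v (e : R), T (L v) -> 0 < e -> exists2 d : R, 0 < d &
     forall t : R, 0 < t -> t < d -> exists b, B b /\ `|b - (a + t *: v)| <= e * t) ->
  small_on 1 0 B (fun x => `|x - a|) (fun x => dist x A) ->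
  forall v, T (L v) -> P v = 0 -> v = 0.
Proof.
move=> curve BA v Lv Sv0.
have [x0 [Ax0 _]] := closure_dist cA ltr01.
apply/eqP; rewrite -normr_le0; apply/ler_addgt0Pl => eta eta0; rewrite addr0.
have K0 : 0 < (2 + kappa) * (3 + `|v|).
  by rewrite mulr_gt0// ltr_pwDl.
pose e := Num.min 1 (eta / ((2 + kappa) * (3 + `|v|))).
have e0 : 0 < e by rewrite lt_min ltr01 divr_gt0.
have e1 : e <= 1 by rewrite ge_min lexx.
have eK : e * ((2 + kappa) * (3 + `|v|)) <= eta.
  by rewrite -ler_pdivlMr// ge_min lexx orbT.
have [d d0 dP] := curve v e Lv e0.
have [r r0 rP] := small_on_littleo (lexx 0) (fun x => normr_ge0 (x - a)) BA e0.
have v1 : 0 < `|v| + 1 by rewrite ltr_wpDl.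
pose t := Num.min (d / 2) (r / 2 / (`|v| + 1)).
have t0 : 0 < t by rewrite lt_min !divr_gt0.
have td : t < d by apply: (@le_lt_trans _ _ (d / 2)); [rewrite ge_min lexx|lra].
have tr : t * (`|v| + 1) <= r / 2.
  by rewrite -ler_pdivlMr// ge_min lexx orbT.
have [b [Bb bt]] := dP t t0 td.
have tv : `|t *: v| = t * `|v| by rewrite normrZ gtr0_norm.
have ba : `|b - a| <= t * (`|v| + e).
  have -> : b - a = (b - (a + t *: v)) + t *: v by rewrite opprD addrA subrK.
  by apply: le_trans (ler_normD _ _) _; rewrite tv; lra.
have te : t * e <= t by rewrite ler_piMr// ltW.
have bar : `|b - a| < r by apply: le_lt_trans ba _; lra.
have := rP b Bb bar; rewrite expr1 => hb.
have et0 : 0 < e * t by rewrite mulr_gt0.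
have [c [Ac bc]] := dist_adherent b Ax0 et0.
(* One [e] comes from the curve, one from choosing [c], and [e * (|v| + e)] from the distance of [b]
   to A; as [e <= 1], [M <= e * (3 + |v|)]. *)
pose M := e * (2 + `|v| + e).
have cM : `|c - a - t *: v| <= M * t.
  have -> : c - a - t *: v = (c - b) + (b - (a + t *: v)).
    by rewrite addrA subrK opprD addrA.
  apply: le_trans (ler_normD _ _) _; rewrite distrC.
  have : e * `|b - a| <= e * (t * (`|v| + e)) by rewrite ler_pM2l.
  rewrite /M; lra.
have cS : `|P (c - a)| <= M * t.
  apply: le_trans cM; apply: le_trans (P_le _).
  by rewrite (PB (c - a)) PZ Sv0 scaler0 subr0.
have cN : `|c - a| <= (1 + kappa) * (M * t).
  apply: le_trans (PQ_le _) _; rewrite mulrDl mul1r lerD//.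
  by apply: le_trans (cone Ac) _; rewrite ler_wpM2l.
have tvM : t * `|v| <= (2 + kappa) * (M * t).
  rewrite -tv -[t *: v](subKr (c - a)); apply: le_trans (ler_normB _ _) _.
  by lra.
have vM : `|v| <= (2 + kappa) * M.
  by rewrite -(ler_pM2l t0) (le_trans tvM)// le_eqVlt; apply/orP; left; apply/eqP; ring.
apply: le_trans vM _; apply: le_trans eK.
rewrite /M mulrCA ler_pM2l// ler_wpM2l ?addr_ge0//.
lra.
Qed.

(** Near a shadow point in direction [s] lie a point of A, a point of [B] and a tangent vector,
    successively. The result is approximate; finite dimension makes it exact later. *)
Lemma shadow_surjective :
  (forall s, tangent_cone D (i p) (i s)) ->
  (forall e : R, 0 < e -> exists2 d : R, 0 < d &
     forall b, B b -> `|b - a| < d ->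
       exists v, T (L v) /\ `|b - a - v| <= e * `|b - a|) ->
  small_on 1 0 A (fun x => `|x - a|) (fun x => dist x B) ->
  forall (s : X) (e : R), 0 < e ->
    exists v, T (L v) /\ `|P v - s| < e.
Proof.
move=> tan secant AB s e e0.
have s1 : 0 < `|s| + 1 by rewrite ltr_wpDl.
have k1 : 0 < 1 + kappa by rewrite ltr_pwDl.
have K0 : 0 < 6 * (1 + kappa) * (`|s| + 1) by rewrite !mulr_gt0.
(* The approximations add up to [3 * h * |x - a|]; after projecting and rescaling this is at most
   [3 * h * (1 + kappa) * (|s| + 1) <= e / 2]. *)
pose h := Num.min 1 (e / (6 * (1 + kappa) * (`|s| + 1))).
have h0 : 0 < h by rewrite lt_min ltr01 divr_gt0.
have h1 : h <= 1 by rewrite ge_min lexx.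
have hK : h * (6 * (1 + kappa) * (`|s| + 1)) <= e.
  by rewrite -ler_pdivlMr// ge_min lexx orbT.
have h20 : 0 < h / 2 by rewrite divr_gt0.
have [d1 d10 d1P] := secant h h0.
have [d2 d20 d2P] := small_on_littleo (lexx 0) (fun x => normr_ge0 (x - a)) AB h20.
pose m := Num.min (Num.min (e / 3) 1) (Num.min (d1 / 2 / (1 + kappa)) (d2 / (1 + kappa))).
have m0 : 0 < m by rewrite !lt_min ltr01 !divr_gt0.
have := tan s.
move=> /(_ m m0)[_ [r [[x Ax <-] r0]]].
rewrite -iB -iZ -iB !iN !lt_min.
move=> /andP[_ /andP[xd1 xd2]] /andP[/andP[re r1] _].
have xa := cone_dist Ax.
rewrite ltr_pdivlMr// in xd1; rewrite ltr_pdivlMr// in xd2.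
have xad2 : `|x - a| < d2 by apply: le_lt_trans xa _; rewrite mulrC.
have [b [Bb xb]] : exists b, B b /\ `|x - b| <= h * `|x - a|.
  have [xa0|xa0] := eqVneq `|x - a| 0.
    exists a; split=> //; rewrite xa0 mulr0//.
  have xagt0 : 0 < `|x - a| by rewrite lt_def xa0 normr_ge0.
  have hx : 0 < h / 2 * `|x - a| by rewrite mulr_gt0.
  have [b [Bb xb]] := dist_adherent x Ba hx; exists b; split=> //.
  by have := d2P x Ax xad2; rewrite expr1; lra.
have hxa : h * `|x - a| <= `|x - a| by rewrite ler_piMl.
have ba : `|b - a| <= 2 * `|x - a|.
  have := ler_distD x b a; rewrite (distrC b x); lra.
have bd : `|b - a| < d1 by apply: le_lt_trans ba _; lra.
have [v [Lv bv]] := d1P b Bb bd.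
exists (r *: v); split.
  by rewrite linearZZ; exact: TZ.
have xv : `|x - a - v| <= 3 * h * `|x - a|.
  have -> : x - a - v = (x - b) + (b - a - v) by rewrite !addrA subrK.
  apply: le_trans (ler_normD _ _) _.
  have : h * `|b - a| <= h * (2 * `|x - a|) by rewrite ler_pM2l.
  lra.
have Sxv : `|P x - p - P v| <= 3 * h * ((1 + kappa) * `|P x - p|).
  apply: (@le_trans _ _ `|x - a - v|).
    by rewrite -!PB; exact: P_le.
  by apply: le_trans xv _; rewrite ler_wpM2l// mulr_ge0// ltW.
have rSv : `|r *: (P x - p) - P (r *: v)| <= e / 2 .
  rewrite PZ -scalerBr normrZ gtr0_norm//.
  apply: le_trans (ler_wpM2l (ltW r0) Sxv) _.
  have rx : r * `|P x - p| <= `|s| + 1.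
    rewrite -{1}(gtr0_norm r0) -normrZ -[r *: _](subrK s) addrC.
    by apply: le_trans (ler_normD _ _) _; rewrite lerD2l ltW.
  have -> : r * (3 * h * ((1 + kappa) * `|P x - p|)) =
      3 * h * (1 + kappa) * (r * `|P x - p|) by ring.
  have h3 : 0 <= 3 * h * (1 + kappa) by rewrite !mulr_ge0// ltW.
  apply: le_trans (ler_wpM2l h3 rx) _; lra.
have := ler_distD (r *: (P x - p)) (P (r *: v)) s.
rewrite (distrC (P (r *: v)) (r *: _)); lra.
Qed.

End Transversality.
End Splitting.

(** * Dimension of the tangent plane *)

Section Dimension.
Variables (R : realType) (n : nat) (S T : {vspace euclid R n}).
Local Notation E := (euclid R n).
Variables (L M : {linear E -> E}).
Hypotheses (LM : cancel L M) (ML : cancel M L).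

(** The tangent plane of the submanifold: [L] is the differential of the chart and [M] its
    inverse. *)
Let TB : {vspace E} := (linfun M @: T)%VS.

Let memTB v : (v \in TB) = (L v \in T).
Proof.
apply/idP/idP => [/memv_imgP[w wT ->]|LvT]; first by rewrite lfunE/= ML.
by apply/memv_imgP; exists (L v) => //; rewrite lfunE/= LM.
Qed.

Let dimTB : \dim TB = \dim T.
Proof.
apply: limg_dim_eq; apply/eqP; rewrite -subv0; apply/subvP => v.
rewrite memv_cap memv_ker lfunE/= => /andP[_ /eqP Mv].
by rewrite memv0 -[v]ML Mv linear0.
Qed.

Let phi : 'End(E) := daddv_pi S (orthc S).

Let phiE v : phi v = vsval (oproj S v). Proof. by []. Qed.

Let phi_sub : (phi @: TB <= S)%VS.
Proof. by apply/subvP => _ /memv_imgP[w _ ->]; rewrite phiE subvsP. Qed.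

Lemma dim_transversal :
  (forall v, L v \in T -> oproj S v = 0 -> v = 0) -> (\dim T <= \dim S)%N.
Proof.
move=> tr; rewrite -dimTB -(limg_dim_eq (f := phi)); first exact: dimvS.
apply/eqP; rewrite -subv0; apply/subvP => v.
rewrite memv_cap memv_ker memTB phiE => /andP[LvT /eqP pv].
by rewrite memv0 (tr v LvT)//; exact/val_inj.
Qed.

Hypothesis surj : forall (s : subvs_of S) (e : R), 0 < e ->
  exists v, L v \in T /\ `|oproj S v - s| < e.

(** The component of [s] orthogonal to the projected plane is smaller than every [e], hence 0. *)
Let surjS : (S <= phi @: TB)%VS.
Proof.
apply/subvP => s sS; set Q := (phi @: TB)%VS.
suff : oproj (orthc Q) s = 0.
  by move=> h; rewrite (oproj_add Q s) h addr0 subvsP.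
apply/eqP; rewrite -normr_le0; apply/ler_addgt0Pl => e e0; rewrite addr0.
have [v [LvT sv]] := surj (oproj S s) e0.
have -> : oproj (orthc Q) s = oproj (orthc Q) (s - vsval (oproj S v)).
  rewrite oprojB -[X in _ = _ - X](_ : 0 = _) ?subr0//.
  apply/esym/val_inj; apply: oproj_orthc_id.
  by rewrite -phiE memv_img// memTB.
apply: le_trans (oproj_norm_le _ _) _; apply: ltW.
by rewrite -{1}(oproj_id sS) -vsvalB vsval_norm distrC.
Qed.

Lemma dim_surjective : (\dim S <= \dim T)%N.
Proof.
apply: leq_trans (dimvS surjS) _; rewrite -dimTB.
by rewrite -(limg_ker_dim phi TB) leq_addl.
Qed.

Lemma surjective_transversal : \dim T = \dim S ->
  forall v, L v \in T -> oproj S v = 0 -> v = 0.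
Proof.
move=> TS v LvT Sv0; have := limg_ker_dim phi TB.
have -> : (phi @: TB = S)%VS by apply/eqP; rewrite eqEsubv phi_sub surjS.
rewrite dimTB TS => /eqP; rewrite -[X in _ == X]add0n eqn_add2r dimv_eq0.
move=> /eqP K0; apply/eqP; rewrite -memv0 -K0 memv_cap memTB LvT memv_ker phiE.
by rewrite Sv0 eqxx.
Qed.

End Dimension.

(** * Submanifolds of Euclidean space *)

Section EuclideanGraphs.
Variables (R : realType) (n : nat).
Local Notation E := (euclid R n).
Implicit Types (S T : {vspace E}) (A B : set E) (a : E).

Lemma oproj_orthc0 S v : v \in orthc S -> oproj S v = 0.
Proof. by move=> vS; rewrite -[v](oproj_id vS) oproj_vsval_orthc. Qed.

Lemma euclid_splitting S :
  splitting (oproj S) (oproj (orthc S)) (@vsval _ _ S) (@vsval _ _ (orthc S)).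
Proof.
split=> [x|x|x|x|s|s|w|w|s].
- exact: oproj_norm_le.
- exact: oproj_norm_le.
- exact: norm_le_oproj.
- exact: oproj_add.
- exact: oprojK.
- exact: oproj_orthc_vsval.
- exact: oproj_vsval_orthc.
- exact: oprojK.
- exact: vsval_norm.
Qed.

(** The shear [x |-> x - h x] flattens the graph onto [S]; since [h] depends only on the unchanged
    component in [S], adding [h] inverts it globally. *)
Lemma graph_submanifold k (alpha : R) S (f : subvs_of S -> subvs_of (orthc S)) :
  0 <= alpha <= 1 -> Cclass k.+1 alpha setT f ->
  submanifold k.+1 alpha (\dim S) (graph_of f).
Proof.
move=> a01 fC b Gb; have /andP[_ a1] := a01.
have Efin := findim_euclid R n; have Sfin := findim_subvs S.
pose h x : E := vsval (f (oproj S x)).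
have hC : Cclass k.+1 alpha setT h.
  have fpC : Cclass k.+1 alpha setT (f \o oproj S).
    apply: (CclassS_comp Efin Sfin openT openT a01 _ _ fC) => //.
    exact: Cclass_lin (@oproj_continuous R n S).
  exact: Cclass_lin_comp openT (@vsval_continuous R n (orthc S)) fpC.
have idC : Cclass k.+1 alpha setT (@id E) by exact: Cclass_id.
have ph x : oproj S (h x) = 0 by exact: oproj_vsval_orthc.
have pB x : oproj S (x - h x) = oproj S x by rewrite oprojB ph subr0.
have gK x : (x - h x) + h (x - h x) = x by rewrite /h pB subrK.
have im : (fun x => x - h x) @` setT = setT.
  apply/seteqP; split=> // x _; exists (x + h x) => //.
  by rewrite /h oprojD ph addr0 addrK.
exists setT, (fun x => x - h x), (fun x => x + h x), S; split=> //.
- split=> //.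
    apply/(of_classE _ _ _ _ Efin); split; first exact: openT.
    exact: CclassB openT idC hC.
  rewrite im; apply/(of_classE _ _ _ _ Efin); split; first exact: openT.
  exact: CclassD openT idC hC.
rewrite im !setIT; apply/seteqP; split=> [_ [x Gx <-]|s sS].
  rewrite /= /h -((graphP (euclid_splitting S) f x).1 Gx).
  by rewrite {1}(oproj_add S x) addrK subvsP.
exists (s + h s).
  apply/(graphP (euclid_splitting S)).
  rewrite /= oprojD oprojD ph addr0 -{1}(oproj_id sS) oproj_orthc_vsval add0r.
  exact: oprojK.
by rewrite /h oprojD ph addr0 addrK.
Qed.

Lemma subspace_graph S :
  [set` S] = graph_of (fun=> 0 : subvs_of (orthc S)) :> set E.
Proof.
have gP := graphP (euclid_splitting S) (fun=> 0 : subvs_of (orthc S)).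
apply/seteqP; split=> x.
  by move=> xS; apply/gP; rewrite /= -[x](oproj_id xS) oproj_orthc_vsval.
move=> /gP/= xS; rewrite (oproj_add S x) xS raddf0 addr0; exact: subvsP.
Qed.

Lemma submanifold_chart k (alpha : R) m B b :
  submanifold k.+1 alpha m B -> B b -> exists (U : set E) (f g : E -> E) T,
    [/\ [/\ open U, open (f @` U), U b & \dim T = m],
        Cclass k.+1 alpha U f, Cclass k.+1 alpha (f @` U) g,
        forall x, U x -> g (f x) = x &
        f @` (B `&` U) = [set` T] `&` (f @` U)].
Proof.
have Efin := findim_euclid R n.
move=> Bm /Bm[U [f [g [T [Ub [fc gc gK] Tm fBT]]]]].
have [oU fC] := (of_classE _ _ _ _ Efin).1 fc.
have [ofU gC] := (of_classE _ _ _ _ Efin).1 gc.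
exists U, f, g, T; split; [split; assumption|exact: fC|exact: gC|exact: gK|exact: fBT].
Qed.

Definition locally_graph k (alpha : R) S a B :=
  exists2 h : subvs_of S -> subvs_of (orthc S), Cclass k alpha setT h &
    exists2 N, nbhs a N & B `&` N = graph_of h `&` N.

Section TangentPlane.
Variables (S : {vspace E}) (A B : set E) (a : E) (kappa : R).
Variables (k m : nat) (alpha : R).
Hypotheses (cA : closure A a) (kappa_ge0 : 0 <= kappa).
Hypothesis cone : forall x, A x ->
  `|oproj (orthc S) (x - a)| <= kappa * `|oproj S (x - a)|.
Hypotheses (a01 : 0 <= alpha <= 1) (Bm : submanifold k.+1 alpha m B) (Ba : B a).

(** The bound on [m] is kept apart from the graph because the submanifold attached to the shadow has
    unknown dimension; there it is one half of the dimension count. *)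
Lemma locally_graph_of_excess :
  small_on 1 0 B (fun x => `|x - a|) (fun x => dist x A) ->
  (m <= \dim S)%N /\ (m = \dim S -> locally_graph k.+1 alpha S a B).
Proof.
move=> BA; have [U [f [g [T [[oU ofU Ua Tm] fC gC gK fBT]]]]] :=
  submanifold_chart Bm Ba.
have TZ (x y : E) c : x \in T -> y \in T -> x + c *: y \in T.
  by move=> xT yT; rewrite memvD// memvZ.
have curve := chart_curve oU ofU fC gC gK Ua Ba fBT TZ.
have tr := cone_transversal (euclid_splitting S) cA kappa_ge0 cone curve BA.
have dK := chart_diffK oU fC gC gK Ua.
have dKV := chart_diffKV ofU fC gC gK Ua.
split; first by rewrite -Tm; exact: dim_transversal dK dKV tr.
rewrite -Tm => TS; apply: (local_graph a01 oU fC gK Ua Ba fBT TS).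
by move=> v Tv /oproj_orthc0; exact: tr.
Qed.

Lemma locally_graph_of_tangent :
  (forall s, tangent_cone (shadow A S) (vsval (oproj S a)) (vsval (s : subvs_of S))) ->
  small_on 1 0 A (fun x => `|x - a|) (fun x => dist x B) ->
  (\dim S <= m)%N /\ (m = \dim S -> locally_graph k.+1 alpha S a B).
Proof.
move=> tan AB; have [U [f [g [T [[oU ofU Ua Tm] fC gC gK fBT]]]]] :=
  submanifold_chart Bm Ba.
have TZ (x y : E) c : x \in T -> y \in T -> x + c *: y \in T.
  by move=> xT yT; rewrite memvD// memvZ.
have TZ1 c (v : E) : v \in T -> c *: v \in T by exact: memvZ.
have secant := chart_secant oU ofU fC gC gK Ua Ba fBT TZ.
have su := shadow_surjective (euclid_splitting S) kappa_ge0 cone Ba TZ1 tan secant AB.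
have dK := chart_diffK oU fC gC gK Ua.
have dKV := chart_diffKV ofU fC gC gK Ua.
split; first by rewrite -Tm; exact: dim_surjective dK dKV su.
rewrite -Tm => TS; apply: (local_graph a01 oU fC gK Ua Ba fBT TS).
by move=> v Tv /oproj_orthc0; exact: (surjective_transversal dK dKV su TS).
Qed.

End TangentPlane.
End EuclideanGraphs.

(** * The condition on the shadow *)

Section Shadow.
Variables (R : realType) (n : nat) (S : {vspace euclid R n}).
Local Notation E := (euclid R n).
Variables (A : set E) (a : E).
Hypothesis cA : closure A a.
Local Notation p := (oproj S a).
Local Notation D := (shadow A S).
Let sp := euclid_splitting S.

Let cD : closure D (vsval p). Proof. by have := closure_shadow sp cA; rewrite /shadow /=. Qed.

Let shadow_sub x : D x -> x \in S.
Proof. by move=> [y _ <-]; exact: subvsP. Qed.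

Let shadow_shadow : shadow D S = D.
Proof.
apply/seteqP; split=> [_ [x Dx <-]|x Dx]; first by rewrite oproj_id ?shadow_sub.
by exists x => //; rewrite oproj_id ?shadow_sub.
Qed.

(** For [w] in [S], a shadow point close to [p + t w], rescaled by [1 / t], approximates [w]. The
    other inclusion holds because rescaled secants of the shadow stay in [S]. *)
Lemma small_shadow_tangent :
  small_on 1 0 setT (fun s => `|s - p|) (fun s => dist (vsval s) D) ->
  tangent_cone D (vsval p) = [set` S].
Proof.
move=> sm; apply/seteqP; split=> [v tv|v vS e e0].
  suff : oproj (orthc S) v = 0.
    by move=> h; rewrite (oproj_add S v) h raddf0 addr0; exact: subvsP.
  apply/eqP; rewrite -normr_le0; apply/ler_addgt0Pl => e e0; rewrite addr0.
  have [x [r [Dx r0 _ xv]]] := tv e e0.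
  have wS : r *: (x - vsval p) \in S.
    by rewrite memvZ// memvB//; [exact: shadow_sub|exact: subvsP].
  have -> : oproj (orthc S) v = - oproj (orthc S) (r *: (x - vsval p) - v).
    by rewrite oprojB -(oproj_id wS) oproj_orthc_vsval sub0r opprK.
  by rewrite normrN; apply: le_trans (oproj_norm_le _ _) _; exact: ltW.
set w := oproj S v; have vw : vsval w = v by exact: oproj_id.
have w1 : 0 < `|w| + 1 by rewrite ltr_wpDl.
have [b [Db _]] := closure_dist cD ltr01.
(* The distance bound [e' * t * |w|] and the slack [e' * t] add up to [t * (e / 2)]. *)
pose e' := e / 2 / (`|w| + 1); have e'0 : 0 < e' by rewrite !divr_gt0.
have [d d0 dP] := small_on_littleo (lexx 0) (fun s => normr_ge0 (s - p)) sm e'0.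
pose m := Num.min (Num.min (d / 2) (e / 3)) 1; pose t := m / (`|w| + 1).
have t0 : 0 < t by rewrite divr_gt0// !lt_min !divr_gt0/=.
have tE : t * (`|w| + 1) = m by rewrite divfK// gt_eqF.
have tw : t * `|w| <= m.
  by rewrite -tE ler_wpM2l ?(ltW t0)// lerDl.
have td : t * `|w| <= d / 2 by apply: le_trans tw _; rewrite !ge_min lexx.
have te : t * `|w| <= e / 3 by apply: le_trans tw _; rewrite !ge_min lexx orbT.
pose s := p + t *: w.
have sp' : `|s - p| = t * `|w| by rewrite addrC addKr normrZ gtr0_norm.
have := dP s I; rewrite sp' => /(_ ltac:(lra)); rewrite expr1 => ds.
have et0 : 0 < e' * t by rewrite mulr_gt0.
have [x [Dx sx]] := dist_adherent (vsval s) Db et0.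
have e't : e' * t * (`|w| + 1) = t * (e / 2) by rewrite mulrAC divfK ?gt_eqF// mulrC.
have xs : `|x - vsval s| <= t * (e / 2).
  rewrite distrC -e't; apply: le_trans (ltW sx) _; lra.
have t1 : t * (e / 2) <= e / 2.
  rewrite ler_piMl ?divr_ge0 ?(ltW e0)//.
  rewrite -[leLHS]mulr1; apply: (@le_trans _ _ m); last by rewrite ge_min lexx orbT.
  by rewrite -tE ler_pM2l// lerDr.
exists x, t^-1; split=> //.
- by rewrite invr_gt0.
- have := ler_distD (vsval s) x (vsval p).
  rewrite -(vsvalB s p) vsval_norm sp'; lra.
have -> : t^-1 *: (x - vsval p) - v = t^-1 *: (x - vsval s).
  rewrite /s vsvalD vsvalZ vw opprD addrA [RHS]scalerBr scalerA mulVf ?gt_eqF//.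
  by rewrite scale1r.
rewrite normrZ gtr0_norm ?invr_gt0// mulrC ltr_pdivrMr// (le_lt_trans xs)//.
by rewrite mulrC ltr_pM2r//; lra.
Qed.

(** The shadow obeys the cone condition with constant 0 and is its own shadow, so the general
    results apply to it and fix the dimension of its submanifold. Conversely, [S] itself serves as
    that submanifold. *)
Lemma shadow_small l (beta : R) : 0 <= beta <= 1 ->
  strongly_pointwise_differentiable l.+1 beta D (vsval p) /\
    tangent_cone D (vsval p) = [set` S] <->
  small_on l.+1 beta setT (fun s => `|s - p|) (fun s => dist (vsval s) D).
Proof.
move=> b01; have /andP[b0 b1] := b01; split=> [[[m [B [Bm [Bp gap1 gapl]]]] tan]|sm].
  have e2l := ((gap_small l b0 cD Bp).1 gapl).2.
  have [e11 e21] := (gap_small 0 (lexx 0) cD Bp).1 gap1.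
  have cone x : D x ->
      `|oproj (orthc S) (x - vsval p)| <= 0 * `|oproj S (x - vsval p)|.
    move=> Dx; rewrite mul0r oprojB oproj_orthc_vsval subr0.
    by rewrite -(oproj_id (shadow_sub Dx)) oproj_orthc_vsval normr0.
  have tan' (s : subvs_of S) :
      tangent_cone (shadow D S) (vsval (oproj S (vsval p))) (vsval s).
    by rewrite shadow_shadow oprojK tan; exact: subvsP.
  have [mS lg] := locally_graph_of_excess cD (lexx 0) cone b01 Bm Bp e21.
  have [Sm _] := locally_graph_of_tangent (lexx 0) cone b01 Bm Bp tan' e11.
  have [|h hC [N Np BN]] := lg; first by apply/eqP; rewrite eqn_leq mS Sm.
  have : small_on l.+1 beta setT (fun s => `|s - oproj S (vsval p)|)
      (fun s => dist (vsval s) (shadow D S)).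
    exact: (excess_shadow sp (findim_subvs S) cD b01 hC Np BN Bp b0 e2l).
  by rewrite shadow_shadow oprojK.
split; last by apply: small_shadow_tangent; exact: small_onW sm.
have pS : [set` S] (vsval p) by exact: subvsP.
have e1 : small_on l.+1 beta D (fun x => `|x - vsval p|) (fun x => dist x [set` S]).
  apply: small_on_le0 => // x Dx.
  by rewrite dist_closure//; exact/subset_closure/shadow_sub.
have e2 : small_on l.+1 beta [set` S] (fun x => `|x - vsval p|) (fun x => dist x D).
  apply: (small_on1 (c := 1) (C := 1) (d0 := 1) _ _ _ _ _ _ _ _ _ sm) => //.
  - by move=> s _; exact: dist_ge0.
  - move=> x _ /normr0_eq0/eqP; rewrite subr_eq0 => /eqP ->.
    by rewrite dist_closure.
  move=> x xS _ _ eta eta0; exists (oproj S x); split=> //.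
    by rewrite mul1r -[p in leLHS]oprojK -oprojB oproj_norm_le.
  by rewrite mul1r (oproj_id xS) lerDl ltW.
exists (\dim S), [set` S]; split.
  rewrite subspace_graph; apply: graph_submanifold b01 _; exact: Cclass_cst.
split=> //; last exact/(gap_small _ b0 cD pS).
apply/(gap_small 0 (lexx 0) cD pS).
by split; [exact: small_onW e1|exact: small_onW e2].
Qed.

End Shadow.

(** * Equivalence of the conditions *)

Section Equivalence.
Variables (R : realType) (n k : nat) (alpha kappa : R).
Local Notation E := (euclid R n).
Variables (A : set E) (a : E) (S : {vspace E}) (ver : version).
Hypotheses (a01 : 0 <= alpha <= 1) (cA : closure A a) (kappa_ge0 : 0 <= kappa).
Hypothesis cone : A `<=`
  [set x | `|oproj (orthc S) (x - a)| <= kappa * `|oproj S (x - a)|].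

Local Notation p := (oproj S a).
Let sp := euclid_splitting S.
Let Sfin := findim_subvs S.
Let a0 : 0 <= alpha. Proof. by have /andP[] := a01. Qed.

(** The order sigma is [(l.+1, beta)], just as the order gamma is [(k.+1, alpha)]; both versions are
    treated at once through these parameters. *)
Let l := if ver is Strong then k else 0%N.
Let beta := if ver is Strong then alpha else 0.

Let b01 : 0 <= beta <= 1.
Proof. by rewrite /beta; case: ver => //; rewrite lexx ler01. Qed.
Let b0 : 0 <= beta. Proof. by have /andP[] := b01. Qed.

Let weaken (T : Type) (X : set T) (rho q : T -> R) : (forall x, 0 <= rho x) ->
  small_on k.+1 alpha X rho q -> small_on l.+1 beta X rho q.
Proof. by rewrite /l /beta; case: ver => //; exact: small_onW. Qed.

Local Notation estimate :=
  (graph_estimate (oproj S) (oproj (orthc S)) A a k.+1 alpha).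
Local Notation shadow_cond := (shadow_condition ver k.+1 alpha A a S).

Let shadow_near := small_on l.+1 beta setT (fun s => `|s - p|)
  (fun s => dist (vsval s) (shadow A S)).

Let shadow_conditionE : shadow_cond <-> shadow_near.
Proof.
rewrite /shadow_near -(shadow_small S cA l b01) /shadow_condition /l /beta.
by case: ver.
Qed.

Let condition1E B : condition1 ver k.+1 alpha A a B <->
  [/\ B a, small_on k.+1 alpha A (fun x => `|x - a|) (fun x => dist x B) &
      small_on l.+1 beta B (fun x => `|x - a|) (fun x => dist x A)].
Proof.
rewrite /l /beta; case: ver => /=; split=> -[Ba].
- move=> /(gap_small 0 (lexx 0) cA Ba)[_ e2].
  by move=> /(excess_small _ a0 cA (ex_intro _ a Ba)).
- move=> e1 e2; split=> //.
    by apply/(gap_small 0 (lexx 0) cA Ba); split=> //; exact: small_onW e1.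
  exact/(excess_small _ a0 cA (ex_intro _ a Ba)).
- by move=> _ /(gap_small _ a0 cA Ba)[].
- move=> e1 e2; split=> //; last exact/(gap_small _ a0 cA Ba).
  apply/(gap_small 0 (lexx 0) cA Ba).
  by split; [exact: small_onW e1|exact: small_onW e2].
Qed.

Let condition2E B : condition2 ver k.+1 alpha A a S B <->
  [/\ shadow_cond, B a &
      small_on k.+1 alpha A (fun x => `|x - a|) (fun x => dist x B)].
Proof.
split=> -[sh Ba e1]; split=> //.
  exact/(excess_small _ a0 cA (ex_intro _ a Ba)).
exact/(excess_small _ a0 cA (ex_intro _ a Ba)).
Qed.

Lemma condition3E (f : subvs_of S -> subvs_of (orthc S)) :
  condition3 ver k.+1 alpha A a f <-> shadow_cond /\ estimate f.
Proof.
rewrite /condition3.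
have -> // : small_order k.+1 alpha (fun r => ereal_sup
    [set `|oproj (orthc S) x - f (oproj S x)|%:E
       | x in A `&` [set x | closedB (oproj S a) r (oproj S x)]]) <-> estimate f.
apply: small_order_sup => //.
  move=> r r0; have [x [Ax xa]] := closure_dist cA r0; exists x => //.
  by rewrite -oprojB; apply: le_trans (oproj_norm_le _ _) (ltW xa).
move=> r r0; congr ereal_sup; apply/seteqP.
by split=> _ [x [Ax xr] <-]; exists x => //; split=> //; move: xr;
  rewrite /closedB/closed_ball_/= distrC.
Qed.

Section LocalGraph.
Variables (B : set E) (f : subvs_of S -> subvs_of (orthc S)) (N : set E).
Hypotheses (fC : Cclass k.+1 alpha setT f).
Hypotheses (Na : nbhs a N) (BN : B `&` N = graph_of f `&` N).

Let Ba : estimate f -> B a.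
Proof.
move=> fE; have fp := graph_estimate_value sp Sfin cA a01 fC fE.
suff : (B `&` N) a by case.
rewrite BN; split; last exact: nbhs_singleton.
exact/(graphP sp).
Qed.

(** For a local graph, (1) and (2) both reduce to the shadow condition together with the estimate on
    A, which is what (3) says. *)
Lemma graph_condition1 :
  condition1 ver k.+1 alpha A a B <-> shadow_cond /\ estimate f.
Proof.
rewrite condition1E shadow_conditionE; split=> [[Ba' e1 e2]|[sh fE]].
  split; first exact: (excess_shadow sp Sfin cA a01 fC Na BN Ba' b0 e2).
  exact/(excess_graph sp Sfin kappa_ge0 cone a01 fC Na BN Ba' _ a0).
have Ba' := Ba fE; split=> //.
  exact/(excess_graph sp Sfin kappa_ge0 cone a01 fC Na BN Ba' _ a0).
apply: (shadow_excess sp Sfin cA a01 fC Na BN b0) sh.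
exact: weaken fE.
Qed.

Lemma graph_condition2 :
  condition2 ver k.+1 alpha A a S B <-> shadow_cond /\ estimate f.
Proof.
rewrite condition2E; split=> [[sh Ba' e1]|[sh fE]].
  split=> //.
  exact/(excess_graph sp Sfin kappa_ge0 cone a01 fC Na BN Ba' _ a0).
have Ba' := Ba fE; split=> //.
exact/(excess_graph sp Sfin kappa_ge0 cone a01 fC Na BN Ba' _ a0).
Qed.

End LocalGraph.

Section Submanifold.
Variable B : set E.
Hypothesis Bm : submanifold k.+1 alpha (\dim S) B.

Lemma condition1_graph :
  condition1 ver k.+1 alpha A a B -> locally_graph k.+1 alpha S a B.
Proof.
move=> /condition1E[Ba _ e2].
have e21 := small_onW b0 (fun x => normr_ge0 (x - a)) e2.
by have [_] := locally_graph_of_excess cA kappa_ge0 cone a01 Bm Ba e21; apply.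
Qed.

Lemma condition2_graph :
  condition2 ver k.+1 alpha A a S B -> locally_graph k.+1 alpha S a B.
Proof.
move=> c2; have [[_ tan] _ _] := c2; have [_ Ba e1] := (condition2E B).1 c2.
have tan' s : tangent_cone (shadow A S) (vsval p) (vsval (s : subvs_of S)).
  by rewrite tan; exact: subvsP.
have e11 := small_onW a0 (fun x => normr_ge0 (x - a)) e1.
by have [_] := locally_graph_of_tangent kappa_ge0 cone a01 Bm Ba tan' e11; apply.
Qed.

End Submanifold.
End Equivalence.

Theorem theorem3p11 (R : realType) (k n m : nat) (alpha kappa : R)
    (A : set (euclid R n)) (a : euclid R n) (S : {vspace euclid R n})
    (ver : version)
    (k_gt0 : (0 < k)%N) (n_gt0 : (0 < n)%N) (m_le_n : (m <= n)%N)
    (alpha_01 : 0 <= alpha <= 1) (a_clos : closure A a) (dimS : \dim S = m)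
    (kappa_ge0 : 0 <= kappa)
    (A_cone : A `<=`
       [set x | `|oproj (orthc S) (x - a)| <= kappa * `|oproj S (x - a)|]) :
  [/\ (exists B, submanifold k alpha m B /\ condition1 ver k alpha A a B) <->
      (exists B, submanifold k alpha m B /\ condition2 ver k alpha A a S B),
      (exists B, submanifold k alpha m B /\ condition2 ver k alpha A a S B) <->
      (exists f : subvs_of S -> subvs_of (orthc S),
         of_class k alpha setT f /\ condition3 ver k alpha A a f) &
      (exists B, submanifold k alpha m B /\ condition1 ver k alpha A a B) ->
      exists P : subvs_of S -> subvs_of (orthc S),
        [/\ (* P depends only on k, A, a, S *)
            forall (ver' : version) (alpha' : R)
                (f : subvs_of S -> subvs_of (orthc S)),
              0 <= alpha' <= 1 -> of_class k alpha' setT f ->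
              condition3 ver' k alpha' A a f -> jet k f (oproj S a) = P,
            forall B, submanifold k alpha m B ->
              condition1 ver k alpha A a B <->
              local_graph_with_jet k alpha a B P,
            forall B, submanifold k alpha m B ->
              condition2 ver k alpha A a S B <->
              local_graph_with_jet k alpha a B P &
            forall f : subvs_of S -> subvs_of (orthc S),
              of_class k alpha setT f ->
              condition3 ver k alpha A a f <-> jet k f (oproj S a) = P]].
Proof.
case: k k_gt0 => [|k _]; first by rewrite ltnn.
have /andP[a0 a1] := alpha_01.
have Sfin := findim_subvs S; have sp := euclid_splitting S.
pose estimate := graph_estimate (oproj S) (oproj (orthc S)) A a k.+1 alpha.
pose sh := shadow_condition ver k.+1 alpha A a S.
have classE (beta : R) (f : subvs_of S -> subvs_of (orthc S)) :
    of_class k.+1 beta setT f <-> Cclass k.+1 beta setT f.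
  rewrite (of_classE _ _ _ _ Sfin); split=> [[]|] //.
  by split=> //; exact: openT.
have c1E B f N (fC : Cclass k.+1 alpha setT f) :=
  @graph_condition1 R n k alpha kappa A a S ver alpha_01 a_clos kappa_ge0 A_cone
    B f N fC.
have c2E B f N (fC : Cclass k.+1 alpha setT f) :=
  @graph_condition2 R n k alpha kappa A a S ver alpha_01 a_clos kappa_ge0 A_cone
    B f N fC.
have c3E (f : subvs_of S -> subvs_of (orthc S)) := condition3E k ver alpha_01 a_clos f.
have c1g B (Bm : submanifold k.+1 alpha m B) :
    condition1 ver k.+1 alpha A a B <-> exists f, [/\ Cclass k.+1 alpha setT f,
      exists2 N, nbhs a N & B `&` N = graph_of f `&` N, sh & estimate f].
  split=> [c1|[f [fC [N Na BN] shA fE]]]; last exact/(c1E _ _ _ fC Na BN).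
  rewrite -dimS in Bm.
  have [f fC [N Na BN]] := condition1_graph alpha_01 a_clos kappa_ge0 A_cone Bm c1.
  have [shA fE] := (c1E _ _ _ fC Na BN).1 c1.
  by exists f; split=> //; exists N.
have c2g B (Bm : submanifold k.+1 alpha m B) :
    condition2 ver k.+1 alpha A a S B <-> exists f, [/\ Cclass k.+1 alpha setT f,
      exists2 N, nbhs a N & B `&` N = graph_of f `&` N, sh & estimate f].
  split=> [c2|[f [fC [N Na BN] shA fE]]]; last exact/(c2E _ _ _ fC Na BN).
  rewrite -dimS in Bm.
  have [f fC [N Na BN]] := condition2_graph alpha_01 a_clos kappa_ge0 A_cone Bm c2.
  have [shA fE] := (c2E _ _ _ fC Na BN).1 c2.
  by exists f; split=> //; exists N.
have c12 B (Bm : submanifold k.+1 alpha m B) :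
    condition1 ver k.+1 alpha A a B <-> condition2 ver k.+1 alpha A a S B.
  by rewrite (c1g _ Bm) (c2g _ Bm).
have c23 : (exists B, submanifold k.+1 alpha m B /\
      condition2 ver k.+1 alpha A a S B) <->
    (exists f : subvs_of S -> subvs_of (orthc S),
       of_class k.+1 alpha setT f /\ condition3 ver k.+1 alpha A a f).
  split=> [[B [Bm /(c2g _ Bm)[f [fC _ shA fE]]]]|[f [/classE fC /c3E[shA fE]]]].
    by exists f; split; [exact/classE|exact/c3E].
  (* For the passage from (3) back to (2) the submanifold is the whole graph of [f]. *)
  have Gm : submanifold k.+1 alpha m (graph_of f).
    by rewrite -dimS; exact: graph_submanifold.
  exists (graph_of f); split=> //; apply/(c2g _ Gm); exists f; split=> //.
  by exists setT => //; exact: filterT.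
split=> //.
  by split=> -[B [Bm cB]]; exists B; split=> //; exact/(c12 _ Bm).
move=> [B0 [B0m /(c1g _ B0m)[f0 [f0C _ shA f0E]]]].
have tan (s : subvs_of S) :
    tangent_cone (shadow A S) (vsval (oproj S a)) (vsval s).
  by have [_ ->] := shA; exact: subvsP.
(* The exponent [beta] is arbitrary, and of the shadow condition only the tangent cone enters; hence
   the jet of [f0] serves every exponent and both versions. *)
have unique (beta : R) f : 0 <= beta <= 1 -> Cclass k.+1 beta setT f ->
    graph_estimate (oproj S) (oproj (orthc S)) A a k.+1 beta f ->
    jet k.+1 f (oproj S a) = jet k.+1 f0 (oproj S a).
  move=> b01 fC fE.
  exact: (graph_estimate_unique sp Sfin b01 alpha_01 fC f0C fE f0E tan).
have jetE f : Cclass k.+1 alpha setT f ->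
    jet k.+1 f (oproj S a) = jet k.+1 f0 (oproj S a) <-> estimate f.
  move=> fC; split=> [/esym f0f|]; last exact: unique.
  exact: (graph_estimate_jet sp Sfin a_clos A_cone alpha_01 f0C fC f0f f0E).
have localE B :
    (exists f, [/\ Cclass k.+1 alpha setT f,
      exists2 N, nbhs a N & B `&` N = graph_of f `&` N, sh & estimate f]) <->
    local_graph_with_jet k.+1 alpha a B (jet k.+1 f0 (oproj S a)).
  split=> -[f]; first by move=> [fC BN _ /(jetE _ fC) fJ]; exists f; split=> //; exact/classE.
  by move=> [/classE fC BN /(jetE _ fC) fE]; exists f.
exists (jet k.+1 f0 (oproj S a)); split.
- move=> ver' beta f b01 /classE fC.
  by move=> /(condition3E k ver' b01 a_clos)[_]; exact: unique.
- by move=> B Bm; rewrite (c1g _ Bm).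
- by move=> B Bm; rewrite (c2g _ Bm).
move=> f /classE fC; rewrite c3E (jetE _ fC).
by split=> [[]|].
Qed.
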